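(* Let $\rho:\Gamma\to GL_4(\mathbb{C})$ be a $T$-determined, $T$-unitarizable representation, $\upsilon$ a multiplier system with cusp parameter $m$, and let $\lambda_1,\dots,\lambda_4$, $k_0$, $F_0$ and $\rho_0$ be as in the context. Then: (i) $\mathcal{H}(\rho_0,\upsilon)=\bigoplus_{k\ge0}\mathcal{H}(k_0+2k,\rho_0,\upsilon)$, and $\mathcal{H}(k_0,\rho_0,\upsilon)$ contains the vector $F_0$, whose components form a fundamental system of solutions of an MLDE in weight $k_0$; (ii) $\mathcal{H}(\rho_0,\upsilon)$ is a free $\mathcal{M}$-module of rank 4 with basis $\{F_0,DF_0,D^2F_0,D^3F_0\}$; (iii) $\mathcal{H}(\rho_0,\upsilon)=\mathcal{R}F_0$ is a cyclic $\mathcal{R}$-module; (iv) for each integer $k\ge0$, $\dim\mathcal{H}(k_0+2k,\rho_0,\upsilon)=\left[\frac{2k}{3}\right]+1$.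
   Context: $\Gamma=SL(2,\mathbb{Z})$ acts on the upper half-plane $\mathbb{H}$ by Möbius transformations; $T=\begin{pmatrix}1&1\\0&1\end{pmatrix}$; $q=e^{2\pi iz}$, $\mathbf{e}(r)=e^{2\pi ir}$; $[x]$ is the greatest integer $\le x$. Complex powers use the principal branch of $\log$. For $k\in\mathbb{R}$, a multiplier system of weight $k$ is a map $\upsilon:\Gamma\to\{|w|=1\}$ such that $\nu(\gamma,z)=\upsilon(\gamma)(cz+d)^k$ satisfies $\nu(\gamma\sigma,z)=\nu(\gamma,\sigma z)\nu(\sigma,z)$; it is also one of weight $k+n$, $n\in\mathbb{Z}$. Cusp parameter: the $m\in[0,12)$ with $\upsilon(T)=\mathbf{e}(m/12)$. Slash: $(f|_k^\upsilon\gamma)(z)=\upsilon(\gamma)^{-1}(cz+d)^{-k}f(\gamma z)$. Moderate growth: $|f(x+iy)|\le y^N$ for $y>c$. $\mathcal{H}(k,\rho,\upsilon)$: column vectors $F$ of holomorphic moderate-growth functions on $\mathbb{H}$ with $F|_k^\upsilon\gamma=\rho(\gamma)F$ for all $\gamma$; $\mathcal{H}(\rho,\upsilon)=\bigoplus_{n\in\mathbb{Z}}\mathcal{H}(k+n,\rho,\upsilon)$. $\mathcal{M}=\mathbb{C}[E_4,E_6]$ is the graded ring of holomorphic integral-weight modular forms for $\Gamma$ with trivial multiplier, acting by multiplication. $T$-unitarizable: $\rho(T)$ conjugate to a unitary matrix. An irreducible $\rho$ of dimension $d$ is $T$-determined if every indecomposable $\rho':\Gamma\to GL_d(\mathbb{C})$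 with $\rho'(T)$ having the same eigenvalues as $\rho(T)$ is irreducible. $\eta=q^{1/24}\prod_{n\ge1}(1-q^n)$, $P=\frac{i}{\pi}\frac{\eta'}{\eta}$, $D_kf=\frac{1}{2\pi i}\frac{df}{dz}+kPf$; $D$ acts on $\mathcal{H}(k,\rho,\upsilon)$ componentwise as $D_k$, $D^n=D_{k+2(n-1)}\circ\cdots\circ D_k$. An MLDE of order $n$ in weight $k$ is $D_k^nf+M_4D_k^{n-2}f+\cdots+M_{2n}f=0$, $M_{2j}\in\mathcal{M}_{2j}$; rewriting it as $q^n\frac{d^nf}{dq^n}+\sum_{j<n}q^jg_j(q)\frac{d^jf}{dq^j}=0$ with $g_j$ holomorphic at $q=0$, its indicial roots are the roots of $r(r-1)\cdots(r-n+1)+\sum_{j<n}g_j(0)r(r-1)\cdots(r-j+1)$. A fundamental system is a basis of the solution space. $\mathcal{R}=\mathcal{M}[d]$ with $dM=Md+DM$ acts by $d\cdot F=DF$; $\mathcal{R}F_0$ = all finite sums $\sum M_jD^jF_0$. Setting: write the (distinct) eigenvalues of $\rho(T)$ as $\mathbf{e}(r_1),\dots,\mathbf{e}(r_4)$ with $0\le r_1<r_2<r_3<r_4<1$; let $\lambda_j\in[0,1)$ with $\lambda_j\equiv r_j+\frac{m}{12}\pmod{\mathbb{Z}}$, $\lambda_0=\sum_j\lambda_j$, $k_0=3\lambda_0-3$. Let $L[f]=0$ be the unique fourth order MLDE (in weight $k_0$) whose indicial roots are $\lambda_1,\dots,\lambda_4$; it has a fundamental system $f_j=q^{\lambda_j}+\sum_{n\ge1}a_j(n)q^{\lambda_j+n}$,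 $j=1,\dots,4$. Put $F_0=(f_1,\dots,f_4)^t$, and let $\rho_0:\Gamma\to GL_4(\mathbb{C})$ be the representation with $F_0|_{k_0}^\upsilon\gamma=\rho_0(\gamma)F_0$ for all $\gamma\in\Gamma$ (here $\upsilon$ is a multiplier system of weight $k_0$). *)

(* Defs.v *)
From HB Require Import structures.
From mathcomp Require Import all_boot all_order all_algebra.
From mathcomp Require Import all_classical all_reals all_analysis.
From mathcomp Require Import complex.
From mathcomp Require Import Rstruct Rstruct_topology.
Import Order.TTheory GRing.Theory Num.Theory.
Import numFieldNormedType.Exports.

Set Implicit Arguments.
Unset Strict Implicit.
Unset Printing Implicit Defensive.

Local Open Scope classical_set_scope.
Local Open Scope ring_scope.
Local Open Scope complex_scope.

Definition R := Rdefinitions.R.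

(* The complex numbers, equipped with their structure of normed space over
   themselves, so that [derivable f z 1] is complex differentiability. *)
Definition C : Type := R[i].
HB.instance Definition _ := Num.ClosedField.on C.
HB.instance Definition _ := GRing.ComAlgebra.copy C C^o.
HB.instance Definition _ := Vector.copy C C^o.
HB.instance Definition _ := NormedModule.copy C C^o.

Definition RC (x : R) : C := x +i* 0.
Definition iC : C := 0 +i* 1.
Definition ReC (z : C) : R := complex.Re z.
Definition ImC (z : C) : R := complex.Im z.

Definition expC (w : C) : C :=
  RC (expR (ReC w)) * (cos (ImC w) +i* sin (ImC w)).

Definition Arg (w : C) : R :=
  let x := ReC w in let y := ImC w in
  if 0 < x then atan (y / x)
  else if x < 0 then (if 0 <= y then atan (y / x) + pi else atan (y / x) - pi)
  else if 0 < y then pi / 2 else if y < 0 then - (pi / 2) else 0.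

Definition LogC (w : C) : C :=
  ln (Num.sqrt (ReC w ^+ 2 + ImC w ^+ 2)) +i* Arg w.

Definition cpow (w : C) (k : R) : C :=
  if w == 0 then 0 else expC (RC k * LogC w).

Definition eC (w : C) : C := expC (RC (2 * pi) * iC * w).

Definition qC (z : C) : C := eC z.

(** ** The upper half-plane.  Functions on H are represented as functions
    C -> _ which vanish off H (so that equality of such functions is
    equality on H). *)
Definition inH (z : C) : bool := 0 < ImC z.

Definition i0 : 'I_2 := ord0.
Definition i1 : 'I_2 := ord_max.
Definition inSL (g : 'M[int]_2) : Prop := \det g = 1.
Definition ga (g : 'M[int]_2) : C := (g i0 i0)%:~R.
Definition gb (g : 'M[int]_2) : C := (g i0 i1)%:~R.
Definition gc (g : 'M[int]_2) : C := (g i1 i0)%:~R.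
Definition gd (g : 'M[int]_2) : C := (g i1 i1)%:~R.
Definition mob (g : 'M[int]_2) (z : C) : C := (ga g * z + gb g) / (gc g * z + gd g).
Definition Tmat : 'M[int]_2 := 1%:M + delta_mx i0 i1.

Definition nu (k : R) (ups : 'M[int]_2 -> C) (g : 'M[int]_2) (z : C) : C :=
  ups g * cpow (gc g * z + gd g) k.

Definition multiplier_system (k : R) (ups : 'M[int]_2 -> C) : Prop :=
  (forall g, inSL g -> `|ups g| = 1) /\
  (forall g h z, inSL g -> inSL h -> inH z ->
     nu k ups (g *m h) z = nu k ups g (mob h z) * nu k ups h z).

Definition cusp_parameter (ups : 'M[int]_2 -> C) (m : R) : Prop :=
  0 <= m < 12 /\ ups Tmat = eC (RC (m / 12)).

Definition is_rep (rho : 'M[int]_2 -> 'M[C]_4) : Prop :=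
  (forall g, inSL g -> rho g \in unitmx) /\
  (forall g h, inSL g -> inSL h -> rho (g *m h) = rho g *m rho h).

(* the subspace of C^4 spanned by the columns of U is rho-invariant *)
Definition invariant (rho : 'M[int]_2 -> 'M[C]_4) (U : 'M[C]_4) : Prop :=
  forall g, inSL g -> ((rho g *m U)^T <= U^T)%MS.

Definition irreducible_rep (rho : 'M[int]_2 -> 'M[C]_4) : Prop :=
  forall U, invariant rho U -> \rank U = 0%N \/ \rank U = 4%N.

Definition indecomposable_rep (rho : 'M[int]_2 -> 'M[C]_4) : Prop :=
  ~ (exists U V : 'M[C]_4, [/\ invariant rho U, invariant rho V,
        (0 < \rank U)%N, (0 < \rank V)%N &
        (\rank U + \rank V = 4)%N /\ row_full (col_mx U^T V^T)]).

Definition T_determined (rho : 'M[int]_2 -> 'M[C]_4) : Prop :=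
  irreducible_rep rho /\
  forall rho' : 'M[int]_2 -> 'M[C]_4, is_rep rho' ->
    (forall a, eigenvalue (rho' Tmat) a = eigenvalue (rho Tmat) a) ->
    indecomposable_rep rho' -> irreducible_rep rho'.

Definition unitary (U : 'M[C]_4) : Prop := U *m (map_mx Num.conj U)^T = 1%:M.

Definition T_unitarizable (rho : 'M[int]_2 -> 'M[C]_4) : Prop :=
  exists P : 'M[C]_4, P \in unitmx /\ unitary (P *m rho Tmat *m invmx P).

Definition holH (f : C -> C) : Prop :=
  (forall z, inH z -> derivable f z 1) /\ (forall z, ~~ inH z -> f z = 0).

Definition moderate_growth (f : C -> C) : Prop :=
  exists (N : nat) (c : R), forall x y : R, c < y -> `|f (x +i* y)| <= RC (y ^+ N).

Definition sigmaf (k n : nat) : nat := (\sum_(d < n.+1 | d %| n) d ^ k)%N.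

Definition E4 (z : C) : C :=
  1 + 240 * limn (series (fun n => (sigmaf 3 n.+1)%:R * qC z ^+ n.+1)).
Definition E6 (z : C) : C :=
  1 - 504 * limn (series (fun n => (sigmaf 5 n.+1)%:R * qC z ^+ n.+1)).

(* M_w : the weight-w part of M = C[E4,E6] (w : int; zero unless w = 4a+6b) *)
Definition Mform (w : int) (f : C -> C) : Prop :=
  exists c : nat -> nat -> C, forall z, inH z ->
    f z = \sum_(a < (absz w).+1) \sum_(b < (absz w).+1)
            (if (4 * a + 6 * b)%N%:Z == w then c a b * E4 z ^+ a * E6 z ^+ b else 0).

Definition eta (z : C) : C :=
  eC (z / 24) * limn (fun N => \prod_(1 <= n < N.+1) (1 - qC z ^+ n)).

Definition Pfun (z : C) : C := (iC / RC pi) * ('D_1 eta z / eta z).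

Definition Dk (k : R) (f : C -> C) : C -> C := fun z =>
  if inH z then (RC (2 * pi) * iC)^-1 * 'D_1 f z + RC k * Pfun z * f z else 0.

Fixpoint Dn (n : nat) (k : R) (f : C -> C) : C -> C :=
  match n with
  | 0 => f
  | n'.+1 => Dk (k + 2 * n'%:R) (Dn n' k f)
  end.

Definition vcomp (F : C -> 'cV[C]_4) (i : 'I_4) : C -> C := fun z => F z i ord0.

Definition DnV (n : nat) (k : R) (F : C -> 'cV[C]_4) : C -> 'cV[C]_4 :=
  fun z => \col_i Dn n k (vcomp F i) z.

Definition slash (k : R) (ups : 'M[int]_2 -> C) (g : 'M[int]_2)
  (F : C -> 'cV[C]_4) : C -> 'cV[C]_4 :=
  fun z => ((ups g)^-1 * cpow (gc g * z + gd g) (- k)) *: F (mob g z).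

Definition Hspace (k : R) (rho : 'M[int]_2 -> 'M[C]_4) (ups : 'M[int]_2 -> C)
  (F : C -> 'cV[C]_4) : Prop :=
  (forall i, holH (vcomp F i) /\ moderate_growth (vcomp F i)) /\
  (forall g z, inSL g -> inH z -> slash k ups g F z = rho g *m F z).

Definition has_dim (S : (C -> 'cV[C]_4) -> Prop) (n : nat) : Prop :=
  exists B : 'I_n -> C -> 'cV[C]_4,
    [/\ forall i, S (B i),
        (forall c : 'I_n -> C, (forall z, inH z -> \sum_i c i *: B i z = 0) ->
           forall i, c i = 0) &
        (forall F, S F -> exists c : 'I_n -> C,
           forall z, inH z -> F z = \sum_i c i *: B i z)].

Definition mlde4_op (k : R) (M4 M6 M8 : C -> C) (f : C -> C) : C -> C := fun z =>
  Dn 4 k f z + M4 z * Dn 2 k f z + M6 z * Dn 1 k f z + M8 z * f z.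

Definition is_mlde4 (M4 M6 M8 : C -> C) : Prop :=
  [/\ Mform 4 M4, Mform 6 M6 & Mform 8 M8].

Definition fundamental_system (k : R) (M4 M6 M8 : C -> C) (fs : 'I_4 -> C -> C) : Prop :=
  [/\ (forall j, holH (fs j) /\ forall z, inH z -> mlde4_op k M4 M6 M8 (fs j) z = 0),
      (forall c : 'I_4 -> C, (forall z, inH z -> \sum_j c j * fs j z = 0) ->
         forall j, c j = 0) &
      (forall f, holH f -> (forall z, inH z -> mlde4_op k M4 M6 M8 f z = 0) ->
         exists c : 'I_4 -> C, forall z, inH z -> f z = \sum_j c j * fs j z)].

(* r is an indicial root: L[q^r] = q^r (ind(r) + O(q)), so the indicial
   polynomial at r is lim_{y -> +oo} L[q^r](iy) / q^r(iy). *)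
Definition indicial_root (k : R) (M4 M6 M8 : C -> C) (r : R) : Prop :=
  (fun y : R => mlde4_op k M4 M6 M8 (fun z => eC (RC r * z)) (0 +i* y)
                / eC (RC r * (0 +i* y))) @ +oo --> (0 : C).

(* f = q^lam + sum_{n>=1} a(n) q^(lam+n) on H, with q^lam := e(lam z) *)
Definition qexp_form (lam : R) (f : C -> C) : Prop :=
  exists a : nat -> C, forall z, inH z ->
    series (fun n => a n.+1 * qC z ^+ n.+1) @ \oo --> (f z / eC (RC lam * z) - 1).

Definition fracR (x : R) : R := x - (Num.floor x)%:~R.

(* Main.v *)
(** Write [theta = (2 pi i)^-1 d/dz], so that [P = - E2 / 12].  The components of [F0] are
    [e(lam_i z)] times power series in [q], and their Wronskian matrix [X = (D^l f_i)] satisfies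
    a linear differential system of trace [lam_0 E2]; hence [det X] is a constant multiple of
    [eta ^ (24 lam_0)].  The constant is a Vandermonde determinant in the [lam_i], so [X] is
    invertible on all of H.

    No Eisenstein series is summed to obtain modularity: for [g] in SL(2,Z) the transform [Pt]
    of [P] under [g] also provides an MLDE satisfied by [F0], and comparing the coefficients of
    [D^3 F0] gives [12 lam_0 (Pt - P) = 0].  Ramanujan's equations [E4 = E2^2 - 12 theta E2] and
    [E6 = E2 E4 - 3 theta E4], which are convolution identities for divisor sums, carry this over
    to [E4] and [E6].

    By Cramer's rule a vector of weight [k0 + n] is a combination of [F0, .., D^3 F0] with
    coefficients that are holomorphic, bounded at infinity (here [lam_i < 1] is used) and modular
    of weight [n - 2 j].  Scalar modular forms are polynomials in [E4] and [E6]: invariant functions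
    vanishing at infinity are zero by the maximum principle, and forms vanishing at infinity are
    divisible by [eta ^ 24]. *)
Require Import Defs.
From HB Require Import structures.
From mathcomp Require Import all_boot all_order all_algebra.
From mathcomp Require Import all_classical all_reals all_analysis.
From mathcomp Require Import complex.
From mathcomp Require Import Rstruct Rstruct_topology.
From mathcomp Require Import ring lra zify perm.
From Coquelicot Require RInt Continuity Derive Hierarchy.
Import Order.TTheory GRing.Theory Num.Theory.
Import numFieldNormedType.Exports.
Set Implicit Arguments.
Unset Strict Implicit.
Unset Printing Implicit Defensive.
Local Open Scope classical_set_scope.
Local Open Scope ring_scope.
Local Open Scope complex_scope.

Import complex.ComplexField.Normc.

(** The weight makes the argument fit: [k0 = 3 lam_0 - 3] gives [4 k0 + 12 = 12 lam_0], the sum of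
    the weights [k0 + 2 m] for [m < 4], and this number enters twice. Divided by 12 it is the
    exponent in the equation of the Wronskian determinant, so the factors [e(lam_i z)] use up
    exactly the power [q ^ lam_0] and leave a function of [q] that does not vanish even at [q = 0].
    It is also the factor of [Pt - P] in the comparison of the two MLDEs, and it is positive because
    distinct nonnegative numbers cannot all vanish. Thus the absence of a [D^3] term in an MLDE is
    what yields the transformation law of [P]. The complex analysis rests on one device: the mean of
    a holomorphic function of period 1 over a horizontal unit segment does not depend on the height,
    by Goursat's theorem on rectangles. Discs are reached through [w -> z + r q(w)], which turns
    horizontal lines into circles, so that Taylor series, the mean value property and removable
    singularities all come from the periodic case. *)

Definition nm (z : C) : R := normc z.
Arguments nm : simpl never.

(** The norm of [C] takes its values in [C]; estimates are made with the real number [nm]. *)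
Lemma norm_nm (z : C) : `|z| = RC (nm z).
Proof. by []. Qed.

Lemma nm_def (z : C) : nm z = Num.sqrt (ReC z ^+ 2 + ImC z ^+ 2).
Proof. by case: z. Qed.

Lemma nm_ge0 (z : C) : 0 <= nm z.
Proof. by rewrite nm_def sqrtr_ge0. Qed.

Lemma nm_sqr (z : C) : nm z ^+ 2 = ReC z ^+ 2 + ImC z ^+ 2.
Proof. by rewrite nm_def sqr_sqrtr // addr_ge0 ?sqr_ge0. Qed.

Lemma nm0 : nm 0 = 0. Proof. exact: normc0. Qed.
Lemma nm1 : nm 1 = 1. Proof. exact: normc1. Qed.

Lemma nmM (x y : C) : nm (x * y) = nm x * nm y.
Proof. exact: normcM. Qed.

Lemma nmV (x : C) : nm x^-1 = (nm x)^-1.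
Proof. exact: normcV. Qed.

Lemma nm_eq0 (x : C) : (nm x == 0) = (x == 0).
Proof. by apply/eqP/eqP => [/eq0_normc|->] //; rewrite nm0. Qed.

Lemma nm_gt0 (x : C) : (0 < nm x) = (x != 0).
Proof. by rewrite lt_def nm_ge0 andbT nm_eq0. Qed.

Lemma nmN (x : C) : nm (- x) = nm x.
Proof. exact: normcN. Qed.

Lemma nmD (x y : C) : nm (x + y) <= nm x + nm y.
Proof. exact: le_normcD. Qed.

Lemma nmB (x y : C) : nm (x - y) <= nm x + nm y.
Proof. by rewrite -(nmN y) nmD. Qed.

Lemma nm_distC (x y : C) : nm (x - y) = nm (y - x).
Proof. by rewrite -nmN opprB. Qed.

Lemma nm_le_dist (x y : C) : nm x <= nm y + nm (x - y).
Proof. by rewrite -{1}(subrK y x) addrC nmD. Qed.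

Lemma nmX (x : C) n : nm (x ^+ n) = nm x ^+ n.
Proof. by elim: n => [|n IH]; rewrite ?expr0 ?nm1 // !exprS nmM IH. Qed.

(** * Real numbers inside [C], and coordinates *)

Lemma RCE (x : R) : RC x = x%:C. Proof. by []. Qed.
Lemma RC0 : RC 0 = 0. Proof. by []. Qed.
Lemma RC1 : RC 1 = 1. Proof. by []. Qed.
Lemma RCD x y : RC (x + y) = RC x + RC y. Proof. exact: (rmorphD (real_complex R)). Qed.
Lemma RCM x y : RC (x * y) = RC x * RC y. Proof. exact: (rmorphM (real_complex R)). Qed.
Lemma RCN x : RC (- x) = - RC x. Proof. exact: (rmorphN (real_complex R)). Qed.
Lemma RCB x y : RC (x - y) = RC x - RC y. Proof. exact: (rmorphB (real_complex R)). Qed.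
Lemma RCn n : RC n%:R = n%:R. Proof. exact: (rmorph_nat (real_complex R)). Qed.
Lemma RCz n : RC n%:~R = n%:~R. Proof. exact: (rmorph_int (real_complex R)). Qed.
Lemma RCV x : RC x^-1 = (RC x)^-1. Proof. exact: (fmorphV (real_complex R)). Qed.
Lemma RCX x n : RC (x ^+ n) = RC x ^+ n. Proof. exact: (rmorphXn (real_complex R)). Qed.
Lemma RC_eq0 x : (RC x == 0) = (x == 0). Proof. exact: (fmorph_eq0 (real_complex R)). Qed.
Lemma RC_inj : injective RC. Proof. by move=> x y []. Qed.

Lemma nmRC (x : R) : nm (RC x) = `|x|.
Proof. by rewrite nm_def /= expr0n addr0 sqrtr_sqr. Qed.

Lemma nm_nat n : nm n%:R = n%:R.
Proof. by rewrite -RCn nmRC normr_nat. Qed.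

Lemma ReE (x y : R) : ReC (x +i* y) = x. Proof. by []. Qed.
Lemma ImE (x y : R) : ImC (x +i* y) = y. Proof. by []. Qed.
Lemma ReD (x y : C) : ReC (x + y) = ReC x + ReC y. Proof. by case: x; case: y. Qed.
Lemma ImD (x y : C) : ImC (x + y) = ImC x + ImC y. Proof. by case: x; case: y. Qed.
Lemma ReN (x : C) : ReC (- x) = - ReC x. Proof. by case: x. Qed.
Lemma ImN (x : C) : ImC (- x) = - ImC x. Proof. by case: x. Qed.
Lemma ReM (x y : C) : ReC (x * y) = ReC x * ReC y - ImC x * ImC y.
Proof. by case: x; case: y. Qed.
Lemma ImM (x y : C) : ImC (x * y) = ReC x * ImC y + ImC x * ReC y.
Proof. by case: x; case: y. Qed.
Lemma ReRC (x : R) : ReC (RC x) = x. Proof. by []. Qed.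
Lemma ImRC (x : R) : ImC (RC x) = 0. Proof. by []. Qed.
Lemma Rei : ReC iC = 0. Proof. by []. Qed.
Lemma Imi : ImC iC = 1. Proof. by []. Qed.
Lemma Re1 : ReC 1 = 1. Proof. by []. Qed.
Lemma Im1 : ImC 1 = 0. Proof. by []. Qed.
Lemma Re0 : ReC 0 = 0. Proof. by []. Qed.
Lemma Im0 : ImC 0 = 0. Proof. by []. Qed.
Lemma Ren n : ReC n%:R = n%:R. Proof. by rewrite -RCn. Qed.
Lemma Imn n : ImC n%:R = 0. Proof. by rewrite -RCn. Qed.
Definition ReImE := (ReD, ImD, ReN, ImN, ReM, ImM, ReRC, ImRC, Rei, Imi, Re1, Im1, Re0, Im0, Ren, Imn).

Lemma CeqP (x y : C) : ReC x = ReC y -> ImC x = ImC y -> x = y.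
Proof. by case: x => a b; case: y => c d /= -> ->. Qed.

Lemma CE (z : C) : z = RC (ReC z) + iC * RC (ImC z).
Proof. by apply: CeqP; rewrite !ReImE; ring. Qed.

Lemma iC2 : iC * iC = -1 :> C.
Proof. by apply: CeqP; rewrite !ReImE; ring. Qed.

Lemma nm_i : nm iC = 1.
Proof. by rewrite nm_def Rei Imi expr0n expr1n add0r sqrtr1. Qed.

Lemma abs_Re_le (z : C) : `|ReC z| <= nm z.
Proof. by rewrite nm_def -sqrtr_sqr ler_sqrt ?lerDl ?addr_ge0 ?sqr_ge0. Qed.

Lemma abs_Im_le (z : C) : `|ImC z| <= nm z.
Proof. by rewrite nm_def -sqrtr_sqr ler_sqrt ?lerDr ?addr_ge0 ?sqr_ge0. Qed.

Lemma nm_le_ReIm (z : C) : nm z <= `|ReC z| + `|ImC z|.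
Proof.
rewrite {1}(CE z); apply: (le_trans (nmD _ _)).
by rewrite nmM nm_i mul1r !nmRC.
Qed.

Lemma nm_sum_le (I : Type) (s : seq I) (P : pred I) (F : I -> C) :
  nm (\sum_(i <- s | P i) F i) <= \sum_(i <- s | P i) nm (F i).
Proof.
elim/big_rec2: _ => [|i x y _ h]; first by rewrite nm0.
by apply: (le_trans (nmD _ _)); rewrite lerD2l.
Qed.

(** * Limits, continuity and complex derivatives in real terms *)

Definition cs (u : nat -> C) (l : C) : Prop :=
  forall e : R, 0 < e -> exists N, forall n, (N <= n)%N -> nm (u n - l) < e.

Lemma csP (u : nat -> C) (l : C) : u @ \oo --> l <-> cs u l.
Proof.
split.
  move/cvgrPdist_lt => H e e0.
  have /H : 0 < RC e by rewrite ltcR.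
  case=> N _ HN; exists N => n nN; have := HN n nN.
  by rewrite /= norm_nm ltcR nm_distC.
move=> H; apply/cvgrPdist_lt => e e0.
have eE : e = RC (ReC e).
  by apply: CeqP => //; rewrite ImRC; move: e0; rewrite ltcE => /andP[/eqP].
have r0 : 0 < ReC e by move: e0; rewrite ltcE => /andP[_].
have [N HN] := H _ r0; exists N => // n nN; have := HN n nN.
by rewrite /= eE norm_nm ltcR nm_distC.
Qed.

Lemma cs_unique u l l' : cs u l -> cs u l' -> l = l'.
Proof.
move=> h h'; apply/eqP; rewrite -subr_eq0 -nm_eq0; apply/eqP.
apply/eqP; rewrite eq_le nm_ge0 andbT leNgt; apply/negP => p.
have q : 0 < nm (l - l') / 2 by rewrite divr_gt0.
have [N HN] := h _ q; have [N' HN'] := h' _ q.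
have := HN _ (leq_maxl N N'); have := HN' _ (leq_maxr N N').
set v := u _; have := nmB (v - l') (v - l).
rewrite (_ : v - l' - (v - l) = l - l'); last by ring.
lra.
Qed.

Lemma limn_cs (u : nat -> C) l : cs u l -> limn u = l.
Proof. by move/csP/cvg_lim; apply; apply: norm_hausdorff. Qed.

(** The neighbourhood filter of [z], with real radii. *)
Definition nb (z : C) (P : C -> Prop) : Prop :=
  exists2 d : R, 0 < d & forall w, nm (w - z) < d -> P w.

Definition cts (f : C -> C) (z : C) : Prop :=
  forall e : R, 0 < e -> nb z (fun w => nm (f w - f z) < e).

Lemma nb_and z P Q : nb z P -> nb z Q -> nb z (fun w => P w /\ Q w).
Proof.
move=> [d d0 hd] [c c0 hc]; exists (Num.min d c); first by rewrite lt_min d0.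
by move=> w; rewrite lt_min => /andP[/hd ? /hc ?].
Qed.

Lemma nb_imp z (P Q : C -> Prop) : (forall w, P w -> Q w) -> nb z P -> nb z Q.
Proof. by move=> PQ [d d0 hd]; exists d => // w /hd /PQ. Qed.

Lemma nb_true z (P : C -> Prop) : (forall w, P w) -> nb z P.
Proof. by move=> h; exists 1. Qed.

Lemma nb_self z P : nb z P -> P z.
Proof. by case=> d d0; apply; rewrite subrr nm0. Qed.

Lemma cts_loc f g z : nb z (fun w => f w = g w) -> cts g z -> cts f z.
Proof.
move=> h cg e e0; have := nb_and h (cg e e0); have -> := nb_self h.
by apply: nb_imp => w [->].
Qed.

Lemma cts_cst (a z : C) : cts (fun=> a) z.
Proof. by move=> e e0; apply: nb_true => w; rewrite subrr nm0. Qed.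

Lemma cts_id (z : C) : cts id z.
Proof. by move=> e e0; exists e. Qed.

Lemma ctsD f g z : cts f z -> cts g z -> cts (fun w => f w + g w) z.
Proof.
move=> cf cg e e0; have e2 : 0 < e / 2 by rewrite divr_gt0.
apply: nb_imp (nb_and (cf _ e2) (cg _ e2)) => w [h1 h2].
have := nmD (f w - f z) (g w - g z).
by rewrite addrACA -opprD; lra.
Qed.

Lemma ctsM f g z : cts f z -> cts g z -> cts (fun w => f w * g w) z.
Proof.
move=> cf cg e e0; set A := nm (f z); set B := nm (g z).
have A0 : 0 <= A := nm_ge0 _; have B0 : 0 <= B := nm_ge0 _.
pose d := Num.min 1 (e / (2 + A + B)).
have q0 : 0 < 2 + A + B by lra.
have d0 : 0 < d by rewrite lt_min ltr01 divr_gt0.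
have d1 : d <= 1 by rewrite ge_min lexx.
have dq : d * (2 + A + B) <= e.
  by rewrite -ler_pdivlMr // ge_min lexx orbT.
apply: nb_imp (nb_and (cf _ d0) (cg _ d0)) => w [h1 h2].
have -> : f w * g w - f z * g z =
  (f w - f z) * (g w - g z) + (f z * (g w - g z) + (f w - f z) * g z) by ring.
have n1 := nmD ((f w - f z) * (g w - g z)) (f z * (g w - g z) + (f w - f z) * g z).
have n2 := nmD (f z * (g w - g z)) ((f w - f z) * g z).
move: n1 n2; rewrite !nmM -/A -/B => n1 n2.
have a0 := nm_ge0 (f w - f z); have b0 := nm_ge0 (g w - g z).
have e1 : nm (f w - f z) * nm (g w - g z) <= nm (f w - f z).
  by rewrite ler_piMr //; lra.
have e2 : A * nm (g w - g z) <= A * d by apply: ler_wpM2l => //; exact: ltW.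
have e3 : nm (f w - f z) * B <= d * B by apply: ler_wpM2r => //; exact: ltW.
clearbody d A B; apply: (le_lt_trans n1). lra.
Qed.

Lemma ctsV f z : cts f z -> f z != 0 -> cts (fun w => (f w)^-1) z.
Proof.
move=> cf; rewrite -nm_gt0; set A := nm (f z) => A0 e e0.
pose d := Num.min (A / 2) (e * A ^+ 2 / 2).
have d0 : 0 < d by rewrite lt_min !divr_gt0 ?mulr_gt0 ?exprn_gt0.
apply: nb_imp (cf _ d0) => w h.
have dA : d <= A / 2 by rewrite ge_min lexx.
have de : d <= e * A ^+ 2 / 2 by rewrite ge_min lexx orbT.
have hw : A / 2 < nm (f w).
  have := nm_le_dist (f z) (f w); rewrite nm_distC -/A; lra.
have fw0 : f w != 0 by rewrite -nm_gt0; lra.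
have fz0 : f z != 0 by rewrite -nm_gt0.
have -> : (f w)^-1 - (f z)^-1 = (f z - f w) / (f w * f z) by field; rewrite ?fw0 ?fz0.
rewrite nmM nmV nmM -/A nm_distC ltr_pdivrMr; last by apply: mulr_gt0; lra.
apply: (lt_le_trans h); apply: (le_trans de).
have hw' : 0 <= nm (f w) - A / 2 by lra.
have := mulr_ge0 (mulr_ge0 (ltW e0) (ltW A0)) hw'; rewrite expr2; lra.
Qed.

Lemma cts_comp f g z : cts f z -> cts g (f z) -> cts (fun w => g (f w)) z.
Proof.
move=> cf cg e e0; have [d d0 hd] := cg e e0.
by apply: nb_imp (cf d d0) => w /hd.
Qed.

Lemma cts_neq0 f z : cts f z -> f z != 0 -> nb z (fun w => f w != 0).
Proof.
move=> cf f0; apply: nb_imp (cf (nm (f z)) _) => [w|]; last by rewrite nm_gt0.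
apply: contraTneq => ->; by rewrite add0r nmN ltxx.
Qed.

Lemma cts_cs f (u : nat -> C) z : cts f z -> cs u z -> cs (fun n => f (u n)) (f z).
Proof.
move=> cf cu e e0; have [d d0 hd] := cf e e0; have [N HN] := cu d d0.
by exists N => n /HN /hd.
Qed.

Lemma csD u v a b : cs u a -> cs v b -> cs (fun n => u n + v n) (a + b).
Proof.
move=> cf cg e e0; have e2 : 0 < e / 2 by rewrite divr_gt0.
have [N HN] := cf _ e2; have [M HM] := cg _ e2.
exists (maxn N M) => n; rewrite geq_max => /andP[/HN h1 /HM h2].
have := nmD (u n - a) (v n - b).
by rewrite addrACA -opprD; lra.
Qed.

Lemma cs_cst a : cs (fun=> a) a.
Proof. by move=> e e0; exists 0%N => n _; rewrite subrr nm0. Qed.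

Lemma csZ u a b : cs u a -> cs (fun n => b * u n) (b * a).
Proof. by apply: cts_cs; apply: ctsM; [exact: cts_cst|exact: cts_id]. Qed.

Lemma cs_ext u v a : (forall n, u n = v n) -> cs u a -> cs v a.
Proof. by move=> h; rewrite (_ : v = u) //; apply/funext => n. Qed.

Lemma cs_shift u a k : cs u a <-> cs (fun n => u (n + k)%N) a.
Proof.
split=> h e e0; have [N HN] := h e e0.
  by exists N => n nN; apply: HN; rewrite (leq_trans nN) // leq_addr.
exists (N + k)%N => n nN; rewrite -(@subnK k n); last by rewrite (leq_trans _ nN) // leq_addl.
by apply: HN; rewrite leq_subRL ?(leq_trans _ nN) ?leq_addl // addnC.
Qed.

Lemma csM u v a b : cs u a -> cs v b -> cs (fun n => u n * v n) (a * b).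
Proof.
move=> cu cv.
have h1 : cs (fun n => (u n - a) * (v n - b)) 0.
  move=> e e0; have m0 : 0 < Num.min 1 e by rewrite lt_min ltr01 e0.
  have [N HN] := cu _ m0; have [M HM] := cv 1 ltr01.
  exists (maxn N M) => n; rewrite geq_max => /andP[/HN + /HM h2].
  rewrite subr0 nmM lt_min => /andP[_ h1].
  have a0 := nm_ge0 (u n - a); apply: le_lt_trans h1.
  by rewrite ler_piMr // ltW.
have h2 : cs (fun n => a * (v n - b)) 0.
  by have := csZ a (csD cv (cs_cst (- b))); rewrite subrr mulr0.
have h3 : cs (fun n => b * (u n - a)) 0.
  by have := csZ b (csD cu (cs_cst (- a))); rewrite subrr mulr0.
have := csD (csD (csD h1 h2) h3) (cs_cst (a * b)); rewrite !add0r.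
by apply: cs_ext => n; ring.
Qed.

(* Caratheodory's form of complex differentiability: with it the chain and product rules need
   no case distinction. *)
Definition isd (f : C -> C) (z l : C) : Prop :=
  exists phi : C -> C, [/\ cts phi z, phi z = l & forall w, f w = f z + phi w * (w - z)].

(** The factor [phi] is the difference quotient, completed by [l] at [z]; its continuity at [z] is
    the usual first-order estimate. *)
Lemma isdP f z l : isd f z l <->
  forall e : R, 0 < e -> nb z (fun w => nm (f w - f z - l * (w - z)) <= e * nm (w - z)).
Proof.
split.
  move=> [phi [cphi <- hf]] e e0; apply: nb_imp (cphi e e0) => w h.
  rewrite hf (_ : _ - _ = (phi w - phi z) * (w - z)); last by ring.
  by rewrite nmM ler_wpM2r ?nm_ge0 // ltW.
move=> h; exists (fun w => if w == z then l else (f w - f z) / (w - z)).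
split; rewrite ?eqxx //.
  move=> e e0; rewrite eqxx; have e2 : 0 < e / 2 by rewrite divr_gt0.
  apply: nb_imp (h _ e2) => w hh; case: eqP => [_|/eqP wz]; first by rewrite subrr nm0.
  move: hh.
  have wz' : w - z != 0 by rewrite subr_eq0.
  rewrite (_ : _ - _ - _ = ((f w - f z) / (w - z) - l) * (w - z)); last by field.
  rewrite nmM ler_pM2r ?nm_gt0 // => hh; apply: (le_lt_trans hh); lra.
move=> w; case: eqP => [->|/eqP wz]; first by ring.
by field; rewrite subr_eq0.
Qed.

Lemma isd_cts f z l : isd f z l -> cts f z.
Proof.
move=> [phi [cphi _ hf]]; have : cts (fun w => f z + phi w * (w - z)) z.
  apply: ctsD (cts_cst _ _) _; apply: ctsM => //; apply: ctsD (cts_id _) (cts_cst _ _).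
by apply: cts_loc; apply: nb_true.
Qed.

Lemma isd_loc f g z l : nb z (fun w => f w = g w) -> isd g z l -> isd f z l.
Proof.
move=> h /isdP hg; apply/isdP => e e0; have := nb_and h (hg e e0); have -> := nb_self h.
by apply: nb_imp => w [->].
Qed.

Lemma isd_eq f z l l' : isd f z l -> l = l' -> isd f z l'.
Proof. by move=> ? <-. Qed.

Lemma isd_cst a z : isd (fun=> a) z 0.
Proof. by exists (fun=> 0); split=> [|//|w]; [exact: cts_cst|ring]. Qed.

Lemma isd_id z : isd id z 1.
Proof. by exists (fun=> 1); split=> [|//|w]; [exact: cts_cst|rewrite /=; ring]. Qed.

Lemma isdD f g z a b : isd f z a -> isd g z b -> isd (fun w => f w + g w) z (a + b).
Proof.
move=> [p [cp <- hf]] [q [cq <- hg]]; exists (fun w => p w + q w); split=> //.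
  exact: ctsD.
by move=> w; rewrite hf hg; ring.
Qed.

Lemma isdM f g z a b : isd f z a -> isd g z b ->
  isd (fun w => f w * g w) z (a * g z + f z * b).
Proof.
move=> hf' hg'; have cg := isd_cts hg'.
move: hf' hg' => [p [cp <- hf]] [q [cq <- hg]].
exists (fun w => p w * g w + f z * q w); split=> //.
  by apply: ctsD; apply: ctsM => //; exact: cts_cst.
move=> w; rewrite (hf w) (hg w); ring.
Qed.

Lemma isdZ f z a b : isd f z a -> isd (fun w => b * f w) z (b * a).
Proof. by move=> h; apply: isd_eq (isdM (isd_cst b z) h) _; ring. Qed.

Lemma isdN f z a : isd f z a -> isd (fun w => - f w) z (- a).
Proof.
move=> h; apply: isd_loc (isd_eq (isdZ (-1) h) _); last by ring.
by apply: nb_true => w /=; ring.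
Qed.

Lemma isdB f g z a b : isd f z a -> isd g z b -> isd (fun w => f w - g w) z (a - b).
Proof. by move=> hf hg; apply: isdD hf (isdN hg). Qed.

Lemma isd_comp f g z a b : isd f z a -> isd g (f z) b -> isd (fun w => g (f w)) z (b * a).
Proof.
move=> hf' [q [cq <- hg]]; have cf := isd_cts hf'; case: hf' => p [cp <- hf].
exists (fun w => q (f w) * p w); split=> //.
  by apply: ctsM => //; exact: cts_comp cf cq.
move=> w; rewrite hg; have e : f w - f z = p w * (w - z) by rewrite (hf w); ring.
by rewrite e mulrA.
Qed.

Lemma isdV f z a : isd f z a -> f z != 0 -> isd (fun w => (f w)^-1) z (- a / f z ^+ 2).
Proof.
move=> hf' f0; have cf := isd_cts hf'; have [p [cp <- hf]] := hf'.
pose g w := (f z)^-1 + (- p w / (f w * f z)) * (w - z).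
have : isd g z (- p z / f z ^+ 2).
  exists (fun w => - p w / (f w * f z)); split; rewrite ?expr2 //.
    apply: ctsM.
      apply: cts_loc (ctsM (cts_cst (-1) z) cp); apply: nb_true => w /=; ring.
    by apply: ctsV; [apply: ctsM => //; exact: cts_cst | rewrite mulf_neq0].
  by move=> w; rewrite /g subrr mulr0 addr0.
apply: isd_loc; apply: nb_imp (cts_neq0 cf f0) => w fw0; rewrite /g.
have e : p w * (w - z) = f w - f z by rewrite (hf w); ring.
rewrite (_ : - p w / (f w * f z) * (w - z) = - (p w * (w - z)) / (f w * f z)); last by ring.
by rewrite e; field; rewrite ?fw0 ?f0.
Qed.

Lemma isd_div f g z a b : isd f z a -> isd g z b -> g z != 0 ->
  isd (fun w => f w / g w) z ((a * g z - f z * b) / g z ^+ 2).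
Proof.
move=> hf hg g0; apply: isd_eq (isdM hf (isdV hg g0)) _.
by field.
Qed.

Lemma isdX f z a n : isd f z a -> isd (fun w => f w ^+ n) z (n%:R * f z ^+ n.-1 * a).
Proof.
move=> hf; elim: n => [|n IH].
  by apply: isd_eq (isd_cst 1 z) _; rewrite mul0r mul0r.
apply: isd_loc (isd_eq (isdM hf IH) _); first by apply: nb_true => w; rewrite exprS.
by case: n {IH} => [|n] /=; rewrite ?exprS; [ring|rewrite -!natr1; ring].
Qed.

Lemma isd_sum (I : Type) (s : seq I) (f : I -> C -> C) z (a : I -> C) :
  (forall i, isd (f i) z (a i)) ->
  isd (fun w => \sum_(i <- s) f i w) z (\sum_(i <- s) a i).
Proof.
move=> h; elim: s => [|i s IH].
  by rewrite big_nil; apply: isd_loc (isd_cst 0 z); apply: nb_true => w; rewrite big_nil.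
rewrite big_cons; apply: isd_loc (isdD (h i) IH).
by apply: nb_true => w; rewrite big_cons.
Qed.

Lemma isd_unique f z a b : isd f z a -> isd f z b -> a = b.
Proof.
move=> /isdP ha /isdP hb; apply/eqP; rewrite -subr_eq0 -nm_eq0 eq_le nm_ge0 andbT leNgt.
apply/negP => p; have q : 0 < nm (a - b) / 4 by rewrite divr_gt0.
have [d d0 hd] := nb_and (ha _ q) (hb _ q).
have ex : z + RC (d / 2) - z = RC (d / 2) by ring.
have nx : nm (RC (d / 2)) = d / 2 by rewrite nmRC gtr0_norm ?divr_gt0.
have hw : nm (z + RC (d / 2) - z) < d by rewrite ex nx; lra.
have [] := hd _ hw; rewrite ex nx.
set x := RC _ in nx *; set y := f _ - f _ => h1 h2.
have := nmB (y - b * x) (y - a * x).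
rewrite (_ : y - b * x - (y - a * x) = (a - b) * x); last by ring.
rewrite nmM nx; have := mulr_gt0 p d0; lra.
Qed.

Lemma derivable_isd (f : C -> C) (z : C) : derivable f z 1 -> isd f z ('D_1 f z).
Proof.
move=> h; apply/isdP => e e0.
have /cvgrPdist_lt/(_ (RC e)) := h; rewrite -[lim _]/('D_1 f z).
have -> : 0 < RC e by rewrite ltcR.
move=> /(_ isT) /nbhs_ballP[d /= d0 hd].
have eE : d = RC (ReC d).
  by apply: CeqP => //; rewrite ImRC; move: d0; rewrite ltcE => /andP[/eqP].
have r0 : 0 < ReC d by move: d0; rewrite ltcE => /andP[_].
exists (ReC d) => // w hw; have [->|wz] := eqVneq w z; first by rewrite !subrr mulr0 subr0 nm0 mulr0.
have wz' : w - z != 0 by rewrite subr_eq0.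
have := hd (w - z); rewrite /ball /= sub0r.
have -> : `|- (w - z)| < d by rewrite norm_nm eE nmN ltcR.
move=> /(_ isT wz'); rewrite norm_nm ltcR.
set x := (X in nm X) => hx.
have -> : f w - f z - 'D_1 f z * (w - z) = - (x * (w - z)).
  rewrite /x /= /shift /= -[_ *: _]/((w - z)^-1 * _) -[(w - z) *: 1]/((w - z) * 1).
  by rewrite mulr1 subrK; field.
by rewrite nmN nmM ler_wpM2r ?nm_ge0 // ltW.
Qed.

Lemma isd_cvg (f : C -> C) (z l : C) : isd f z l ->
  (fun h : C => h^-1 *: ((f \o shift z) (h *: (1:C)) - f z)) @ (0:C)^' --> l.
Proof.
move=> /isdP h; apply/cvgrPdist_lt => e e0.
have eE : e = RC (ReC e).
  by apply: CeqP => //; rewrite ImRC; move: e0; rewrite ltcE => /andP[/eqP].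
have r0 : 0 < ReC e by move: e0; rewrite ltcE => /andP[_].
have r2 : 0 < ReC e / 2 by rewrite divr_gt0.
have [d d0 hd] := h _ r2.
apply/nbhs_ballP; exists (RC d) => /=; first by rewrite ltcR.
move=> w; rewrite /ball /= sub0r norm_nm ltcR nmN => hw w0.
have := hd (w + z); rewrite addrK => /(_ hw); rewrite eE norm_nm ltcR.
rewrite /shift /= -[_ *: _]/(w^-1 * _) -[w *: 1]/(w * 1) mulr1.
move=> hx; rewrite -(ltr_pM2r (_ : 0 < nm w)) ?nm_gt0 // -nmM.
rewrite (_ : _ * w = - (f (w + z) - f z - l * w)); last by field.
rewrite nmN; apply: (le_lt_trans hx); rewrite ltr_pM2r ?nm_gt0 //; lra.
Qed.

Lemma isd_derivable (f : C -> C) (z l : C) : isd f z l -> derivable f z 1.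
Proof. by move=> /isd_cvg h; apply/cvg_ex; exists l. Qed.

Lemma isd_derive (f : C -> C) (z l : C) : isd f z l -> 'D_1 f z = l.
Proof. by move=> /isd_cvg; apply/cvg_lim; apply: norm_hausdorff. Qed.

(** * Power series in the unit disc *)

Lemma nm_tri (a b c : C) : nm (a - c) <= nm (a - b) + nm (b - c).
Proof. by have := nmD (a - b) (b - c); rewrite addrA subrK. Qed.

Lemma geo_tail (K r : R) (N M : nat) : 0 <= K -> 0 <= r < 1 ->
  \sum_(N <= k < M) K * r ^+ k <= K * r ^+ N / (1 - r).
Proof.
move=> K0 /andP[r0 r1]; have q0 : 0 < 1 - r by rewrite subr_gt0.
have [NM|MN] := leqP N M; last first.
  by rewrite big_geq ?(ltnW MN) // divr_ge0 ?mulr_ge0 ?exprn_ge0 // ltW.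
rewrite -big_distrr /= -mulrA ler_wpM2l // ler_pdivlMr //.
rewrite -{1}(add0n N) big_addn big_mkord.
rewrite (eq_bigr (fun i : 'I_(M - N) => r ^+ N * r ^+ i)); last first.
  by move=> i _; rewrite exprD mulrC.
rewrite -big_distrr /= -mulrA ler_piMr ?exprn_ge0 //.
rewrite mulrC; have := subrX1 r (M - N).
move=> e; have -> : (1 - r) * (\sum_(i < M - N) r ^+ i) = 1 - r ^+ (M - N).
  by rewrite -[LHS]opprK -mulNr opprB -e opprB.
by rewrite lerBlDl lerDr exprn_ge0.
Qed.

Lemma geo_small_realType (F : realType) (K r e : F) : 0 <= r < 1 -> 0 < e ->
  exists N, forall n, (N <= n)%N -> K * r ^+ n < e.
Proof.
move=> /andP[r0 r1] e0.
have h : (fun n => K * r ^+ n) @ \oo --> (0 : F).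
  by apply: cvg_geometric; rewrite ger0_norm.
move: h => /cvgrPdist_lt/(_ e e0)[N _ HN].
exists N => n /HN /=; rewrite sub0r normrN; apply: le_lt_trans; exact: ler_norm.
Qed.

Lemma geo_small (K r e : R) : 0 <= r < 1 -> 0 < e ->
  exists N, forall n, (N <= n)%N -> K * r ^+ n < e.
Proof. exact: geo_small_realType. Qed.

Lemma geo_cvg_realType (F : realType) (u : nat -> F) (K r : F) : 0 <= K -> 0 <= r < 1 ->
  (forall n, `|u n| <= K * r ^+ n) ->
  exists l, forall e, 0 < e -> exists N, forall n, (N <= n)%N ->
    `|l - \sum_(0 <= k < n) u k| < e.
Proof.
move=> K0 /andP[r0 r1] hu.
have : cvgn (series u).
  apply: normed_cvg; apply: (@series_le_cvg _ _ (geometric K r)) => //.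
    by move=> n; apply: normr_ge0.
    by move=> n; rewrite /geometric /=; apply: mulr_ge0 => //; apply: exprn_ge0.
  by apply: is_cvg_geometric_series; rewrite ger0_norm.
move=> /cvg_ex[l /cvgrPdist_lt hl]; exists l => e /hl[N _ HN].
by exists N => n /HN.
Qed.

(** With [s = sqrt t], the product [(n + 1) s ^ n] is at most [1 + s + .. + s ^ n], hence at most
    [1 / (1 - s)]. Polynomial factors are absorbed in this way below. *)
Lemma npow_geo (t : R) : 0 <= t < 1 ->
  exists K s, [/\ 0 <= K, 0 <= s < 1 & forall n, n.+1%:R * t ^+ n <= K * s ^+ n].
Proof.
move=> /andP[t0 t1]; pose s : R := Num.sqrt t.
have s0 : 0 <= s := sqrtr_ge0 _.
have s2 : s * s = t by rewrite -expr2 sqr_sqrtr.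
have s1 : s < 1 by rewrite /s -[ltRHS]sqrtr1 ltr_sqrt.
have q0 : 0 < 1 - s by rewrite subr_gt0.
exists ((1 - s)^-1), s; split; rewrite ?s0 ?invr_ge0 ?(ltW q0) // => n.
rewrite -s2 exprMn mulrA ler_wpM2r ?exprn_ge0 //.
have := @geo_tail 1 s 0 n.+1 ler01; rewrite s0 s1 => /(_ isT); rewrite expr0 mulr1 mul1r.
apply: le_trans; rewrite big_mkord.
have -> : n.+1%:R * s ^+ n = \sum_(i < n.+1) s ^+ n.
  by rewrite sumr_const card_ord mulr_natl.
apply: ler_sum => i _; rewrite mul1r; apply: ler_wiXn2l => //; [exact: ltW|].
by rewrite -ltnS.
Qed.

Lemma geo_cvg (u : nat -> C) (K r : R) : 0 <= K -> 0 <= r < 1 ->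
  (forall n, nm (u n) <= K * r ^+ n) ->
  exists l, cs (series u) l /\ forall N, nm (l - series u N) <= K * r ^+ N / (1 - r).
Proof.
move=> K0 r01 hu; have [r0 r1] := andP r01.
have [a ha] := geo_cvg_realType K0 r01 (fun n => le_trans (abs_Re_le (u n)) (hu n)).
have [b hb] := geo_cvg_realType K0 r01 (fun n => le_trans (abs_Im_le (u n)) (hu n)).
have sRe N : \sum_(0 <= k < N) ReC (u k) = ReC (series u N).
  by rewrite /series /=; elim/big_rec2: _ => // i x y _ ->; rewrite ReD.
have sIm N : \sum_(0 <= k < N) ImC (u k) = ImC (series u N).
  by rewrite /series /=; elim/big_rec2: _ => // i x y _ ->; rewrite ImD.
have H : cs (series u) (a +i* b).
  move=> e e0; have e2 : 0 < e / 2 by rewrite divr_gt0.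
  have [N HN] := ha _ e2.
  have [M HM] := hb _ e2.
  exists (maxn N M) => n; rewrite geq_max => /andP[/HN h1 /HM h2].
  apply: (le_lt_trans (nm_le_ReIm _)).
  rewrite ReD ImD ReN ImN ReE ImE -sRe -sIm distrC (distrC _ b).
  move: h1 h2 => /=; lra.
exists (a +i* b); split => // N; rewrite leNgt; apply/negP => h.
have [|M HM] := H (nm (a +i* b - series u N) - K * r ^+ N / (1 - r)).
  by rewrite subr_gt0.
have := HM _ (leq_maxl M N); set m := maxn M N => h1.
have h2 : nm (series u m - series u N) <= K * r ^+ N / (1 - r).
  rewrite /series /= (@big_cat_nat _ _ _ N 0 m) ?leq_maxr //= addrAC subrr add0r.
  apply: (le_trans (nm_sum_le _ _ _)); apply: le_trans (geo_tail N m K0 r01).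
  by apply: ler_sum => i _.
have := nm_tri (a +i* b) (series u m) (series u N).
rewrite nm_distC in h1; lra.
Qed.

(** Radius of convergence at least 1, expressed by boundedness of the terms on every smaller circle
    (Abel's criterion). *)
Definition PSR (a : nat -> C) : Prop :=
  forall r : R, 0 < r < 1 -> exists K, forall n, nm (a n) * r ^+ n <= K.

Definition psum (a : nat -> C) (w : C) : C := limn (series (fun n => a n * w ^+ n)).

(** A radius [r] strictly between [s] and 1 gives the ratio [s / r] of a dominating geometric
    series. *)
Lemma PSR_geo a s : PSR a -> 0 <= s < 1 ->
  exists K t, [/\ 0 <= K, 0 <= t < 1 &
    forall n (w : C), nm w <= s -> nm (a n * w ^+ n) <= K * t ^+ n].
Proof.
move=> ha /andP[s0 s1]; pose r : R := (1 + s) / 2.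
have r01 : 0 < r < 1 by rewrite /r; lra.
have [r0 r1] := andP r01; have [K hK] := ha r r01.
exists K, (s / r); split.
- by apply: le_trans (hK 0%N); rewrite mulr_ge0 ?nm_ge0 ?exprn_ge0 // ltW.
- by rewrite divr_ge0 ?(ltW r0) //= ltr_pdivrMr // mul1r /r; lra.
move=> n w hw; rewrite nmM nmX exprMn mulrA.
apply: (@le_trans _ _ (nm (a n) * s ^+ n)).
  by rewrite ler_wpM2l ?nm_ge0 // lerXn2r ?nnegrE ?nm_ge0.
rewrite exprVn ler_pdivlMr ?exprn_gt0 //.
by rewrite mulrAC ler_wpM2r ?exprn_ge0.
Qed.

Lemma psum_cs a w : PSR a -> nm w < 1 -> cs (series (fun n => a n * w ^+ n)) (psum a w).
Proof.
move=> ha hw; have [|K [t [K0 t01 h]]] := @PSR_geo a (nm w) ha; first by rewrite nm_ge0.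
have [l [hl _]] := geo_cvg K0 t01 (fun n => h n w (lexx _)).
by rewrite /psum (limn_cs hl).
Qed.

Lemma psum_tail a s : PSR a -> 0 <= s < 1 ->
  exists K t, [/\ 0 <= K, 0 <= t < 1 & forall w N, nm w <= s ->
    nm (psum a w - series (fun n => a n * w ^+ n) N) <= K * t ^+ N].
Proof.
move=> ha s01; have [K [t [K0 t01 h]]] := PSR_geo ha s01.
have [t0 t1] := andP t01.
exists (K / (1 - t)), t; split => // [|w N hw].
  by rewrite divr_ge0 // subr_ge0 ltW.
have [l [hl hN]] := geo_cvg K0 t01 (fun n => h n w hw).
by rewrite /psum (limn_cs hl) mulrAC.
Qed.

Lemma psum_eq a w l : cs (series (fun n => a n * w ^+ n)) l -> psum a w = l.
Proof. exact: limn_cs. Qed.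

(** The terms of a convergent series, as differences of consecutive partial sums, are eventually at
    most 2; the finitely many others are covered by their sum. *)
Lemma PSR_of_cvg (a : nat -> C) :
  (forall w : C, nm w < 1 -> exists l, cs (series (fun n => a n * w ^+ n)) l) -> PSR a.
Proof.
move=> h r /andP[r0 r1]; have [|l hl] := h (RC r); first by rewrite nmRC gtr0_norm.
have [N HN] := hl 1 ltr01.
have hb n : (N <= n)%N -> nm (a n) * r ^+ n <= 2.
  move=> nN; have h1 := HN n nN; have h2 := HN n.+1 (leqW nN).
  have := nmB (series (fun n => a n * RC r ^+ n) n.+1 - l) (series (fun n => a n * RC r ^+ n) n - l).
  rewrite /series /= big_nat_recr //= in h1 h2 *.
  set S := \sum_(0 <= k < n) _ in h1 h2 *.
  rewrite (_ : _ - _ - _ = a n * RC r ^+ n); last by ring.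
  rewrite nmM nmX nmRC gtr0_norm //; lra.
exists (2 + \sum_(i < N) nm (a i) * r ^+ i) => n.
have s0 : 0 <= \sum_(i < N) nm (a i) * r ^+ i.
  by apply: sumr_ge0 => i _; rewrite mulr_ge0 ?nm_ge0 ?exprn_ge0 // ltW.
have [/hb|nN] := leqP N n; first by lra.
rewrite (bigD1 (Ordinal nN)) //=.
have : 0 <= \sum_(i < N | i != Ordinal nN) nm (a i) * r ^+ i.
  by apply: sumr_ge0 => i _; rewrite mulr_ge0 ?nm_ge0 ?exprn_ge0 // ltW.
lra.
Qed.

Lemma PSR_le (a b : nat -> C) : (forall n, nm (a n) <= nm (b n)) -> PSR b -> PSR a.
Proof.
move=> h hb r r01; have [K hK] := hb r r01; exists K => n; apply: le_trans (hK n).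
by rewrite ler_wpM2r ?h ?exprn_ge0 //; case/andP: r01 => /ltW.
Qed.

Lemma PSRD (a b : nat -> C) : PSR a -> PSR b -> PSR (fun n => a n + b n).
Proof.
move=> ha hb r r01; have [K hK] := ha r r01; have [K' hK'] := hb r r01.
exists (K + K') => n; apply: le_trans (lerD (hK n) (hK' n)).
rewrite -mulrDl ler_wpM2r ?nmD ?exprn_ge0 //; by case/andP: r01 => /ltW.
Qed.

Lemma PSRZ (a : nat -> C) (c : C) : PSR a -> PSR (fun n => c * a n).
Proof.
move=> ha r r01; have [K hK] := ha r r01; exists (nm c * K) => n.
by rewrite nmM -mulrA ler_wpM2l ?nm_ge0.
Qed.

Lemma PSR1 : PSR (fun=> 1).
Proof.
move=> r /andP[r0 r1]; exists 1 => n.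
by rewrite nm1 mul1r exprn_ile1 // ltW.
Qed.

Definition conv (a b : nat -> C) (n : nat) : C := \sum_(i < n.+1) a i * b (n - i)%N.

(** On the circle of radius [s] each of the [n + 1] products is at most [K L]; the factor [n + 1] is
    absorbed in passing from [s] down to [r]. *)
Lemma PSR_conv (a b : nat -> C) : PSR a -> PSR b -> PSR (conv a b).
Proof.
move=> ha hb r /andP[r0 r1]; pose s : R := (1 + r) / 2.
have s01 : 0 < s < 1 by rewrite /s; lra.
have [s0 s1] := andP s01.
have [K hK] := ha s s01; have [L hL] := hb s s01.
have t01 : 0 <= r / s < 1.
  by rewrite divr_ge0 ?(ltW s0) ?(ltW r0) //= ltr_pdivrMr // mul1r /s; lra.
have [J [t [J0 /andP[t0 t1] ht]]] := npow_geo t01.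
have K0 : 0 <= K by apply: le_trans (hK 0%N); rewrite mulr_ge0 ?nm_ge0 ?exprn_ge0 // ltW.
have L0 : 0 <= L by apply: le_trans (hL 0%N); rewrite mulr_ge0 ?nm_ge0 ?exprn_ge0 // ltW.
exists (K * L * J) => n.
have h1 : nm (conv a b n) * s ^+ n <= n.+1%:R * (K * L).
  apply: (@le_trans _ _ ((\sum_(i < n.+1) nm (a i * b (n - i)%N)) * s ^+ n)).
    by rewrite ler_wpM2r ?nm_sum_le ?exprn_ge0 // ltW.
  rewrite mulr_suml; have -> : n.+1%:R * (K * L) = \sum_(i < n.+1) (K * L).
    by rewrite sumr_const card_ord mulr_natl.
  apply: ler_sum => i _; rewrite nmM.
  have -> : s ^+ n = s ^+ i * s ^+ (n - i) by rewrite -exprD subnKC // -ltnS.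
  by rewrite mulrACA; apply: ler_pM; rewrite ?mulr_ge0 ?nm_ge0 ?exprn_ge0 ?hK ?hL // ltW.
have er : r ^+ n = s ^+ n * (r / s) ^+ n by rewrite -exprMn mulrC divfK // gt_eqF.
rewrite er mulrA.
apply: (@le_trans _ _ (n.+1%:R * (K * L) * (r / s) ^+ n)).
  by rewrite ler_wpM2r ?exprn_ge0 //; case/andP: t01.
rewrite mulrAC [leLHS]mulrC ler_wpM2l ?mulr_ge0 //.
by apply: (le_trans (ht n)); rewrite ler_piMr // exprn_ile1 // ltW.
Qed.

Definition da (a : nat -> C) (n : nat) : C := n.+1%:R * a n.+1.

Lemma PSR_da a : PSR a -> PSR (da a).
Proof.
move=> ha r /andP[r0 r1]; pose s : R := (1 + r) / 2.
have s01 : 0 < s < 1 by rewrite /s; lra.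
have [s0 s1] := andP s01; have [K hK] := ha s s01.
have t01 : 0 <= r / s < 1.
  by rewrite divr_ge0 ?(ltW s0) ?(ltW r0) //= ltr_pdivrMr // mul1r /s; lra.
have [J [t [J0 /andP[t0 t1] ht]]] := npow_geo t01.
have K0 : 0 <= K by apply: le_trans (hK 0%N); rewrite mulr_ge0 ?nm_ge0 ?exprn_ge0 // ltW.
exists (K / s * J) => n; rewrite /da nmM nm_nat.
have h1 : nm (a n.+1) * s ^+ n <= K / s.
  by rewrite ler_pdivlMr // -mulrA -exprSr.
have -> : n.+1%:R * nm (a n.+1) * r ^+ n = nm (a n.+1) * s ^+ n * (n.+1%:R * (r / s) ^+ n).
  have er : r ^+ n = s ^+ n * (r / s) ^+ n by rewrite -exprMn mulrC divfK // gt_eqF.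
  by rewrite er; ring.
apply: ler_pM; rewrite ?mulr_ge0 ?nm_ge0 ?exprn_ge0 ?(ltW s0) //; first by case/andP: t01.
by apply: (le_trans (ht n)); rewrite ler_piMr // exprn_ile1 // ltW.
Qed.

Lemma PSR_sub a : PSR a -> PSR (fun n => a n.+1).
Proof.
move=> /PSR_da; apply: PSR_le => n; rewrite /da nmM nm_nat ler_peMl ?nm_ge0 //.
by rewrite ler1n.
Qed.

Lemma PSR_natM a : PSR a -> PSR (fun n => n%:R * a n).
Proof.
move=> ha r r01; have [K hK] := PSR_da ha r01; have [r0 r1] := andP r01.
have K0 : 0 <= K by apply: le_trans (hK 0%N); rewrite mulr_ge0 ?nm_ge0 ?exprn_ge0 // ltW.
exists K => -[|n]; first by rewrite mul0r nm0 mul0r.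
apply: le_trans (hK n); rewrite /da exprS mulrCA ler_piMl // ?mulr_ge0 ?nm_ge0 ?exprn_ge0 // ltW //.
Qed.

Lemma PSR_pow k : PSR (fun n => n%:R ^+ k).
Proof.
elim: k => [|k /PSR_natM IH]; first exact: PSR1.
by apply: PSR_le IH => n; rewrite exprS.
Qed.

Lemma psumD a b w : PSR a -> PSR b -> nm w < 1 ->
  psum (fun n => a n + b n) w = psum a w + psum b w.
Proof.
move=> ha hb hw; apply: psum_eq; apply: cs_ext (csD (psum_cs ha hw) (psum_cs hb hw)) => n.
by rewrite /series /= -big_split /=; apply: eq_bigr => i _; rewrite mulrDl.
Qed.

Lemma psumZ a c w : PSR a -> nm w < 1 -> psum (fun n => c * a n) w = c * psum a w.
Proof.
move=> ha hw; apply: psum_eq; apply: cs_ext (csZ c (psum_cs ha hw)) => n.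
by rewrite /series /= big_distrr /=; apply: eq_bigr => i _; rewrite mulrA.
Qed.

Lemma psum_shift a w : PSR a -> nm w < 1 ->
  psum a w = a 0%N + w * psum (fun n => a n.+1) w.
Proof.
move=> ha hw; apply: psum_eq; apply/(cs_shift _ _ 1).
apply: cs_ext (csD (cs_cst (a 0%N)) (csZ w (psum_cs (PSR_sub ha) hw))) => n.
rewrite addn1 /series /= big_nat_recl //= expr0 mulr1 big_distrr /=; congr (_ + _).
by apply: eq_bigr => i _; rewrite exprS; ring.
Qed.

Lemma psum_natM a w : PSR a -> nm w < 1 -> psum (fun n => n%:R * a n) w = w * psum (da a) w.
Proof. by move=> ha hw; rewrite (psum_shift (PSR_natM ha)) // mul0r add0r. Qed.

Lemma psum_cst (c w : C) : psum (fun n => if n == 0%N then c else 0) w = c.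
Proof.
apply: psum_eq; apply/(cs_shift _ _ 1); apply: cs_ext (cs_cst c) => n.
rewrite addn1 /series /= big_nat_recl //= expr0 mulr1 big1 ?addr0 // => i _.
by rewrite mul0r.
Qed.

Lemma PSR_cst (c : C) : PSR (fun n => if n == 0%N then c else 0).
Proof.
move=> r /andP[r0 r1]; exists (nm c) => -[|n] /=; first by rewrite expr0 mulr1.
by rewrite nm0 mul0r nm_ge0.
Qed.

(** The product of two partial sums of length [N] is a polynomial that has the coefficients of the
    convolution below [N]; the remaining ones, up to degree [2 N], lie under the tail of a geometric
    series. *)
Lemma psum_conv a b w : PSR a -> PSR b -> nm w < 1 ->
  psum (conv a b) w = psum a w * psum b w.
Proof.
move=> ha hb hw; apply: psum_eq.
have hw' : 0 <= nm w < 1 by rewrite nm_ge0.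
have [K [t [K0 t01 hK]]] := PSR_geo ha hw'.
have [L [s [L0 s01 hL]]] := PSR_geo hb hw'.
pose x : R := Num.max s t.
have [t0 t1] := andP t01; have [s0 s1] := andP s01.
have x01 : 0 <= x < 1 by rewrite le_max s0 gt_max s1.
have [x0 x1] := andP x01.
have sx : s <= x by rewrite le_max lexx. have tx : t <= x by rewrite le_max lexx orbT.
have [J [y [J0 y01 hJ]]] := npow_geo x01.
pose A N := \poly_(i < N) a i; pose B N := \poly_(i < N) b i.
have evA (c : nat -> C) N : (\poly_(i < N) c i).[w] = series (fun n => c n * w ^+ n) N.
  by rewrite horner_poly /series /= big_mkord.
have cb N n : nm ((A N * B N)`_n * w ^+ n) <= K * L * J * y ^+ n.
  rewrite coefM big_distrl /=; apply: (le_trans (nm_sum_le _ _ _)).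
  apply: (@le_trans _ _ (\sum_(i < n.+1) K * L * x ^+ n)); last first.
    rewrite sumr_const card_ord -[leLHS]mulr_natl mulrCA -[leRHS]mulrA ler_wpM2l ?mulr_ge0 //.
  apply: ler_sum => i _; have lin : (i <= n)%N by rewrite -ltnS.
  have -> : w ^+ n = w ^+ i * w ^+ (n - i) by rewrite -exprD subnKC.
  have -> : x ^+ n = x ^+ i * x ^+ (n - i) by rewrite -exprD subnKC.
  rewrite !coef_poly mulrACA nmM [leRHS]mulrACA.
  apply: ler_pM; rewrite ?nm_ge0 //.
    case: ifP => _; last by rewrite mul0r nm0 mulr_ge0 // exprn_ge0.
    apply: (le_trans (hK _ _ (lexx _))); rewrite ler_wpM2l //.
    by rewrite lerXn2r ?nnegrE.
  case: ifP => _; last by rewrite mul0r nm0 mulr_ge0 // exprn_ge0.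
  apply: (le_trans (hL _ _ (lexx _))); rewrite ler_wpM2l //.
  by rewrite lerXn2r ?nnegrE.
have hN N : nm (series (fun n => a n * w ^+ n) N * series (fun n => b n * w ^+ n) N -
               series (fun n => conv a b n * w ^+ n) N) <= K * L * J / (1 - y) * y ^+ N.
  have e1 : (A N * B N).[w] = \sum_(0 <= i < N + N) (A N * B N)`_i * w ^+ i.
    rewrite (@horner_coef_wide _ (N + N)) ?big_mkord //.
    apply: leq_trans (size_polyMleq _ _) _.
    by rewrite (leq_trans (leq_pred _)) // leq_add // size_poly.
  rewrite -(evA a) -(evA b) -hornerM e1 {e1} /series /=.
  rewrite (@big_cat_nat _ _ _ N) ?leq_addr //=.
  have -> : \sum_(0 <= i < N) (A N * B N)`_i * w ^+ i = \sum_(0 <= i < N) conv a b i * w ^+ i.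
    rewrite !big_mkord; apply: eq_bigr => i _; rewrite coefM; congr (_ * _).
    apply: eq_bigr => j _; rewrite !coef_poly.
    have -> : (j < N)%N by rewrite (leq_ltn_trans _ (ltn_ord i)) // -ltnS.
    by have -> : (i - j < N)%N by rewrite (leq_ltn_trans (leq_subr _ _)).
  rewrite addrAC subrr add0r mulrAC; apply: (le_trans (nm_sum_le _ _ _)).
  apply: le_trans (geo_tail N (N + N) _ y01); last by rewrite !mulr_ge0.
  by apply: ler_sum => i _; exact: cb.
have hd : cs (fun N => series (fun n => conv a b n * w ^+ n) N -
   series (fun n => a n * w ^+ n) N * series (fun n => b n * w ^+ n) N) 0.
  move=> e e0; have [N HN] := geo_small (K * L * J / (1 - y)) y01 e0.
  by exists N => n /HN; apply: le_lt_trans; rewrite subr0 nm_distC.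
have := csD hd (csM (psum_cs ha hw) (psum_cs hb hw)); rewrite add0r.
by apply: cs_ext => n; rewrite subrK.
Qed.

(** A uniform limit of continuous functions is continuous; the uniformity near [z] comes from the
    common geometric bound. *)
Lemma series_cts (u : nat -> C -> C) (f : C -> C) (z : C) (K t : R) :
  0 <= K -> 0 <= t < 1 -> (forall n, cts (u n) z) ->
  nb z (fun w => (forall n, nm (u n w) <= K * t ^+ n) /\ cs (series (u ^~ w)) (f w)) ->
  cts f z.
Proof.
move=> K0 t01 cu hnb e e0.
have hz := nb_self hnb.
have e3 : 0 < e / 3 by rewrite divr_gt0.
have [N HN] := geo_small (K / (1 - t)) t01 e3.
have key w : (forall n, nm (u n w) <= K * t ^+ n) /\ cs (series (u ^~ w)) (f w) ->
   nm (f w - series (u ^~ w) N) < e / 3.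
  move=> [h1 h2]; have [l [hl hN]] := geo_cvg K0 t01 h1.
  by rewrite (cs_unique h2 hl); apply: (le_lt_trans (hN N)); rewrite mulrAC; apply: HN.
have cN : cts (fun w => series (u ^~ w) N) z.
  rewrite /series /=; elim: N {HN key} => [|N IH].
    by apply: cts_loc (cts_cst 0 z); apply: nb_true => w; rewrite big_geq.
  apply: cts_loc (ctsD IH (cu N)); apply: nb_true => w; by rewrite big_nat_recr.
apply: nb_imp (nb_and hnb (cN _ e3)) => w [/key h1 h2]; have h3 := key z hz.
have n1 := nm_tri (f w) (series (u ^~ w) N) (f z).
have n2 := nm_tri (series (u ^~ w) N) (series (u ^~ z) N) (f z).
rewrite (nm_distC (f z)) in h3; lra.
Qed.

(** The Caratheodory factor is the sum of [a_(n+1) (w ^ (n+1) - z ^ (n+1)) / (w - z)]. Its terms are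
    polynomials in [w], dominated by the terms of the derived series at [s], so it is continuous at
    [z]. *)
Lemma isd_psum a z : PSR a -> nm z < 1 -> isd (psum a) z (psum (da a) z).
Proof.
move=> ha hz; pose s : R := (1 + nm z) / 2.
have z0 := nm_ge0 z.
have s01 : 0 <= s < 1 by rewrite /s; lra.
have zs : nm z <= s by rewrite /s; lra.
pose c n (w : C) := \sum_(i < n.+1) w ^+ (n - i) * z ^+ i.
have hnb : nb z (fun w => nm w <= s).
  exists (s - nm z); first by rewrite /s; lra.
  move=> w hw; have := nm_le_dist w z; lra.
have [K [t [K0 t01 hK]]] := PSR_geo (PSR_da ha) s01.
have [s0 s1] := andP s01.
have bnd n w : nm w <= s -> nm (a n.+1 * c n w) <= K * t ^+ n.
  move=> hw; have := hK n (RC s); rewrite nmRC ger0_norm // => /(_ (lexx _)).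
  apply: le_trans; rewrite /da !nmM nm_nat mulrAC mulrC ler_wpM2r ?nm_ge0 //.
  apply: (le_trans (nm_sum_le _ _ _)).
  have -> : n.+1%:R * nm (RC s ^+ n) = \sum_(i < n.+1) s ^+ n.
    by rewrite sumr_const card_ord mulr_natl nmX nmRC ger0_norm.
  apply: ler_sum => i _; rewrite nmM !nmX.
  have -> : s ^+ n = s ^+ (n - i) * s ^+ i by rewrite -exprD subnK // -ltnS.
  by apply: ler_pM; rewrite ?exprn_ge0 ?nm_ge0 // lerXn2r ?nnegrE ?nm_ge0.
pose phi w := limn (series (fun n => a n.+1 * c n w)).
have cphi w : nm w <= s -> cs (series (fun n => a n.+1 * c n w)) (phi w).
  move=> hw; have [l [hl _]] := geo_cvg K0 t01 (fun n => bnd n w hw).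
  by rewrite /phi (limn_cs hl).
apply: (@isd_loc _ (fun w => psum a z + phi w * (w - z))).
  apply: nb_imp hnb => w hw; have hw1 : nm w < 1 by lra.
  have h1 := csD (psum_cs ha hw1) (csZ (-1) (psum_cs ha hz)).
  have h2 := csZ (w - z) (cphi w hw).
  suff e : psum a w + -1 * psum a z = (w - z) * phi w by rewrite mulrC -e; ring.
  apply: cs_unique h1 _; apply/(cs_shift _ _ 1); apply: cs_ext h2 => n.
  rewrite addn1 /series /= !big_distrr /= -big_split /= big_nat_recl //= !expr0.
  rewrite (_ : _ + _ * _ = 0); last by ring.
  rewrite add0r; apply: eq_bigr => i _.
  have -> : a i.+1 * w ^+ i.+1 + -1 * (a i.+1 * z ^+ i.+1) = a i.+1 * (w ^+ i.+1 - z ^+ i.+1) by ring.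
  by rewrite subrXX mulrCA.
exists phi; split.
- apply: (@series_cts (fun n w => a n.+1 * c n w) _ _ K t K0 t01).
    move=> n; apply: ctsM; first exact: cts_cst.
    apply: isd_cts; apply: isd_sum => i.
    apply: isdM (isd_cst _ _); apply: isdX; apply: isd_id.
  by apply: nb_imp hnb => w hw; split => [n|]; [exact: bnd|exact: cphi].
- apply: cs_unique (cphi z zs) _; apply: cs_ext (psum_cs (PSR_da ha) hz) => n.
  rewrite /series /=; apply: eq_bigr => i _; rewrite /da /c.
  rewrite (eq_bigr (fun=> z ^+ i)); last first.
    by move=> j _; rewrite -exprD subnK // -ltnS.
  by rewrite sumr_const card_ord mulr_natl; ring.
by move=> w; rewrite subrr mulr0 addr0.
Qed.

Lemma psum_near0 a : PSR a -> exists2 K : R, 0 <= K &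
  forall w, nm w <= 1 / 2 -> nm (psum a w - a 0%N) <= K * nm w.
Proof.
move=> ha; have s01 : 0 <= (1 / 2 : R) < 1 by lra.
have [K [t [K0 t01 h]]] := psum_tail (PSR_sub ha) s01.
exists K => // w hw; have hw1 : nm w < 1 by apply: le_lt_trans hw _; lra.
rewrite (psum_shift ha hw1) addrAC subrr add0r nmM mulrC ler_wpM2r ?nm_ge0 //.
by have := h w 0%N hw; rewrite expr0 mulr1 /series /= big_geq // subr0.
Qed.


(** * The exponential and the logarithm *)

Lemma deriv0_realType (F : realType) (f : F -> F) (l : F) : is_derive (0 : F) 1 f l ->
  forall e, 0 < e -> exists2 d, 0 < d & forall h, `|h| < d -> `|f h - f 0 - l * h| <= e * `|h|.
Proof.
move=> [df dl] e e0.
have /cvgrPdist_lt/(_ e e0)/nbhs_ballP[d /= d0 hd] := df.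
exists d => // h hh; have [->|h0] := eqVneq h 0.
  by rewrite mulr0 subr0 subrr normr0 mulr0.
have := hd h; rewrite /ball /= sub0r normrN => /(_ hh h0).
rewrite -[lim _]/('D_1 f 0) dl [h *: _]mulr1 /shift /= addr0 -[_ *: _]/(h^-1 * _) => hx.
have -> : f h - f 0 - l * h = - ((l - h^-1 * (f h - f 0)) * h) by field.
by rewrite normrN normrM ler_wpM2r // ltW.
Qed.

Lemma continuous_realType (F : realType) (f : F -> F) (a : F) : {for a, continuous f} ->
  forall e, 0 < e -> exists2 d, 0 < d & forall x, `|x - a| < d -> `|f x - f a| < e.
Proof.
move=> /cvgrPdist_lt cf e /cf /nbhs_ballP[d /= d0 hd]; exists d => // x hx.
by have := hd x; rewrite /ball /= distrC hx => /(_ isT); rewrite distrC.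
Qed.

Definition tangent0 (f : R -> R) (l : R) : Prop :=
  forall e : R, 0 < e -> exists2 d : R, 0 < d &
    forall h : R, `|h| < d -> `|f h - f 0 - l * h| <= e * `|h|.

Lemma tangent0_expR : tangent0 (@expR R) (expR 0).
Proof. exact: (deriv0_realType (is_derive_expR 0)). Qed.

Lemma tangent0_cos : tangent0 (@cos R) (- sin 0).
Proof. exact: (deriv0_realType (is_derive_cos 0)). Qed.

Lemma tangent0_sin : tangent0 (@sin R) (cos 0).
Proof. exact: (deriv0_realType (is_derive_sin 0)). Qed.

Lemma continuousR_ln (a : R) : 0 < a -> forall e : R, 0 < e ->
  exists2 d : R, 0 < d & forall x : R, `|x - a| < d -> `|ln x - ln a| < e.
Proof. by move=> a0; apply: continuous_realType; apply: continuous_ln. Qed.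

Lemma continuousR_atan (a : R) : forall e : R, 0 < e ->
  exists2 d : R, 0 < d & forall x : R, `|x - a| < d -> `|atan x - atan a| < e.
Proof. by apply: continuous_realType; apply: continuous_atan. Qed.

Lemma expCD (a b : C) : expC (a + b) = expC a * expC b.
Proof.
rewrite /expC ReD ImD exp.expRD trigo.cosD trigo.sinD.
by apply: CeqP; rewrite !ReImE !ReE !ImE; ring.
Qed.

Lemma expC0 : expC 0 = 1.
Proof. by rewrite /expC Re0 Im0 exp.expR0 trigo.cos0 trigo.sin0; apply: CeqP; rewrite !ReImE /=; ring. Qed.

Lemma nm_expC (a : C) : nm (expC a) = expR (ReC a).
Proof.
rewrite /expC nmM nmRC ger0_norm ?expR_ge0 // nm_def ReE ImE trigo.cos2Dsin2 sqrtr1.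
by rewrite mulr1.
Qed.

Lemma expC_neq0 (a : C) : expC a != 0.
Proof. by rewrite -nm_gt0 nm_expC expR_gt0. Qed.

Lemma expCN (a : C) : expC (- a) = (expC a)^-1.
Proof.
have h := expC_neq0 a; apply: (mulIf h); rewrite mulVf //.
by rewrite -expCD addNr expC0.
Qed.

Lemma expCX (a : C) n : expC (n%:R * a) = expC a ^+ n.
Proof.
elim: n => [|n IH]; first by rewrite mul0r expC0.
by rewrite -natr1 mulrDl mul1r expCD IH exprSr.
Qed.

Lemma isd_expC0 : isd expC 0 1.
Proof.
(* The first-order errors [al], [gm] and [sg] of exp, cos and sin are at most [d] times their
   arguments; together they contribute at most [d |Re w| + 8 d |Im w|]. *)
apply/isdP => e e0; pose d := Num.min 1 (e / 12).
have d0 : 0 < d by rewrite lt_min ltr01 divr_gt0.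
have dE : d <= e / 12 by rewrite ge_min lexx orbT.
have d1 : d <= 1 by rewrite ge_min lexx.
clearbody d.
have [r1 r10 h1] := tangent0_expR d0.
have [r2 r20 h2] := tangent0_cos d0.
have [r3 r30 h3] := tangent0_sin d0.
exists (Num.min d (Num.min r1 (Num.min r2 r3))); first by rewrite !lt_min d0 r10 r20.
move=> w; rewrite subr0 expC0 mul1r !lt_min => /and4P[hd hr1 hr2 hr3].
have ha := abs_Re_le w; have hb := abs_Im_le w.
set a := ReC w in ha *; set b := ImC w in hb *.
have := h1 a (le_lt_trans ha hr1); rewrite exp.expR0 mul1r.
have := h2 b (le_lt_trans hb hr2); rewrite trigo.sin0 trigo.cos0 oppr0 mul0r subr0.
have := h3 b (le_lt_trans hb hr3); rewrite trigo.cos0 trigo.sin0 mul1r subr0.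
set sg := sin b - b; set gm := cos b - 1; set al := expR a - 1 - a => hs hg hal.
have eR : ReC (expC w - 1 - w) = al + (1 + a + al) * gm.
  by rewrite /expC !ReImE !ReE !ImE -/a -/b /al /gm; ring.
have eI : ImC (expC w - 1 - w) = (a + al) * b + (1 + a + al) * sg.
  by rewrite /expC !ReImE !ReE !ImE -/a -/b /al /sg; ring.
apply: (le_trans (nm_le_ReIm _)); rewrite eR eI.
have B : `|1 + a + al| <= 3.
  have n1 := ler_normD (1 + a) al; have n2 := ler_normD 1 a; rewrite normr1 in n2.
  have : d * `|a| <= 1 * 1 by apply: ler_pM => //; [exact: ltW|lra].
  lra.
have A : `|a + al| <= 2 * `|a|.
  have n1 := ler_normD a al.
  have : d * `|a| <= 1 * `|a| by apply: ler_wpM2r.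
  lra.
have m1 := ler_normD al ((1 + a + al) * gm); rewrite normrM in m1.
have m2 := ler_normD ((a + al) * b) ((1 + a + al) * sg); rewrite !normrM in m2.
have p1 : `|1 + a + al| * `|gm| <= 3 * (d * `|b|) by apply: ler_pM.
have p2 : `|1 + a + al| * `|sg| <= 3 * (d * `|b|) by apply: ler_pM.
have p3 : `|a + al| * `|b| <= 2 * d * `|b|.
  by apply: ler_wpM2r => //; apply: (le_trans A); rewrite ler_wpM2l //; lra.
have p4 : d * `|b| <= e / 12 * nm w by apply: ler_pM => //; exact: ltW.
have p5 : d * `|a| <= e / 12 * nm w by apply: ler_pM => //; exact: ltW.
have p6 : 0 <= e * nm w by rewrite mulr_ge0 ?nm_ge0 // ltW.
lra.
Qed.

Lemma isd_expC z : isd expC z (expC z).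
Proof.
have h : isd (fun w => w - z) z 1.
  by apply: isd_eq (isdB (isd_id z) (isd_cst z z)) _; rewrite subr0.
have h2 : isd expC (z - z) 1 by rewrite subrr; exact: isd_expC0.
apply: isd_loc (isd_eq (isdZ (expC z) (isd_comp h h2)) _); last by ring.
by apply: nb_true => w; rewrite -expCD subrKC.
Qed.

Lemma pi_neq0 : (pi : R) != 0. Proof. by rewrite gt_eqF // trigo.pi_gt0. Qed.

Definition tpi : C := RC (2 * pi) * iC.

Lemma tpi_neq0 : tpi != 0.
Proof.
rewrite mulf_neq0 // ?RC_eq0 ?mulf_neq0 ?pi_neq0 ?pnatr_eq0 //.
by rewrite -nm_gt0 nm_i.
Qed.

Lemma eCE w : eC w = expC (tpi * w). Proof. by []. Qed.

Lemma eCD a b : eC (a + b) = eC a * eC b.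
Proof. by rewrite !eCE mulrDr expCD. Qed.

Lemma eCN a : eC (- a) = (eC a)^-1.
Proof. by rewrite !eCE mulrN expCN. Qed.

Lemma eC1 : eC 1 = 1.
Proof.
rewrite eCE mulr1 /expC /tpi !ReImE mulr0 mul0r subr0 mulr1 mul0r addr0 exp.expR0.
rewrite (_ : 2 * pi = pi *+ 2); last by rewrite mulr_natl.
by rewrite trigo.cos2pi trigo.sin2pi RC1 mul1r.
Qed.

Lemma eC_neq0 a : eC a != 0. Proof. exact: expC_neq0. Qed.

Lemma isd_eC z (a : C) : isd (fun w => eC (a * w)) z (tpi * a * eC (a * z)).
Proof.
have h := isdZ (tpi * a) (isd_id z).
have := isd_comp h (isd_expC (tpi * a * z)).
rewrite mulr1 /= => h1; apply: isd_loc (isd_eq h1 _).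
  by apply: nb_true => w; rewrite eCE mulrA.
by rewrite eCE [tpi * (a * z)]mulrA [RHS]mulrC.
Qed.

Lemma isd_qC z : isd qC z (tpi * qC z).
Proof.
have := isd_eC z 1; rewrite mulr1 mul1r; apply: isd_loc; apply: nb_true => w.
by rewrite mul1r.
Qed.

Lemma nm_eC (z : C) : nm (eC z) = expR (- (2 * pi * ImC z)).
Proof. by rewrite eCE nm_expC /tpi !ReImE; congr expR; ring. Qed.

Lemma nm_qC (z : C) : nm (qC z) = expR (- (2 * pi * ImC z)).
Proof. exact: nm_eC. Qed.

Lemma nm_eC_lt1 (z : C) : (nm (eC z) < 1) = (0 < ImC z).
Proof.
rewrite nm_eC -[ltRHS](@exp.expR0 R) exp.ltr_expR oppr_lt0 pmulr_rgt0 //.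
by rewrite mulr_gt0 ?trigo.pi_gt0.
Qed.

Lemma nm_qC_lt1 (z : C) : inH z -> nm (qC z) < 1.
Proof. by rewrite nm_eC_lt1. Qed.

Lemma qC_neq0 z : qC z != 0. Proof. exact: expC_neq0. Qed.

Lemma qC_shift z : qC (z + 1) = qC z.
Proof. by rewrite /qC eCD eC1 mulr1. Qed.

(** Polar coordinates. On the left half-plane, adding or subtracting [pi] changes the signs of both
    cosine and sine. *)
Lemma cosArg (w : C) : w != 0 ->
  nm w * cos (Arg w) = ReC w /\ nm w * sin (Arg w) = ImC w.
Proof.
rewrite -nm_gt0 /Arg => r0; set x := ReC w; set y := ImC w.
have r2 : nm w ^+ 2 = x ^+ 2 + y ^+ 2 by exact: nm_sqr.
have key : x != 0 -> nm w * cos (atan (y / x)) = `|x|.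
  move=> x0; have ax : 0 < `|x| by rewrite normr_gt0.
  rewrite trigo.cos_atan.
  have -> : Num.sqrt (1 + (y / x) ^+ 2) = nm w / `|x|.
    have -> : 1 + (y / x) ^+ 2 = (nm w / `|x|) ^+ 2.
      rewrite [in RHS]expr_div_n r2 -normrX ger0_norm ?sqr_ge0 // expr_div_n.
      by field.
    by rewrite sqrtr_sqr ger0_norm // divr_ge0 // ltW.
  by rewrite invf_div mulrC divfK ?gt_eqF.
have sinE : x != 0 -> sin (atan (y / x)) = (y / x) * cos (atan (y / x)).
  move=> x0; have c0 : cos (atan (y / x)) != 0.
    by apply/eqP => h; have := key x0; rewrite h mulr0 => /esym/eqP; rewrite normr_eq0 (negbTE x0).
  by rewrite -{2}(trigo.atanK (y / x)) /tan divfK.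
case: (ltrgt0P x) => hx.
- have x0 : x != 0 by rewrite gt_eqF.
  by rewrite key // gtr0_norm // sinE // mulrCA key // gtr0_norm // divfK.
- have x0 : x != 0 by rewrite lt_eqF.
  have k := key x0; rewrite ltr0_norm // in k.
  case: ifP => _; last rewrite -(trigo.cosN (_ - pi)) -[sin _]opprK -(trigo.sinN (_ - pi)) opprB addrC.
    rewrite trigo.cosDpi trigo.sinDpi !mulrN k opprK sinE // mulrCA k; split => //.
    by rewrite mulrN opprK divfK.
  rewrite trigo.cosDpi trigo.sinDpi trigo.cosN trigo.sinN !mulrN !opprK k opprK sinE // mulrCA k; split => //.
  by rewrite mulrN opprK divfK.
- have h2 : nm w = `|y| by apply/eqP; rewrite -(eqrXn2 (n:=2)) ?nm_ge0 // r2 hx expr0n add0r -normrX ger0_norm ?sqr_ge0.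
  case: (ltrgt0P y) => hy.
  + by rewrite trigo.cos_pihalf trigo.sin_pihalf mulr0 mulr1 h2 gtr0_norm.
  + by rewrite trigo.cosN trigo.sinN trigo.cos_pihalf trigo.sin_pihalf mulr0 mulrN1 h2 ltr0_norm ?opprK.
  + by move: r0; rewrite h2 hy normr0 ltxx.
Qed.

Lemma LogCK (w : C) : w != 0 -> expC (LogC w) = w.
Proof.
move=> w0; have [h1 h2] := cosArg w0; have r0 : 0 < nm w by rewrite nm_gt0.
rewrite /expC /LogC ReE ImE -nm_def lnK ?posrE //.
by apply: CeqP; rewrite !ReImE /=; [rewrite -[RHS]h1|rewrite -[RHS]h2]; ring.
Qed.

(** The definition of [Arg] splits at the imaginary axis. This formula holds on the whole upper
    half-plane and makes the continuity of the argument there visible. *)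
Lemma ArgE_pos (w : C) : 0 < ImC w -> Arg w = pi / 2 - atan (ReC w / ImC w).
Proof.
move=> y0; have w0 : w != 0 by apply: contraTneq y0 => ->; rewrite ltxx.
have [h1 h2] := cosArg w0; have r0 : 0 < nm w by rewrite nm_gt0.
have rng : 0 < Arg w < pi.
  have p0 := trigo.pi_gt0 R.
  rewrite /Arg; case: (ltrgt0P (ReC w)) => hx; rewrite ?(ltW y0) ?y0.
  - have a1 := @atan_ltpi2 R (ImC w / ReC w).
    have a0 : 0 < atan (ImC w / ReC w) by rewrite -[ltLHS]trigo.atan0 trigo.lt_atan // divr_gt0.
    move: p0 a0 a1; move: (@pi _) (atan _) => p t; clear; move=> *; apply/andP; split; lra.
  - have a1 := @atan_gtNpi2 R (ImC w / ReC w).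
    have a0 : atan (ImC w / ReC w) < 0 by rewrite -[ltRHS]trigo.atan0 trigo.lt_atan // pmulr_rlt0 // invr_lt0.
    move: p0 a0 a1; move: (@pi _) (atan _) => p t; clear; move=> *; apply/andP; split; lra.
  by apply/andP; split; lra.
have := trigo.tanK (_ : pi / 2 - Arg w \in `]- (pi / 2), pi / 2[).
rewrite in_itv /= => /(_ _); have -> : - (pi / 2) < pi / 2 - Arg w < pi / 2 by apply/andP; split; lra.
move=> /(_ isT); rewrite /tan trigo.sinB trigo.cosB trigo.cos_pihalf trigo.sin_pihalf !mul0r !mul1r subr0 add0r.
have -> : cos (Arg w) / sin (Arg w) = ReC w / ImC w.
  by rewrite -h1 -h2 -mulf_div divff ?mul1r ?gt_eqF.
by move=> ->; ring.
Qed.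

Lemma ArgE_neg (w : C) : ImC w < 0 -> Arg w = - (pi / 2) - atan (ReC w / ImC w).
Proof.
move=> y0; have w0 : w != 0 by apply: contraTneq y0 => ->; rewrite ltxx.
have [h1 h2] := cosArg w0; have r0 : 0 < nm w by rewrite nm_gt0.
have rng : - pi < Arg w < 0.
  have p0 := trigo.pi_gt0 R.
  rewrite /Arg; case: (ltrgt0P (ReC w)) => hx; rewrite ?(le_gtF (ltW y0)) ?(lt_geF y0) ?y0.
  - have a1 := @atan_gtNpi2 R (ImC w / ReC w).
    have a0 : atan (ImC w / ReC w) < 0.
      by rewrite -[ltRHS]trigo.atan0 trigo.lt_atan // pmulr_llt0 // invr_gt0.
    move: p0 a0 a1; move: (@pi _) (atan _) => p t; clear; move=> *; apply/andP; split; lra.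
  - have a1 := @atan_ltpi2 R (ImC w / ReC w).
    have a0 : 0 < atan (ImC w / ReC w).
      by rewrite -[ltLHS]trigo.atan0 trigo.lt_atan // nmulr_rgt0 // invr_lt0.
    move: p0 a0 a1; move: (@pi _) (atan _) => p t; clear; move=> *; apply/andP; split; lra.
  by apply/andP; split; lra.
have rng2 : - (pi / 2) - Arg w \in `]- (pi / 2), pi / 2[.
  by rewrite in_itv /=; apply/andP; split; lra.
have := trigo.tanK rng2; rewrite /tan -opprD trigo.sinN trigo.cosN.
rewrite trigo.sinD trigo.cosD trigo.cos_pihalf trigo.sin_pihalf !mul0r !mul1r addr0 sub0r.
have -> : - cos (Arg w) / - sin (Arg w) = ReC w / ImC w.
  by rewrite -h1 -h2 invrN mulrNN -mulf_div divff ?mul1r ?gt_eqF.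
by move=> ->; ring.
Qed.

Lemma cts_RC_comp (g : R -> R) (phi : C -> R) (z : C) :
  (forall e : R, 0 < e -> exists2 d : R, 0 < d &
     forall x : R, `|x - phi z| < d -> `|g x - g (phi z)| < e) ->
  cts (fun w => RC (phi w)) z -> cts (fun w => RC (g (phi w))) z.
Proof.
move=> hg hphi e e0; have [d d0 hd] := hg e e0.
by apply: nb_imp (hphi d d0) => w; rewrite -!RCB !nmRC; apply: hd.
Qed.

Lemma cts_Re z : cts (fun w => RC (ReC w)) z.
Proof.
move=> e e0; exists e => // w; apply: le_lt_trans.
by rewrite -RCB nmRC -ReN -ReD abs_Re_le.
Qed.

Lemma cts_Im z : cts (fun w => RC (ImC w)) z.
Proof.
move=> e e0; exists e => // w; apply: le_lt_trans.
by rewrite -RCB nmRC -ImN -ImD abs_Im_le.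
Qed.

Lemma cts_nm z : cts (fun w => RC (nm w)) z.
Proof.
move=> e e0; exists e => // w; apply: le_lt_trans.
rewrite -RCB nmRC ler_norml; have := nm_le_dist w z; have := nm_le_dist z w.
by rewrite (nm_distC z); move=> *; apply/andP; split; lra.
Qed.

Lemma nb_Im (z : C) : ImC z != 0 -> nb z (fun w => ImC w * ImC z > 0).
Proof.
move=> h; exists `|ImC z|; first by rewrite normr_gt0.
move=> w hw; have : `|ImC w - ImC z| < `|ImC z|.
  by apply: le_lt_trans hw; rewrite -ImN -ImD abs_Im_le.
case: (ltrgt0P (ImC z)) h => // h _; rewrite ltr_norml => /andP[h1 h2].
  by rewrite mulr_gt0 //; lra.
by rewrite nmulr_lgt0 //; lra.
Qed.

Lemma cts_Log (z : C) : ImC z != 0 -> cts LogC z.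
Proof.
move=> iz; have z0 : z != 0 by apply: contraNneq iz => ->.
have r0 : 0 < nm z by rewrite nm_gt0.
have cq : cts (fun w => RC (ReC w / ImC w)) z.
  apply: cts_loc (ctsM (cts_Re z) (ctsV (cts_Im z) _)); last by rewrite RC_eq0.
  by apply: nb_true => w; rewrite RCM RCV.
have ca := cts_RC_comp (@continuousR_atan _) cq.
have cl := cts_RC_comp (continuousR_ln r0) (cts_nm z).
have key (c : R) : cts (fun w => RC (ln (nm w)) + (iC * (RC c + -1 * RC (atan (ReC w / ImC w))))) z.
  apply: ctsD cl (ctsM (cts_cst _ _) (ctsD (cts_cst _ _) (ctsM (cts_cst _ _) ca))).
have LE w : LogC w = RC (ln (nm w)) + iC * RC (Arg w).
  by rewrite /LogC -nm_def; apply: CeqP; rewrite !ReImE /=; ring.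
case: (ltrgt0P (ImC z)) iz => // h _.
  apply: cts_loc (key (pi / 2)).
  have := nb_Im (z := z); rewrite gt_eqF // => /(_ isT); apply: nb_imp => w.
  rewrite pmulr_lgt0 // => hw; rewrite LE ArgE_pos // RCB; ring.
apply: cts_loc (key (- (pi / 2))).
have := nb_Im (z := z); rewrite lt_eqF // => /(_ isT); apply: nb_imp => w.
rewrite nmulr_lgt0 // => hw; rewrite LE ArgE_neg // RCB; ring.
Qed.

(** The inverse function rule in Caratheodory's form: if [p] is the factor of the exponential at
    [LogC z], then [1 / p (LogC w)] is one for the logarithm at [z]. *)
Lemma isd_Log (z : C) : ImC z != 0 -> isd LogC z z^-1.
Proof.
move=> iz; have z0 : z != 0 by apply: contraNneq iz => ->.
have cL := cts_Log iz.
have [p [cp pL hp]] := isd_expC (LogC z); rewrite LogCK // in pL.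
have cq := cts_comp cL cp.
have q0 : p (LogC z) != 0 by rewrite pL.
have nz := cts_neq0 (cts_id z) z0.
apply: (@isd_loc _ (fun w => LogC z + (p (LogC w))^-1 * (w - z))).
  apply: nb_imp (nb_and nz (cts_neq0 cq q0)) => w [/= w0 pw0].
  have := hp (LogC w); rewrite !LogCK // => e.
  have e2 : w - z = p (LogC w) * (LogC w - LogC z) by rewrite {1}e; ring.
  by rewrite e2 mulKf //; ring.
exists (fun w => (p (LogC w))^-1); split; [exact: ctsV|by rewrite pL|].
by move=> w; rewrite subrr mulr0 addr0.
Qed.

Lemma cpowE (w : C) k : w != 0 -> cpow w k = expC (RC k * LogC w).
Proof. by rewrite /cpow => /negbTE ->. Qed.

Lemma cpow_neq0 (w : C) k : w != 0 -> cpow w k != 0.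
Proof. by move=> w0; rewrite cpowE // expC_neq0. Qed.

Lemma cpowDn (w : C) k n : w != 0 -> cpow w (k + n%:R) = cpow w k * w ^+ n.
Proof.
move=> w0; rewrite !cpowE // RCD mulrDl expCD RCn expCX LogCK //.
Qed.

Lemma cpowN (w : C) k : w != 0 -> cpow w (- k) = (cpow w k)^-1.
Proof. by move=> w0; rewrite !cpowE // RCN mulNr expCN. Qed.

Lemma isd_cpow (z : C) k : ImC z != 0 -> isd (fun w => cpow w k) z (RC k / z * cpow z k).
Proof.
move=> iz; have z0 : z != 0 by apply: contraNneq iz => ->.
have h := isdZ (RC k) (isd_Log iz).
apply: isd_loc (isd_eq (isd_comp h (isd_expC _)) _).
  by apply: nb_imp (cts_neq0 (cts_id z) z0) => w w0; rewrite cpowE.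
by rewrite cpowE // mulrC.
Qed.

(** H covers the punctured unit disc, so an identity on H carries over to power series in [q],
    except at [q = 0]. *)
Lemma qC_onto (w : C) : w != 0 -> nm w < 1 -> exists2 z, inH z & qC z = w.
Proof.
move=> w0 w1; exists (LogC w / tpi).
  rewrite /inH -nm_eC_lt1 eCE mulrC divfK ?tpi_neq0 // LogCK //.
by rewrite /qC eCE mulrC divfK ?tpi_neq0 // LogCK.
Qed.

(** * Goursat's theorem on rectangles *)

Definition ctr (f : R -> R) (x : R) : Prop :=
  forall e : R, 0 < e -> exists2 d : R, 0 < d & forall y : R, `|y - x| < d -> `|f y - f x| < e.

Definition ctrs (f : R -> R) (a b : R) : Prop := forall x, a <= x <= b -> ctr f x.

Definition Itg (f : R -> R) (a b : R) : R := @RInt.RInt Hierarchy.R_CompleteNormedModule f a b.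

Lemma ctr_continuous f x : ctr f x -> @Continuity.continuous Hierarchy.R_UniformSpace Hierarchy.R_UniformSpace f x.
Proof.
move=> cf P [e he]; have /RltP e0 := RIneq.cond_pos e.
have [d /RltP d0 hd] := cf _ e0; exists (RIneq.mkposreal d d0) => y hy; apply: he.
have : Rdefinitions.Rlt (Rbasic_fun.Rabs (Rdefinitions.Rminus y x)) d by exact: hy.
rewrite RabsE RminusE => /RltP hh; have := hd y hh.
move=> /RltP h2; rewrite -RminusE -RabsE in h2; exact: h2.
Qed.

Lemma ex_Itg f a b : a <= b -> ctrs f a b -> @RInt.ex_RInt Hierarchy.R_NormedModule f a b.
Proof.
move=> ab cf; apply: (@RInt.ex_RInt_continuous Hierarchy.R_CompleteNormedModule) => z.
have /RleP ab' := ab; rewrite Rbasic_fun.Rmin_left // Rbasic_fun.Rmax_right // => -[/RleP h1 /RleP h2].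
by apply: ctr_continuous; apply: cf; rewrite h1.
Qed.

Lemma Itg_lin k f g a b : a <= b -> ctrs f a b -> ctrs g a b ->
  Itg (fun x => k * f x + g x) a b = k * Itg f a b + Itg g a b.
Proof.
move=> ab cf cg; have hf := ex_Itg ab cf; have hg := ex_Itg ab cg.
have hk := @RInt.ex_RInt_scal Hierarchy.R_NormedModule f a b k hf.
have e1 := @RInt.RInt_plus Hierarchy.R_CompleteNormedModule _ g a b hk hg.
have e2 := @RInt.RInt_scal Hierarchy.R_CompleteNormedModule f a b k hf.
by rewrite e2 in e1; exact: e1.
Qed.

Lemma Itg_ext f g a b : a <= b -> (forall x, a <= x <= b -> f x = g x) -> Itg f a b = Itg g a b.
Proof.
move=> ab h; apply: (@RInt.RInt_ext Hierarchy.R_CompleteNormedModule) => x.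
have /RleP ab' := ab; rewrite Rbasic_fun.Rmin_left // Rbasic_fun.Rmax_right // => -[/RltP h1 /RltP h2].
by apply: h; rewrite !ltW.
Qed.

Lemma ctrs_sub f a b c d : a <= c -> d <= b -> ctrs f a b -> ctrs f c d.
Proof. by move=> ac db h x /andP[h1 h2]; apply: h; rewrite (le_trans ac) //= (le_trans h2). Qed.

Lemma Itg_chasles f a b c : a <= c -> c <= b -> ctrs f a b -> Itg f a b = Itg f a c + Itg f c b.
Proof.
move=> ac cb cf; symmetry.
apply: (@RInt.RInt_Chasles Hierarchy.R_CompleteNormedModule); apply: ex_Itg => //.
  exact: ctrs_sub cf.
exact: ctrs_sub cf.
Qed.

Lemma Itg_const (c a b : R) : Itg (fun=> c) a b = (b - a) * c.
Proof. exact: (@RInt.RInt_const Hierarchy.R_CompleteNormedModule). Qed.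

Lemma Itg_bound f a b (M : R) : a <= b -> ctrs f a b -> (forall x, a <= x <= b -> `|f x| <= M) ->
  `|Itg f a b| <= (b - a) * M.
Proof.
move=> ab cf hM; rewrite -RabsE; apply/RleP; apply: RInt.abs_RInt_le_const.
- exact/RleP.
- exact: ex_Itg.
by move=> t [/RleP h1 /RleP h2]; rewrite RabsE; apply/RleP; apply: hM; rewrite h1.
Qed.

Lemma Itg_le f g a b : a <= b -> ctrs f a b -> ctrs g a b -> (forall x, a <= x <= b -> f x <= g x) ->
  Itg f a b <= Itg g a b.
Proof.
move=> ab cf cg h; apply/RleP; apply: RInt.RInt_le; [exact/RleP|exact: ex_Itg|exact: ex_Itg|].
by move=> x [/RltP h1 /RltP h2]; apply/RleP; apply: h; rewrite !ltW.
Qed.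

Lemma ctr_cst (c x : R) : ctr (fun=> c) x.
Proof. by move=> e e0; exists 1 => // y _; rewrite subrr normr0. Qed.

Lemma ctrD f g x : ctr f x -> ctr g x -> ctr (fun y => f y + g y) x.
Proof.
move=> cf cg e e0; have e2 : 0 < e / 2 by rewrite divr_gt0.
have [d d0 hd] := cf _ e2; have [c c0 hc] := cg _ e2.
exists (Num.min d c); first by rewrite lt_min d0.
move=> y; rewrite lt_min => /andP[/hd h1 /hc h2].
have := ler_normD (f y - f x) (g y - g x); rewrite addrACA -opprD; lra.
Qed.

Lemma ctrZ k f x : ctr f x -> ctr (fun y => k * f y) x.
Proof.
move=> cf e e0; have k0 : 0 < `|k| + 1 by rewrite ltr_wpDl.
have [d d0 hd] := cf _ (divr_gt0 e0 k0).
exists d => // y /hd; rewrite ltr_pdivlMr // -mulrBr normrM => h.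
apply: le_lt_trans h; rewrite mulrC; apply: ler_wpM2l => //; lra.
Qed.

Lemma Itg_sub f g a b : a <= b -> ctrs f a b -> ctrs g a b ->
  Itg (fun x => f x - g x) a b = Itg f a b - Itg g a b.
Proof.
move=> ab cf cg; have := Itg_lin (-1) ab cg cf.
rewrite (_ : (fun x => _) = (fun x => f x - g x)) => [->|]; last by apply/funext => x; lra.
by lra.
Qed.

Lemma ctr_line (f : C -> C) (phi : R -> C) (P : C -> R) (x : R) :
  (forall z w, `|P z - P w| <= nm (z - w)) ->
  (forall y, nm (phi y - phi x) <= `|y - x|) -> cts f (phi x) -> ctr (fun y => P (f (phi y))) x.
Proof.
move=> hP hphi cf e e0; have [d d0 hd] := cf e e0; exists d => // y hy.
by apply: (le_lt_trans (hP _ _)); apply: hd; apply: le_lt_trans hy; exact: hphi.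
Qed.

Lemma Re_lip z w : `|ReC z - ReC w| <= nm (z - w).
Proof. by rewrite -ReN -ReD abs_Re_le. Qed.
Lemma Im_lip z w : `|ImC z - ImC w| <= nm (z - w).
Proof. by rewrite -ImN -ImD abs_Im_le. Qed.
Lemma hline_lip (y0 x y : R) : nm ((y +i* y0) - (x +i* y0)) <= `|y - x|.
Proof. by rewrite (_ : _ - _ = RC (y - x)) ?nmRC //; apply: CeqP; rewrite !ReImE /=; ring. Qed.
Lemma vline_lip (x0 x y : R) : nm ((x0 +i* y) - (x0 +i* x)) <= `|y - x|.
Proof.
rewrite (_ : _ - _ = iC * RC (y - x)) ?nmM ?nm_i ?mul1r ?nmRC //.
by apply: CeqP; rewrite !ReImE /=; ring.
Qed.

Definition hI (f : C -> C) (y a b : R) : R := Itg (fun x => ReC (f (x +i* y))) a b.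
Definition vI (f : C -> C) (x c d : R) : R := Itg (fun y => ImC (f (x +i* y))) c d.

(* The real part of the integral of f along the boundary of the rectangle [a,b] x [c,d]. *)
Definition bdI (f : C -> C) (a b c d : R) : R :=
  hI f c a b - hI f d a b - vI f b c d + vI f a c d.

Definition rect (a b c d : R) (z : C) : Prop := a <= ReC z <= b /\ c <= ImC z <= d.

Lemma rect_sub a b c d a' b' c' d' z : a <= a' -> b' <= b -> c <= c' -> d' <= d ->
  rect a' b' c' d' z -> rect a b c d z.
Proof.
move=> h1 h2 h3 h4 [/andP[x1 x2] /andP[y1 y2]]; split.
  by rewrite (le_trans h1) ?(le_trans x2).
by rewrite (le_trans h3) ?(le_trans y2).
Qed.

Lemma rect_diam a b c d z w : rect a b c d z -> rect a b c d w ->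
  nm (z - w) <= (b - a) + (d - c).
Proof.
move=> [/andP[x1 x2] /andP[y1 y2]] [/andP[x1' x2'] /andP[y1' y2']].
apply: (le_trans (nm_le_ReIm _)); rewrite ReD ImD ReN ImN.
by apply: lerD; rewrite ler_norml; apply/andP; split; lra.
Qed.

Definition ctsrect (f : C -> C) (a b c d : R) : Prop := forall z, rect a b c d z -> cts f z.

Lemma ctr_h f a b c d y : ctsrect f a b c d -> c <= y <= d ->
  ctrs (fun x => ReC (f (x +i* y))) a b.
Proof.
move=> cf hy x hx; apply: (ctr_line (phi := fun x => x +i* y)) Re_lip (hline_lip y x) _.
by apply: cf; split.
Qed.

Lemma ctr_v f a b c d x : ctsrect f a b c d -> a <= x <= b ->
  ctrs (fun y => ImC (f (x +i* y))) c d.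
Proof.
move=> cf hx y hy; apply: (ctr_line (phi := fun y => x +i* y)) Im_lip (vline_lip x y) _.
by apply: cf; split.
Qed.

Lemma bdI_splitx f a m b c d : a <= m -> m <= b -> c <= d -> ctsrect f a b c d ->
  bdI f a b c d = bdI f a m c d + bdI f m b c d.
Proof.
move=> am mb cd cf; rewrite /bdI /hI.
have hc : c <= c <= d by rewrite lexx cd.
have hd : c <= d <= d by rewrite lexx cd.
rewrite (Itg_chasles am mb (ctr_h cf hc)) (Itg_chasles am mb (ctr_h cf hd)).
move: (Itg _ _ _) (Itg _ _ _) (Itg _ _ _) (Itg _ _ _) (vI _ _ _ _) (vI _ _ _ _) (vI _ _ _ _) => *.
ring.
Qed.

Lemma bdI_splity f a b c m d : a <= b -> c <= m -> m <= d -> ctsrect f a b c d ->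
  bdI f a b c d = bdI f a b c m + bdI f a b m d.
Proof.
move=> ab cm md cf; rewrite /bdI /vI.
have ha : a <= a <= b by rewrite lexx ab.
have hb : a <= b <= b by rewrite lexx ab.
rewrite (Itg_chasles cm md (ctr_v cf ha)) (Itg_chasles cm md (ctr_v cf hb)).
move: (Itg _ _ _) (Itg _ _ _) (Itg _ _ _) (Itg _ _ _) (hI _ _ _ _) (hI _ _ _ _) (hI _ _ _ _) => *.
ring.
Qed.

Lemma bdI_sub f g a b c d : a <= b -> c <= d -> ctsrect f a b c d -> ctsrect g a b c d ->
  bdI (fun z => f z - g z) a b c d = bdI f a b c d - bdI g a b c d.
Proof.
move=> ab cd cf cg.
have hh y : c <= y <= d -> hI (fun z => f z - g z) y a b = hI f y a b - hI g y a b.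
  move=> hy; rewrite /hI -(Itg_sub ab (ctr_h cf hy) (ctr_h cg hy)).
  by apply: Itg_ext => // x _; rewrite ReD ReN.
have hv x : a <= x <= b -> vI (fun z => f z - g z) x c d = vI f x c d - vI g x c d.
  move=> hx; rewrite /vI -(Itg_sub cd (ctr_v cf hx) (ctr_v cg hx)).
  by apply: Itg_ext => // y _; rewrite ImD ImN.
by rewrite /bdI !hh ?hv ?lexx ?ab ?cd //; ring.
Qed.

Lemma bdI_bound f a b c d M : a <= b -> c <= d -> ctsrect f a b c d ->
  (forall z, rect a b c d z -> nm (f z) <= M) ->
  `|bdI f a b c d| <= 2 * ((b - a) + (d - c)) * M.
Proof.
move=> ab cd cf hM.
have hh y : c <= y <= d -> `|hI f y a b| <= (b - a) * M.
  move=> hy; apply: Itg_bound => //; first exact: ctr_h cf hy.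
  by move=> x hx; apply: (le_trans (abs_Re_le _)); apply: hM.
have hv x : a <= x <= b -> `|vI f x c d| <= (d - c) * M.
  move=> hx; apply: Itg_bound => //; first exact: ctr_v cf hx.
  by move=> y hy; apply: (le_trans (abs_Im_le _)); apply: hM.
have := hh c; have := hh d; have := hv a; have := hv b; rewrite !lexx ab cd => /(_ isT) h1 /(_ isT) h2 /(_ isT) h3 /(_ isT) h4.
rewrite /bdI; have m1 := ler_normB (hI f c a b) (hI f d a b).
have m2 := ler_normB (hI f c a b - hI f d a b) (vI f b c d).
have m3 := ler_normD (hI f c a b - hI f d a b - vI f b c d) (vI f a c d).
lra.
Qed.

Lemma cts_affine (p l z0 z : C) : cts (fun w => p + l * (w - z0)) z.
Proof.
apply: ctsD (cts_cst _ _) (ctsM (cts_cst _ _) (ctsD (cts_id _) (cts_cst _ _))).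
Qed.

(** The horizontal sides differ in real part by [Im l] times the height, the vertical ones in
    imaginary part by [Im l] times the width; both integrate to [Im l] times the area and cancel. *)
Lemma bdI_affine (p l z0 : C) a b c d : a <= b -> c <= d ->
  bdI (fun w => p + l * (w - z0)) a b c d = 0.
Proof.
move=> ab cd; set g := fun w => _.
have cg : ctsrect g a b c d by move=> z _; exact: cts_affine.
have e1 : hI g c a b - hI g d a b = (b - a) * (ImC l * (d - c)).
  rewrite /hI -(Itg_sub ab (ctr_h cg _) (ctr_h cg _)) ?lexx ?cd // -Itg_const.
  by apply: Itg_ext => // x _; rewrite /g !ReImE /=; ring.
have e2 : vI g b c d - vI g a c d = (d - c) * (ImC l * (b - a)).
  rewrite /vI -(Itg_sub cd (ctr_v cg _) (ctr_v cg _)) ?lexx ?ab // -Itg_const.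
  by apply: Itg_ext => // x _; rewrite /g !ReImE /=; ring.
rewrite /bdI; move: (hI _ _ _ _) (hI _ _ _ _) (vI _ _ _ _) (vI _ _ _ _) e1 e2 => y x v u e1 e2.
have e : x - y - u + v = (x - y) - (u - v) by ring.
by rewrite e e1 e2; ring.
Qed.

Definition quad : Type := (R * R * R * R)%type.

(** Some quarter of [q] carries at least a quarter of the boundary integral. The last quarter is the
    default, justified in [goursat] by the failure of the three tests. *)
Definition bisect (E : quad -> R) (q : quad) : quad :=
  let: (a, b, c, d) := q in
  let m := (a + b) / 2 in let n := (c + d) / 2 in
  if `|E q| <= 4 * `|E (a, m, c, n)| then (a, m, c, n) else
  if `|E q| <= 4 * `|E (m, b, c, n)| then (m, b, c, n) else
  if `|E q| <= 4 * `|E (a, m, n, d)| then (a, m, n, d) else (m, b, n, d).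

Lemma goursat f a b c d : a <= b -> c <= d ->
  (forall z, rect a b c d z -> exists l, isd f z l) -> bdI f a b c d = 0.
Proof.
move=> ab cd hol; apply/eqP; rewrite -normr_eq0; apply/negPn/negP => nz.
have cf : ctsrect f a b c d by move=> z /hol[l /isd_cts].
pose E (q : quad) := let: (a, b, c, d) := q in bdI f a b c d.
pose Q n := iter n (bisect E) (a, b, c, d).
pose del : R := `|bdI f a b c d|; have del0 : 0 < del by rewrite lt_def nz normr_ge0.
pose s : R := (b - a) + (d - c).
pose h : R := 1 / 2.
have inv n : let: (a', b', c', d') := Q n in
  [/\ [/\ a <= a', b' <= b, c <= c' & d' <= d], b' - a' = (b - a) * h ^+ n, d' - c' = (d - c) * h ^+ n
    & del * (h ^+ n) ^+ 2 <= `|bdI f a' b' c' d'|].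
  elim: n => [|n]; first by rewrite /Q /= expr0 !mulr1 expr1n mulr1 !lexx.
  rewrite /Q iterS -/(Q n); case: (Q n) => [[[a' b'] c'] d'] [[h1 h2 h3 h4] eb ed hE].
  have hn0 : 0 <= h ^+ n by rewrite exprn_ge0 // /h; lra.
  have ab' : a' <= b' by rewrite -subr_ge0 eb mulr_ge0 // subr_ge0.
  have cd' : c' <= d' by rewrite -subr_ge0 ed mulr_ge0 // subr_ge0.
  have cf' : ctsrect f a' b' c' d'.
    by move=> z /(rect_sub h1 h2 h3 h4) /cf.
  pose m : R := (a' + b') / 2; pose k : R := (c' + d') / 2.
  have am : a' <= m by rewrite /m; lra.
  have mb : m <= b' by rewrite /m; lra.
  have ck : c' <= k by rewrite /k; lra.
  have kd : k <= d' by rewrite /k; lra.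
  have c1 : ctsrect f a' b' c' k.
    by move=> z /(rect_sub (lexx _) (lexx _) (lexx _) kd) /cf'.
  have c2 : ctsrect f a' b' k d'.
    by move=> z /(rect_sub (lexx _) (lexx _) ck (lexx _)) /cf'.
  have sp : bdI f a' b' c' d' =
     bdI f a' m c' k + bdI f m b' c' k + (bdI f a' m k d' + bdI f m b' k d').
    by rewrite (bdI_splity ab' ck kd cf') (bdI_splitx am mb ck c1) (bdI_splitx am mb kd c2).
  have em : m - a' = (b - a) * h ^+ n.+1 by rewrite exprS mulrCA -eb /m /h; lra.
  have em' : b' - m = (b - a) * h ^+ n.+1 by rewrite exprS mulrCA -eb /m /h; lra.
  have ek : k - c' = (d - c) * h ^+ n.+1 by rewrite exprS mulrCA -ed /k /h; lra.
  have ek' : d' - k = (d - c) * h ^+ n.+1 by rewrite exprS mulrCA -ed /k /h; lra.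
  have fin x : `|bdI f a' b' c' d'| <= 4 * x -> del * (h ^+ n.+1) ^+ 2 <= x.
    move=> hx; have -> : del * (h ^+ n.+1) ^+ 2 = del * (h ^+ n) ^+ 2 / 4.
      have eh : h ^+ n.+1 = h ^+ n / 2 by rewrite exprS /h mulrC mul1r.
      by rewrite eh expr_div_n mulrA; congr (_ / _); rewrite expr2 -natrM.
    lra.
  rewrite /bisect -/m -/k /E; case: ifP => [/fin ?|/negbT n1].
    by split => //; split => //; apply: le_trans h2 || apply: le_trans h4.
  case: ifP => [/fin ?|/negbT n2].
    by split => //; split => //; [apply: le_trans am|apply: le_trans h4].
  case: ifP => [/fin ?|/negbT n3].
    by split => //; split => //; [apply: le_trans h2|apply: le_trans ck].
  split => //; first by split => //; [apply: le_trans am|apply: le_trans ck].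
  apply: fin; move: n1 n2 n3; rewrite -!ltNge sp.
  move: (bdI _ _ _ _ _) (bdI _ _ _ _ _) (bdI _ _ _ _ _) (bdI _ _ _ _ _) => v u y x.
  have := ler_normD (x + y) (u + v); have := ler_normD x y; have := ler_normD u v; lra.
pose qa (q : quad) := let: (a, _, _, _) := q in a.
pose qb (q : quad) := let: (_, b, _, _) := q in b.
pose qc (q : quad) := let: (_, _, c, _) := q in c.
pose qd (q : quad) := let: (_, _, _, d) := q in d.
have hpos n : 0 <= h ^+ n by rewrite exprn_ge0 // /h; lra.
have mono n k : qa (Q n) <= qa (Q (n + k)%N) /\ qb (Q (n + k)%N) <= qb (Q n) /\
   qc (Q n) <= qc (Q (n + k)%N) /\ qd (Q (n + k)%N) <= qd (Q n).
  elim: k => [|k [i1 [i2 [i3 i4]]]]; first by rewrite addn0.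
  have := inv (n + k)%N; rewrite addnS.
  have -> : Q (n + k).+1 = bisect E (Q (n + k)%N) by rewrite /Q iterS.
  case: (Q (n + k)%N) i1 i2 i3 i4 => [[[a' b'] c'] d'] /= i1 i2 i3 i4 [_ eb ed _].
  have ab' : a' <= b' by rewrite -subr_ge0 eb mulr_ge0 // subr_ge0.
  have cd' : c' <= d' by rewrite -subr_ge0 ed mulr_ge0 // subr_ge0.
  by do 3?[case: ifP => _] => /=; clear -i1 i2 i3 i4 ab' cd'; repeat split; lra.
(* Nested intervals: the supremum of the left ends lies in all of them. *)
have lub (u v : nat -> R) : (forall n k, u n <= u (n + k)%N /\ v (n + k)%N <= v n) ->
    (forall n, u n <= v n) -> exists x, forall n, u n <= x <= v n.
  move=> huv uv; have cross n k : u n <= v k.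
    have [h1 _] := huv n k; have [_ h2] := huv k n; rewrite (addnC k) in h2.
    exact: le_trans h1 (le_trans (uv _) h2).
  exists (sup [set u n | n in setT]) => n; apply/andP; split.
    apply: ub_le_sup; last by exists n.
    by exists (v 0%N) => _ [k _ <-].
  apply: ge_sup; first by exists (u 0%N), 0%N.
  by move=> _ [k _ <-].
have len n : qa (Q n) <= qb (Q n) /\ qc (Q n) <= qd (Q n).
  have := inv n; case: (Q n) => [[[a' b'] c'] d'] /= [_ eb ed _].
  by split; rewrite -subr_ge0 ?eb ?ed mulr_ge0 // subr_ge0.
have [x hx] : exists x, forall n, qa (Q n) <= x <= qb (Q n).
  apply: lub => n; last by have [] := len n.
  by move=> k; have [? [? _]] := mono n k.
have [y hy] : exists y, forall n, qc (Q n) <= y <= qd (Q n).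
  apply: lub => n; last by have [] := len n.
  by move=> k; have [_ [_ ?]] := mono n k.
have [l hl] : exists l, isd f (x +i* y) l by apply: hol; split; [exact: (hx 0%N)|exact: (hy 0%N)].
have s0 : 0 <= s by rewrite /s; lra.
(* With this [e] the affine approximation yields [del <= 2 e s ^ 2], although
   [del = 4 e (s ^ 2 + 1)]. *)
pose e : R := del / (4 * (s ^+ 2 + 1)).
have q0 : 0 < s ^+ 2 + 1 by have := sqr_ge0 s; lra.
have e0 : 0 < e by rewrite divr_gt0 // mulr_gt0.
move/isdP: hl => /(_ e e0) [r r0 hr].
have h01 : 0 <= h < 1 by rewrite /h; apply/andP; split; lra.
have [N /(_ N (leqnn N)) HN] := geo_small s h01 r0.
have := inv N; have := hx N; have := hy N; have := len N.
case: (Q N) => [[[a' b'] c'] d'] /= [ab' cd'] hy' hx' [[i1 i2 i3 i4] eb ed hE].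
have cf' : ctsrect f a' b' c' d'.
  by move=> z /(rect_sub i1 i2 i3 i4) /cf.
have ca : ctsrect (fun w => f (x +i* y) + l * (w - (x +i* y))) a' b' c' d' by move=> z _; exact: cts_affine.
have es : b' - a' + (d' - c') = s * h ^+ N by rewrite eb ed /s; ring.
have cfa : ctsrect (fun z => f z - (f (x +i* y) + l * (z - (x +i* y)))) a' b' c' d'.
  move=> z hz; apply: ctsD (cf' z hz) _.
  apply: cts_loc (ctsM (cts_cst (-1) z) (ca z hz)); apply: nb_true => w /=; ring.
have bnd z : rect a' b' c' d' z -> nm (f z - (f (x +i* y) + l * (z - (x +i* y)))) <= e * (s * h ^+ N).
  move=> hz'; have hz : nm (z - (x +i* y)) <= s * h ^+ N.
    by rewrite -es; apply: rect_diam hz' _.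
  rewrite opprD addrA; apply: (le_trans (hr _ (le_lt_trans hz HN))).
  by rewrite ler_wpM2l // ltW.
have := bdI_bound ab' cd' cfa bnd.
rewrite (bdI_sub ab' cd' cf' ca) (bdI_affine _ _ _ ab' cd') subr0 es => h1.
have h2 := le_trans hE h1.
have hN : 0 < h ^+ N by rewrite exprn_gt0 // /h; lra.
have : del * (h ^+ N) ^+ 2 <= 2 * e * s ^+ 2 * (h ^+ N) ^+ 2 by apply: (le_trans h2); rewrite le_eqVlt; apply/orP; left; apply/eqP; ring.
rewrite ler_pM2r ?(exprn_gt0 2 hN) //.
have -> : del = e * (4 * (s ^+ 2 + 1)) by rewrite /e divfK // gt_eqF // mulr_gt0.
have := mulr_gt0 e0 q0; have := mulr_ge0 (ltW e0) (sqr_ge0 s); lra.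
Qed.

(** * Cauchy's formula for periodic functions *)

(** Cut out a square of half side [t] around [z0]: the four other pieces vanish by Goursat's
    theorem, and the square contributes at most [8 t M], because [f] is bounded near [z0]. Then [t]
    is made small. *)
Lemma goursat_punctured f (a b c d : R) (z0 : C) : a < ReC z0 < b -> c < ImC z0 < d ->
  ctsrect f a b c d -> (forall z, rect a b c d z -> z != z0 -> exists l, isd f z l) ->
  bdI f a b c d = 0.
Proof.
move=> /andP[ax xb] /andP[cy yd] cf hol.
set x := ReC z0 in ax xb *; set y := ImC z0 in cy yd *.
have rz : rect a b c d z0 by split; rewrite !ltW.
have [r r0 hr] := cf z0 rz 1 ltr01.
pose M := nm (f z0) + 1; have M0 : 0 < M by have := nm_ge0 (f z0); rewrite /M; lra.
have small (t : R) : 0 < t -> a <= x - t -> x + t <= b -> c <= y - t -> y + t <= d -> 4 * t < r ->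
    `|bdI f a b c d| <= 8 * t * M.
  move=> t0 h1 h2 h3 h4 h5.
  have hx : x - t <= x + t by lra.
  have hy : y - t <= y + t by lra.
  have ab : a <= x + t by lra.
  have cd : c <= d by lra.
  have cd' : c <= y + t by lra.
  have sub a' b' c' d' : a <= a' -> b' <= b -> c <= c' -> d' <= d -> ctsrect f a' b' c' d'.
    by move=> ? ? ? ? z hz; apply: cf; apply: rect_sub hz.
  have zero a' b' c' d' : a <= a' -> a' <= b' -> b' <= b -> c <= c' -> c' <= d' -> d' <= d ->
      ~ rect a' b' c' d' z0 -> bdI f a' b' c' d' = 0.
    move=> i1 i2 i3 i4 i5 i6 nz; apply: goursat => // z hz; apply: hol.
      exact: rect_sub hz.
    by apply/eqP => e; apply: nz; rewrite -e.
  have xt : x - t <= b by lra.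
  have yt : y - t <= d by lra.
  have c1 : ctsrect f a (x + t) c d by apply: sub.
  have c2 : ctsrect f (x - t) (x + t) c d by apply: sub.
  have c3 : ctsrect f (x - t) (x + t) (y - t) d by apply: sub.
  rewrite (bdI_splitx ab h2 cd cf) (bdI_splitx h1 hx cd c1).
  rewrite (bdI_splity hx h3 yt c2) (bdI_splity hx hy h4 c3).
  rewrite (zero a (x - t) c d) //; last by rewrite /rect -/x => -[/andP[_ ?] _]; lra.
  rewrite (zero (x + t) b c d) //; last by rewrite /rect -/x => -[/andP[? _] _]; lra.
  rewrite (zero (x - t) (x + t) c (y - t)) //; last by rewrite /rect -/y => -[_ /andP[_ ?]]; lra.
  rewrite (zero (x - t) (x + t) (y + t) d) //; last by rewrite /rect -/y => -[_ /andP[? _]]; lra.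
  rewrite !addr0 !add0r.
  have cc : ctsrect f (x - t) (x + t) (y - t) (y + t) by apply: sub.
  have := bdI_bound hx hy cc (M := M).
  have -> : 2 * (x + t - (x - t) + (y + t - (y - t))) * M = 8 * t * M by ring.
  apply=> z hz; have hd : nm (z - z0) < r.
    have rz' : rect (x - t) (x + t) (y - t) (y + t) z0.
      by rewrite /rect -/x -/y; split; apply/andP; split; lra.
    by apply: le_lt_trans (rect_diam hz rz') _; lra.
  have := hr z hd; have := nm_le_dist (f z) (f z0); rewrite /M; lra.
apply/eqP; rewrite -normr_eq0 eq_le normr_ge0 andbT leNgt; apply/negP => p.
pose m := Num.min (Num.min (x - a) (b - x)) (Num.min (y - c) (d - y)).
have m0 : 0 < m by rewrite !lt_min !subr_gt0 ax xb cy.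
have [m1 m2 m3 m4] : [/\ m <= x - a, m <= b - x, m <= y - c & m <= d - y].
  by split; rewrite !ge_min lexx ?orbT.
clearbody m.
pose t := Num.min m (Num.min (r / 8) (`|bdI f a b c d| / (16 * M))).
have t0 : 0 < t by rewrite !lt_min m0 !divr_gt0 // mulr_gt0.
have tm : t <= m by rewrite ge_min lexx.
have tr : t <= r / 8 by rewrite !ge_min lexx orbT.
have tb : t <= `|bdI f a b c d| / (16 * M) by rewrite !ge_min lexx !orbT.
clearbody t.
rewrite ler_pdivlMr ?mulr_gt0 // in tb.
have := small t t0; have -> : a <= x - t by lra. have -> : x + t <= b by lra.
have -> : c <= y - t by lra. have -> : y + t <= d by lra.
have -> : 4 * t < r by lra.
by move=> /(_ isT isT isT isT isT); lra.
Qed.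

(** The mean over a period at height [y], to which all later contour integrals reduce. *)
Definition per1 (f : C -> C) (y : R) : C :=
  Itg (fun x => ReC (f (x +i* y))) 0 1 +i* Itg (fun x => ImC (f (x +i* y))) 0 1.

Definition ctsline (f : C -> C) (y : R) : Prop := forall x : R, 0 <= x <= 1 -> cts f (x +i* y).

Lemma ctr_Re f y : ctsline f y -> ctrs (fun x => ReC (f (x +i* y))) 0 1.
Proof.
by move=> cf x hx; apply: (ctr_line (phi := fun x => x +i* y)) Re_lip (hline_lip y x) _; exact: cf.
Qed.

Lemma ctr_Im f y : ctsline f y -> ctrs (fun x => ImC (f (x +i* y))) 0 1.
Proof.
by move=> cf x hx; apply: (ctr_line (phi := fun x => x +i* y)) Im_lip (hline_lip y x) _; exact: cf.
Qed.

Lemma per1_lin (k : C) f g y : ctsline f y -> ctsline g y ->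
  per1 (fun z => k * f z + g z) y = k * per1 f y + per1 g y.
Proof.
move=> cf cg; have rf := ctr_Re cf; have mf := ctr_Im cf; have rg := ctr_Re cg; have mg := ctr_Im cg.
have lin (p q : R) (u v w : R -> R) : ctrs u 0 1 -> ctrs v 0 1 -> ctrs w 0 1 ->
    Itg (fun x => p * u x + (q * v x + w x)) 0 1 = p * Itg u 0 1 + (q * Itg v 0 1 + Itg w 0 1).
  move=> cu cv cw; rewrite Itg_lin // ?Itg_lin // => x hx.
  by apply: ctrD (ctrZ _ (cv x hx)) (cw x hx).
apply: CeqP; rewrite !ReImE /per1 !ReE !ImE.
  have := lin (ReC k) (- ImC k) _ _ _ rf mf rg; rewrite (Itg_ext (g := fun x => ReC (k * f (x +i* y) + g (x +i* y)))) //.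
    by move=> ->; ring.
  by move=> x _; rewrite !ReImE; ring.
have := lin (ReC k) (ImC k) _ _ _ mf rf mg; rewrite (Itg_ext (g := fun x => ImC (k * f (x +i* y) + g (x +i* y)))) //.
  by move=> ->; ring.
by move=> x _; rewrite !ReImE; ring.
Qed.

Lemma per1_ext f g y : (forall x : R, 0 <= x <= 1 -> f (x +i* y) = g (x +i* y)) -> per1 f y = per1 g y.
Proof.
by move=> h; congr (_ +i* _); apply: Itg_ext => // x hx; rewrite h.
Qed.

Lemma per1_cst (c : C) y : per1 (fun=> c) y = c.
Proof. by rewrite /per1 !Itg_const subr0 !mul1r; case: c. Qed.

Lemma per1_bound f y M : ctsline f y -> (forall x : R, 0 <= x <= 1 -> nm (f (x +i* y)) <= M) ->
  nm (per1 f y) <= 2 * M.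
Proof.
move=> cf hM; apply: (le_trans (nm_le_ReIm _)); rewrite /per1 ReE ImE.
have h1 : `|Itg (fun x => ReC (f (x +i* y))) 0 1| <= (1 - 0) * M.
  by apply: Itg_bound (ctr_Re cf) _ => // x hx; apply: le_trans (abs_Re_le _) (hM x hx).
have h2 : `|Itg (fun x => ImC (f (x +i* y))) 0 1| <= (1 - 0) * M.
  by apply: Itg_bound (ctr_Im cf) _ => // x hx; apply: le_trans (abs_Im_le _) (hM x hx).
lra.
Qed.

Lemma ctsline_lin k f g y : ctsline f y -> ctsline g y -> ctsline (fun z => k * f z + g z) y.
Proof. by move=> cf cg x hx; apply: ctsD (ctsM (cts_cst _ _) (cf x hx)) (cg x hx). Qed.

(** [Im f] is the real part of [- i f], so that the real parts computed by [bdI] control the whole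
    mean. *)
Lemma per1_hI f y : per1 f y = hI f y 0 1 +i* hI (fun z => - iC * f z) y 0 1.
Proof.
rewrite /per1 /hI; congr (_ +i* _); apply: Itg_ext => // x _.
by rewrite !ReImE; ring.
Qed.

(** Periodicity cancels the two vertical sides. *)
Lemma per1_bdI f y1 y2 : (forall y, y1 <= y <= y2 -> f (1 +i* y) = f (0 +i* y)) -> y1 <= y2 ->
  bdI f 0 1 y1 y2 = 0 -> bdI (fun z => - iC * f z) 0 1 y1 y2 = 0 -> per1 f y1 = per1 f y2.
Proof.
move=> hp y12; rewrite /bdI.
have -> : vI f 1 y1 y2 = vI f 0 y1 y2 by apply: Itg_ext => // y hy; rewrite hp.
have -> : vI (fun z => - iC * f z) 1 y1 y2 = vI (fun z => - iC * f z) 0 y1 y2.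
  by apply: Itg_ext => // y hy; rewrite hp.
rewrite !subrK => /eqP; rewrite subr_eq0 => /eqP h1 /eqP; rewrite subr_eq0 => /eqP h2.
by rewrite !per1_hI h1 h2.
Qed.

Definition holstrip (f : C -> C) (P : R -> Prop) : Prop :=
  forall z, P (ImC z) -> exists l, isd f z l.

Lemma shift1 (y : R) : 1 +i* y = (0 +i* y) + 1.
Proof. by apply: CeqP; rewrite !ReImE /=; ring. Qed.

Lemma per1_strip f (P : R -> Prop) y1 y2 : holstrip f P -> (forall z, f (z + 1) = f z) ->
  (forall y, Num.min y1 y2 <= y <= Num.max y1 y2 -> P y) -> per1 f y1 = per1 f y2.
Proof.
move=> hol hp; wlog y12 : y1 y2 / y1 <= y2 => [hw|].
  case/orP: (le_total y1 y2) => /hw h; first exact: h.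
  by move=> hP; rewrite h // => y; rewrite minC maxC; exact: hP.
rewrite (min_idPl y12) (max_idPr y12) => hP.
apply: per1_bdI => // [y _||]; first by rewrite shift1 hp.
  by apply: goursat => // z [_ /hP/hol].
apply: goursat => // z [_ /hP/hol[l hl]]; exists (- iC * l); exact: isdZ.
Qed.

(** Used to extend identities to the points that a parametrisation misses. *)
Lemma cts_dense_eq f g z : cts f z -> cts g z ->
  (forall d : R, 0 < d -> exists w, nm (w - z) < d /\ f w = g w) -> f z = g z.
Proof.
move=> cf cg h; apply/eqP; rewrite -subr_eq0 -nm_eq0 eq_le nm_ge0 andbT leNgt.
apply/negP => p; have q : 0 < nm (f z - g z) / 2 by rewrite divr_gt0.
have [d d0 hd] := nb_and (cf _ q) (cg _ q).
have [w [/hd [h1 h2] e]] := h d d0.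
have := nm_tri (f z) (f w) (g z); rewrite nm_distC in h1; rewrite {2}e; lra.
Qed.

Lemma Re_expC (v : C) : ReC (expC v) = expR (ReC v) * cos (ImC v).
Proof. by rewrite /expC ReM ReRC ImRC /=; ring. Qed.

Lemma Re_tpi (w : C) : ReC (tpi * w) = - (2 * pi * ImC w).
Proof. by rewrite /tpi !ReImE; ring. Qed.

Lemma Im_tpi (w : C) : ImC (tpi * w) = 2 * pi * ReC w.
Proof. by rewrite /tpi !ReImE; ring. Qed.

(** The modulus forces [Im w = 0]. Then [cos (2 pi x) = 1] gives [sin (pi x) = 0], and the sine has
    no zero strictly between 0 and [pi]. *)
Lemma eC_eq1 (w : C) : eC w = 1 -> `|ReC w| < 1 -> w = 0.
Proof.
move=> e1 hw; have h0 : ImC w = 0.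
  have h := nm_eC w; rewrite e1 nm1 in h.
  have : - (2 * pi * ImC w) = 0 by apply: exp.expR_inj; rewrite -h exp.expR0.
  by move/eqP; rewrite oppr_eq0 mulf_eq0 mulf_eq0 pnatr_eq0 (negbTE pi_neq0) /= => /eqP.
apply: CeqP => //; rewrite Re0.
have : ReC (eC w) = 1 by rewrite e1.
rewrite eCE Re_expC Re_tpi Im_tpi h0 mulr0 oppr0 exp.expR0 mul1r.
have -> : 2 * pi * ReC w = (pi * ReC w) *+ 2 by rewrite -[RHS]mulr_natl mulrA.
rewrite trigo.cos_mulr2n -[_ *+ 2]mulr_natl => h.
have h1 := trigo.cos2Dsin2 (pi * ReC w).
have s0 : sin (pi * ReC w) = 0.
  by apply/eqP; rewrite -sqrf_eq0; apply/eqP; lra.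
have p0 := trigo.pi_gt0 R; move: hw; rewrite ltr_norml => /andP[w1 w2].
case: (ltrgt0P (ReC w)) => // hh.
  have := @sin_gt0_pi R (pi * ReC w); rewrite mulr_gt0 //=.
  have -> : pi * ReC w < pi by rewrite -{2}[pi]mulr1 ltr_pM2l.
  by rewrite s0 ltxx => /(_ isT).
have := @sin_gt0_pi R (pi * (- ReC w)); rewrite mulr_gt0 ?oppr_gt0 //=.
have -> : pi * - ReC w < pi by rewrite -{2}[pi]mulr1 ltr_pM2l //; lra.
by rewrite mulrN trigo.sinN s0 oppr0 ltxx => /(_ isT).
Qed.

Lemma qC_inj z w : qC z = qC w -> `|ReC z - ReC w| < 1 -> z = w.
Proof.
move=> e h; apply/eqP; rewrite -subr_eq0; apply/eqP; apply: eC_eq1.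
  by rewrite eCD eCN -/(qC z) e divff // qC_neq0.
by rewrite ReD ReN.
Qed.

Lemma nm_qC_mono z w : ImC z < ImC w -> nm (qC w) < nm (qC z).
Proof.
by move=> h; rewrite !nm_qC exp.ltr_expR ltrN2 ltr_pM2l // mulr_gt0 // pi_gt0.
Qed.

Lemma qC_small (e : R) : 0 < e -> exists Y : R, forall z, Y < ImC z -> nm (qC z) < e.
Proof.
move=> e0; exists (- ln e / (2 * pi)) => z; rewrite ltr_pdivrMr ?mulr_gt0 ?pi_gt0 // => h.
rewrite nm_qC -[ltRHS]lnK ?posrE // exp.ltr_expR; lra.
Qed.

Lemma qC_large (e : R) : exists Y : R, forall z, ImC z < Y -> e < nm (qC z).
Proof.
pose e' := Num.max e 1; have e0 : 0 < e' by rewrite lt_max ltr01 orbT.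
exists (- ln e' / (2 * pi)) => z; rewrite ltr_pdivlMr ?mulr_gt0 ?pi_gt0 // => h.
apply: (@le_lt_trans _ _ e'); first by rewrite le_max lexx.
rewrite nm_qC -[ltLHS]lnK ?posrE // exp.ltr_expR; lra.
Qed.

(* The mean over a period of [(f - f z0) * q / (q - q0)], whose singularity at [z0] is removable,
   does not depend on the height and tends to 0 at infinity; below [z0] the kernel [q / (q - q0)]
   has mean 1. *)
Lemma per1_Cauchy f (c0 y1 : R) (z0 : C) : holstrip f (fun y => c0 < y) ->
  (forall z, f (z + 1) = f z) ->
  (forall e : R, 0 < e -> exists Y : R, forall z, Y < ImC z -> nm (qC z * f z) < e) ->
  c0 < y1 < ImC z0 -> 0 < ReC z0 < 1 ->
  f z0 = per1 (fun z => f z * (qC z / (qC z - qC z0))) y1.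
Proof.
move=> hol hp gr /andP[c01 y10] /andP[x0 x1].
set q0 := qC z0; have q00 : q0 != 0 := qC_neq0 _.
have qne z : ImC z != ImC z0 -> qC z - q0 != 0.
  rewrite subr_eq0; apply: contraNneq => e; case: (ltrgtP (ImC z) (ImC z0)) => // h.
    by have := nm_qC_mono h; rewrite e ltxx.
  by have := nm_qC_mono h; rewrite e ltxx.
have qne2 z : 0 <= ReC z <= 1 -> z != z0 -> qC z - q0 != 0.
  move=> /andP[h1 h2]; rewrite subr_eq0; apply: contraNneq => e; apply/eqP.
  by apply: qC_inj e _; rewrite ltr_norml; apply/andP; split; lra.
have isq z : isd (fun z => qC z - q0) z (tpi * qC z).
  by apply: isd_eq (isdB (isd_qC z) (isd_cst q0 z)) _; rewrite subr0.
have isk z : qC z - q0 != 0 -> exists l, isd (fun z => qC z / (qC z - q0)) z l.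
  by move=> h; eexists; apply: isd_div (isd_qC z) (isq z) h.
have [l hl] := hol z0 (lt_trans c01 y10).
have [p [cp _ hf]] := hl; have [s [cs' se hs]] := isd_qC z0.
(* The value at [z0] is the limit: [p] and [s] are the Caratheodory factors of [f] and [q] at [z0],
   so [z - z0] cancels. *)
pose K z := if z == z0 then p z0 * (qC z0 / s z0) else (f z - f z0) * (qC z / (qC z - q0)).
have s0 : s z0 != 0 by rewrite se mulf_neq0 ?tpi_neq0.
have cK0 : cts K z0.
  apply: (@cts_loc _ (fun z => p z * (qC z / s z))).
    apply: nb_imp (cts_neq0 cs' s0) => w sw; rewrite /K; case: eqP => [->//|/eqP wz].
    rewrite [f w]hf addrAC subrr add0r [in X in _ / X]hs -/q0 addrAC subrr add0r.
    by field; rewrite sw subr_eq0.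
  by apply: ctsM cp (ctsM (isd_cts (isd_qC z0)) (ctsV cs' s0)).
have isK z : c0 < ImC z -> z != z0 -> qC z - q0 != 0 -> exists l, isd K z l.
  move=> hz zz0 qz; have [m hm] := hol z hz; have [k hk] := isk z qz.
  eexists; apply: isd_loc (isdM (isdB hm (isd_cst (f z0) z)) hk).
  have : cts (fun w => w - z0) z by apply: ctsD (cts_id _) (cts_cst _ _).
  move=> /cts_neq0; rewrite subr_eq0 => /(_ zz0); apply: nb_imp => w.
  by rewrite subr_eq0 /K => /negbTE ->.
have key y2 : ImC z0 < y2 -> per1 K y1 = per1 K y2.
  move=> y02.
  have hc : ctsrect K 0 1 y1 y2.
    move=> z [zx /andP[zy _]]; have [->//|zz0] := eqVneq z z0.
    by have [|//|m hm] := isK z _ zz0; [lra|exact: qne2|exact: isd_cts hm].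
  have hd z : rect 0 1 y1 y2 z -> z != z0 -> exists l, isd K z l.
    by move=> [zx /andP[zy _]] zz0; apply: isK => //; [lra|exact: qne2].
  apply: per1_bdI; last 2 first.
  - by apply: (goursat_punctured (z0 := z0)) => //; apply/andP.
  - apply: (goursat_punctured (z0 := z0)) => //; try exact/andP.
      by move=> z /hc h; apply: ctsM (cts_cst _ _) h.
    by move=> z hz /(hd z hz)[m hm]; exists (- iC * m); exact: isdZ.
  - move=> y _; rewrite /K; case: eqP => [e|_]; first by move: x1; rewrite -e ltxx.
    case: eqP => [e|_]; first by move: x0; rewrite -e ltxx.
    by rewrite shift1 hp qC_shift.
  - lra.
have K0 : per1 K y1 = 0.
  apply/eqP; rewrite -nm_eq0 eq_le nm_ge0 andbT leNgt; apply/negP => P0.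
  set e := nm _ in P0; have Q0 : 0 < nm q0 by rewrite nm_gt0.
  (* High up, the modulus of [q - q0] is at least [nm q0 / 2]; this choice then bounds [K] by
     [e / 4] and its mean by [e / 2]. *)
  pose e1 := e * nm q0 / 16; have e10 : 0 < e1 by rewrite divr_gt0 ?mulr_gt0.
  have [Y1 hY1] := gr e1 e10.
  have A0 : 0 < nm (f z0) + 1 by have := nm_ge0 (f z0); lra.
  have [Y2 hY2] := qC_small (divr_gt0 e10 A0).
  have [Y3 hY3] := qC_small (divr_gt0 Q0 (ltr0n _ 2)).
  pose y2 := `|Y1| + `|Y2| + `|Y3| + `|ImC z0| + 1.
  have := ler_norm Y1; have := ler_norm Y2; have := ler_norm Y3; have := ler_norm (ImC z0).
  have := normr_ge0 Y1; have := normr_ge0 Y2; have := normr_ge0 Y3; have := normr_ge0 (ImC z0).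
  move=> n1 n2 n3 n4 m1 m2 m3 m4.
  have y2a : ImC z0 < y2 by rewrite /y2; lra.
  have y2b : Y1 < y2 by rewrite /y2; lra.
  have y2c : Y2 < y2 by rewrite /y2; lra.
  have y2d : Y3 < y2 by rewrite /y2; lra.
  clearbody y2; clear n1 n2 n3 n4 m1 m2 m3 m4.
  have Kb x : 0 <= x <= 1 -> nm (K (x +i* y2)) <= e / 4.
    move=> hx; set z := x +i* y2; have iz : ImC z = y2 by [].
    have zz0 : z != z0 by apply: contraTneq y2a => <-; rewrite iz ltxx.
    rewrite /K (negbTE zz0) mulrA nmM nmV.
    have b1 := hY1 z y2b; have b2 := hY2 z y2c; have b3 := hY3 z y2d.
    rewrite ltr_pdivlMr // in b2.
    have b4 : nm q0 / 2 <= nm (qC z - q0).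
      have := nm_le_dist q0 (qC z); rewrite nm_distC; lra.
    rewrite ler_pdivrMr; last lra.
    have b5 := nmB (qC z * f z) (f z0 * qC z).
    rewrite mulrBl [f z * _]mulrC; apply: (le_trans b5); rewrite (nmM (f z0)).
    have b6 : nm (f z0) * nm (qC z) <= nm (qC z) * (nm (f z0) + 1) by have := nm_ge0 (qC z); lra.
    have b7 : e / 4 * (nm q0 / 2) <= e / 4 * nm (qC z - q0) by rewrite ler_wpM2l //; lra.
    rewrite /e1 in b1 b2; lra.
  have cKl : ctsline K y2.
    move=> x hx; have zz0 : x +i* y2 != z0 by apply: contraTneq y2a => <-; rewrite ltxx.
    have [||//|m hm] := isK (x +i* y2); rewrite ?ImE //; [lra|exact: qne2|exact: isd_cts hm].
  have := per1_bound cKl Kb; rewrite -key // -/e; lra.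
have ql : ctsline (fun z => qC z / (qC z - q0)) y1.
  move=> x hx; have [|m hm] := isk (x +i* y1); last exact: isd_cts hm.
  by apply: qne; rewrite ImE lt_eqF.
have fl : ctsline (fun z => f z * (qC z / (qC z - q0))) y1.
  move=> x hx; apply: ctsM (ql x hx); have [m hm] := hol (x +i* y1) c01; exact: isd_cts hm.
have e1 : per1 K y1 = - f z0 * per1 (fun z => qC z / (qC z - q0)) y1 +
     per1 (fun z => f z * (qC z / (qC z - q0))) y1.
  rewrite -per1_lin //; apply: per1_ext => x hx; rewrite /K.
  have -> : (x +i* y1 == z0) = false by apply: contraTF y10 => /eqP <-; rewrite ltxx.
  by ring.
suff e2 : per1 (fun z => qC z / (qC z - q0)) y1 = 1.
  move: e1; rewrite K0 e2 mulr1 => /eqP; rewrite eq_sym addrC subr_eq0 => /eqP ->; by [].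
(* The kernel is [1 + g], and [g] tends to 0 as the height tends to minus infinity, a direction in
   which there are no poles. *)
pose g z := q0 / (qC z - q0).
have gl y : y < ImC z0 -> ctsline g y.
  move=> yy x hx; apply: ctsM (cts_cst _ _) (ctsV (isd_cts (isq _)) _).
  by apply: qne; rewrite ImE lt_eqF.
have e3 : per1 (fun z => qC z / (qC z - q0)) y1 = 1 + per1 g y1.
  have c1 : ctsline (fun=> 1) y1 by move=> x hx; exact: cts_cst.
  have e4 := per1_lin 1 c1 (gl _ y10); rewrite per1_cst !mulr1 in e4; rewrite -e4.
  apply: per1_ext => x hx; rewrite /g; field.
  by apply: qne; rewrite ImE lt_eqF.
rewrite e3 [per1 g y1](_ : _ = 0) ?addr0 //.
apply/eqP; rewrite -nm_eq0 eq_le nm_ge0 andbT leNgt; apply/negP => P0.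
set e := nm _ in P0; have Q0 : 0 < nm q0 by rewrite nm_gt0.
have [Y hY] := qC_large (nm q0 + 4 * nm q0 / e).
pose y2 := Num.min y1 Y - 1.
have y21 : y2 <= y1 by have : Num.min y1 Y <= y1 by [rewrite ge_min lexx]; rewrite /y2; lra.
have y2Y : y2 < Y by have : Num.min y1 Y <= Y by [rewrite ge_min lexx orbT]; rewrite /y2; lra.
have hg : per1 g y1 = per1 g y2.
  apply: (@per1_strip g (fun y => y < ImC z0)).
  - move=> z hz; eexists; apply: isd_div (isd_cst q0 z) (isq z) _; apply: qne; by rewrite lt_eqF.
  - by move=> z; rewrite /g qC_shift.
  by move=> y; rewrite (max_idPl y21) => /andP[_ h]; apply: le_lt_trans y10.
have gb x : 0 <= x <= 1 -> nm (g (x +i* y2)) <= e / 4.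
  move=> hx; rewrite /g nmM nmV.
  have h1 := hY (x +i* y2) y2Y; have h2 := nm_le_dist (qC (x +i* y2)) q0.
  have h3 : 4 * nm q0 / e < nm (qC (x +i* y2) - q0) by lra.
  have h4 : 0 < nm (qC (x +i* y2) - q0) by apply: lt_trans h3; rewrite divr_gt0 ?mulr_gt0.
  rewrite ler_pdivrMr //; rewrite ltr_pdivrMr // in h3; lra.
have := per1_bound (gl y2 (le_lt_trans y21 y10)) gb; rewrite -hg -/e; lra.
Qed.

Lemma bounded_ctr g : ctrs g 0 1 -> exists B : R, forall x, 0 <= x <= 1 -> `|g x| <= B.
Proof.
move=> cg.
have H (u : R -> R) : ctrs u 0 1 -> exists B : R, forall x, 0 <= x <= 1 -> u x <= B.
  move=> cu; have := @Rtopology.continuity_ab_maj u 0 1.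
  case=> [||M [hM _]]; first by apply/RleP.
    move=> c [/RleP c0 /RleP c1] e /RltP e0.
    have [|d d0 hd] := cu c _ e e0; first by apply/andP.
    exists d; split; first exact/RltP.
    move=> x [_ hx].
    have {}hx : Rdefinitions.Rlt (Rbasic_fun.Rabs (Rdefinitions.Rminus x c)) d := hx.
    suff : Rdefinitions.Rlt (Rbasic_fun.Rabs (Rdefinitions.Rminus (u x) (u c))) e by [].
    by move: hx; rewrite !RabsE !RminusE => /RltP hx; apply/RltP; apply: hd.
  by exists (u M) => x /andP[/RleP x0 /RleP x1]; apply/RleP; apply: hM.
have [B hB] := H g cg.
have [|B' hB'] := H (fun x => -1 * g x); first by move=> x hx; apply: ctrZ (cg x hx).
exists (Num.max B B') => x hx; rewrite ler_norml le_max; have := hB x hx; have := hB' x hx => h1 h2.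
have : - B' <= g x by lra.
have : - Num.max B B' <= - B' by rewrite lerN2 le_max lexx orbT.
move=> h3 h4; rewrite h2 andbT; exact: le_trans h4.
Qed.

Lemma bounded_line f y : ctsline f y ->
  exists2 B : R, 0 <= B & forall x, 0 <= x <= 1 -> nm (f (x +i* y)) <= B.
Proof.
move=> cf; have [B hB] := bounded_ctr (ctr_Re cf); have [B' hB'] := bounded_ctr (ctr_Im cf).
have h x : 0 <= x <= 1 -> nm (f (x +i* y)) <= B + B'.
  by move=> hx; apply: (le_trans (nm_le_ReIm _)); apply: lerD; [exact: hB|exact: hB'].
exists (B + B') => //; apply: le_trans (h 0 _); rewrite ?nm_ge0 // lexx ler01 //.
Qed.

Lemma per_int (f : C -> C) : (forall z, f (z + 1) = f z) -> forall (n : int) z, f (z + n%:~R) = f z.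
Proof.
move=> hp; have hn (n : nat) z : f (z + n%:R) = f z.
  by elim: n z => [|n IH] z; rewrite ?addr0 // -natr1 addrA hp IH.
case=> n z; first exact: hn.
by rewrite NegzE mulrNz -pmulrn -(hn n.+1 (z - _)) subrK.
Qed.

Lemma PSR_bounded (b : nat -> C) (B : R) : (forall n, nm (b n) <= B) -> PSR b.
Proof.
move=> hB r /andP[r0 r1]; exists B => n.
by apply: le_trans (hB n); rewrite ler_piMr ?nm_ge0 // exprn_ile1 // ltW.
Qed.

(** [Q] is [q] rescaled to modulus 1 on the line of height [y1]. Expanding the kernel of
    [per1_Cauchy] in powers of [Q z0 / Q] exhibits the coefficients [b n] as means; the condition
    that [q f] tends to 0 excludes negative powers. *)
Lemma periodic_series f (c0 y1 : R) : holstrip f (fun y => c0 < y) ->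
  (forall z, f (z + 1) = f z) ->
  (forall e : R, 0 < e -> exists Y : R, forall z, Y < ImC z -> nm (qC z * f z) < e) ->
  c0 < y1 ->
  exists b, PSR b /\ forall z, y1 < ImC z -> f z = psum b (qC (z - iC * RC y1)).
Proof.
move=> hol hp gr c01.
have fl : ctsline f y1 by move=> x hx; have [m hm] := hol (x +i* y1) c01; exact: isd_cts hm.
have [B B0 hB] := bounded_line fl.
pose Q z := qC (z - iC * RC y1).
have Qn z : Q z != 0 := qC_neq0 _.
have ImQ z : ImC (z - iC * RC y1) = ImC z - y1 by rewrite !ReImE; ring.
have Q1 x : nm (Q (x +i* y1)) = 1.
  by rewrite /Q nm_qC ImQ ImE subrr mulr0 oppr0 exp.expR0.
have isQ z : isd Q z (tpi * Q z).
  have h : isd (fun w => w - iC * RC y1) z 1.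
    by apply: isd_eq (isdB (isd_id z) (isd_cst _ z)) _; rewrite subr0.
  by apply: isd_eq (isd_comp h (isd_qC _)) _; rewrite mulr1.
have cQ z n : cts (fun z => (Q z)^-1 ^+ n) z.
  have := isdX n (isdV (isQ z) (Qn z)); exact: isd_cts.
pose b n := per1 (fun z => f z * (Q z)^-1 ^+ n) y1.
have flQ n : ctsline (fun z => f z * (Q z)^-1 ^+ n) y1.
  by move=> x hx; apply: ctsM (fl x hx) (cQ _ _).
have hb n : nm (b n) <= 2 * B.
  apply: per1_bound => // x hx; rewrite nmM nmX nmV Q1 invr1 expr1n mulr1; exact: hB.
have pb := PSR_bounded hb.
exists b; split => //.
have key z0 : y1 < ImC z0 -> 0 < ReC z0 < 1 -> f z0 = psum b (Q z0).
  move=> hz x01; have hc : c0 < y1 < ImC z0 by rewrite c01.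
  have s1 : nm (Q z0) < 1 by rewrite nm_qC_lt1 // /inH ImQ subr_gt0.
  symmetry; apply: psum_eq.
  pose s := nm (Q z0); have s0 : 0 <= s := nm_ge0 _.
  have s01 : 0 <= s < 1 by rewrite s0.
  have eq z : qC z / (qC z - qC z0) = Q z / (Q z - Q z0).
    rewrite /Q /qC !eCD -mulrBl -mulf_div divff ?mulr1 //; exact: eC_neq0.
  have qne x : Q (x +i* y1) - Q z0 != 0.
    by rewrite subr_eq0; apply: contraTneq s1 => <-; rewrite Q1 ltxx.
  (* The remainder after [N] terms of the geometric expansion of the kernel. *)
  pose r N := per1 (fun z => f z * (Q z0 / Q z) ^+ N * (Q z / (Q z - Q z0))) y1.
  have rl N : ctsline (fun z => f z * (Q z0 / Q z) ^+ N * (Q z / (Q z - Q z0))) y1.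
    move=> x hx; have d1 := isdX N (isd_div (isd_cst (Q z0) (x +i* y1)) (isQ _) (Qn _)).
    have d2 := isd_div (isQ (x +i* y1)) (isdB (isQ (x +i* y1)) (isd_cst (Q z0) _)) (qne x).
    by apply: ctsM (ctsM (fl x hx) (isd_cts d1)) (isd_cts d2).
  have rb N : nm (r N) <= 2 * B / (1 - s) * s ^+ N.
    apply: (@le_trans _ _ (2 * (B * s ^+ N * (1 - s)^-1))); last by rewrite le_eqVlt; apply/orP; left; apply/eqP; ring.
    apply: per1_bound => // x hx.
    have -> : nm (f (x +i* y1) * (Q z0 / Q (x +i* y1)) ^+ N * (Q (x +i* y1) / (Q (x +i* y1) - Q z0))) =
        nm (f (x +i* y1)) * s ^+ N * (nm (Q (x +i* y1) - Q z0))^-1.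
      have := Q1 x; move: (Q (x +i* y1)) (f _) => A v hA; rewrite /s.
      by rewrite nmM (nmM v) nmX (nmM (Q z0)) (nmM A) !nmV hA invr1 mulr1 mul1r.
    apply: ler_pM; rewrite ?mulr_ge0 ?nm_ge0 ?invr_ge0 ?nm_ge0 ?exprn_ge0 //.
      by rewrite ler_wpM2r ?exprn_ge0 //; exact: hB.
    rewrite lef_pV2 ?posrE ?nm_gt0 ?subr_gt0 //.
    by have := nm_le_dist (Q (x +i* y1)) (Q z0); rewrite Q1 -/s; lra.
  have rS N : r N = b N * Q z0 ^+ N + r N.+1.
    rewrite /r /b mulrC -(per1_lin (Q z0 ^+ N) (flQ N) (rl N.+1)).
    apply: per1_ext => x hx; have := qne x; have := Qn (x +i* y1).
    move: (Q (x +i* y1)) (f _) (Q z0) => u v w u0 uw.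
    rewrite exprSr !exprMn mulrCA -[w ^+ N * (v * _)]mulrCA.
    by field; rewrite uw u0.
  have r0 N : f z0 = series (fun n => b n * Q z0 ^+ n) N + r N.
    elim: N => [|N ->].
      rewrite /series /= big_geq // add0r (per1_Cauchy hol hp gr hc x01).
      by apply: per1_ext => x hx; rewrite expr0 mulr1 eq.
    by rewrite /series /= big_nat_recr //= -addrA -rS.
  move=> e e0; have [N HN] := geo_small (2 * B / (1 - s)) s01 e0.
  exists N => n /HN; apply: le_lt_trans; rewrite (r0 n) opprD addrA subrr sub0r nmN.
  exact: rb.
move=> z hz.
have hQ w : y1 < ImC w -> nm (Q w) < 1 by move=> hw; rewrite nm_qC_lt1 // /inH ImQ subr_gt0.
apply: (@cts_dense_eq f (fun w => psum b (Q w))).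
- have [m hm] := hol z (lt_trans c01 hz); exact: isd_cts hm.
- exact: cts_comp (isd_cts (isQ z)) (isd_cts (isd_psum pb (hQ z hz))).
(* [key] demands a real part strictly between 0 and 1: a small move to the right leaves the lines of
   integral real part, and an integral translation does the rest. *)
move=> d d0; pose n : int := Num.floor (ReC z).
have /andP[n1 n2] : n%:~R <= ReC z < n%:~R + 1 by rewrite floor_le /= -intrD1 floorD1_gt.
pose t := Num.min d (n%:~R + 1 - ReC z) / 2.
have t0 : 0 < t by rewrite divr_gt0 // lt_min d0 subr_gt0.
have td : t < d.
  by have : Num.min d (n%:~R + 1 - ReC z) <= d by [rewrite ge_min lexx]; rewrite /t in t0 *; lra.
have tn : t < n%:~R + 1 - ReC z.
  have : Num.min d (n%:~R + 1 - ReC z) <= n%:~R + 1 - ReC z by rewrite ge_min lexx orbT.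
  rewrite /t in t0 *; lra.
clearbody t; exists (z + RC t); split.
  by rewrite addrAC subrr add0r nmRC gtr0_norm.
pose w := z + RC t - n%:~R.
have eRe : ReC w = ReC z + t - n%:~R by rewrite /w -RCz !ReImE.
have eIm : ImC w = ImC z by rewrite /w -RCz !ReImE; ring.
have -> : z + RC t = w + n%:~R by rewrite subrK.
have Qp (u : C) : Q (u + 1) = Q u by rewrite /Q addrAC qC_shift.
rewrite (per_int hp) (per_int (f := Q)) //; apply: key; rewrite ?eIm // eRe.
by apply/andP; split; lra.
Qed.

(** Riemann's theorem on removable singularities at [q = 0], with the rate of convergence. *)
Lemma periodic_limit f (c0 : R) : holstrip f (fun y => c0 < y) ->
  (forall z, f (z + 1) = f z) ->
  (forall e : R, 0 < e -> exists Y : R, forall z, Y < ImC z -> nm (qC z * f z) < e) ->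
  exists (a : C) (K Y : R), 0 <= K /\ forall z, Y < ImC z -> nm (f z - a) <= K * nm (qC z).
Proof.
move=> hol hp gr; have c01 : c0 < c0 + 1 by rewrite ltrDl.
have [b [pb hb]] := periodic_series hol hp gr c01.
have [K K0 hK] := psum_near0 pb.
set u := qC (- (iC * RC (c0 + 1))); have u0 : 0 < nm u by rewrite nm_gt0 qC_neq0.
have [Y hY] := @qC_small (1 / 2 / nm u) (divr_gt0 (divr_gt0 ltr01 (ltr0n _ 2)) u0).
exists (b 0%N), (K * nm u), (Num.max Y (c0 + 1)); split; first by rewrite mulr_ge0 // ltW.
move=> z; rewrite gt_max => /andP[/hY h1 h2]; rewrite hb //.
have e : qC (z - iC * RC (c0 + 1)) = u * qC z by rewrite /u /qC eCD mulrC.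
rewrite ltr_pdivlMr // in h1.
by rewrite e -mulrA -nmM; apply: hK; rewrite nmM mulrC ltW.
Qed.

(** * Local power series of holomorphic functions on H *)

Definition holC (f : C -> C) : Prop := forall z, inH z -> exists l, isd f z l.

Lemma circle_in (z : C) (r : R) (w : C) : inH z -> 0 < r <= ImC z -> 0 < ImC w ->
  inH (z + RC r * qC w).
Proof.
move=> hz /andP[r0 rz] hw; have h := nm_qC_lt1 hw.
rewrite /inH ImD; have h2 := abs_Im_le (RC r * qC w); rewrite nmM nmRC (gtr0_norm r0) in h2.
have : r * nm (qC w) < r * 1 by rewrite ltr_pM2l.
move: h2; rewrite ler_norml => /andP[h3 _]; lra.
Qed.

Lemma isd_circle f (z : C) (r : R) (w : C) l : isd f (z + RC r * qC w) l ->
  isd (fun w => f (z + RC r * qC w)) w (l * (RC r * (tpi * qC w))).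
Proof.
move=> h; have h1 : isd (fun w => z + RC r * qC w) w (RC r * (tpi * qC w)).
  by apply: isd_eq (isdD (isd_cst z w) (isdZ (RC r) (isd_qC w))) _; rewrite add0r.
exact: isd_comp h1 h.
Qed.

(** [w -> z + r q(w)] maps H onto a punctured disc about [z] and turns [f] into a periodic function,
    bounded at infinity by continuity at [z]. Its series in [q] is the Taylor series of [f]; the
    centre is recovered by continuity. *)
Lemma hol_local_series f z : holC f -> inH z ->
  exists b (k : C), PSR b /\ nb z (fun w => nm (k * (w - z)) < 1 /\ f w = psum b (k * (w - z))).
Proof.
move=> hf hz; pose r := ImC z; have r0 : 0 < r := hz.
have rz : 0 < r <= ImC z by rewrite r0 lexx.
pose g w := f (z + RC r * qC w).
have hol : holstrip g (fun y => 0 < y).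
  move=> w hw; have [l hl] := hf _ (circle_in hz rz hw); eexists; exact: isd_circle hl.
have hp w : g (w + 1) = g w by rewrite /g qC_shift.
have [l hl] := hf z hz; have cf := isd_cts hl.
have gr e : 0 < e -> exists Y : R, forall w, Y < ImC w -> nm (qC w * g w) < e.
  move=> e0; have [d d0 hd] := cf 1 ltr01.
  have A0 : 0 < nm (f z) + 1 by have := nm_ge0 (f z); lra.
  have [Y1 h1] := qC_small (divr_gt0 e0 A0); have [Y2 h2] := qC_small (divr_gt0 d0 r0).
  exists (Num.max Y1 Y2) => w; rewrite gt_max => /andP[/h1 w1 /h2 w2].
  have : nm (g w - f z) < 1.
    apply: hd; rewrite addrAC subrr add0r nmM nmRC gtr0_norm // mulrC.
    by rewrite -ltr_pdivlMr.
  move=> h3; have h4 := nm_le_dist (g w) (f z).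
  rewrite nmM; rewrite ltr_pdivlMr // in w1; apply: le_lt_trans w1.
  by rewrite ler_wpM2l ?nm_ge0 //; lra.
have [b [pb hb]] := periodic_series hol hp gr ltr01.
(* [periodic_series] is applied at height 1, whence the factor [1 / q(i)] in the scale of the local
   variable. *)
pose u := qC (- (iC * RC 1)).
have u0 : u != 0 := qC_neq0 _.
pose k := u / RC r; have rC : RC r != 0 by rewrite RC_eq0 gt_eqF.
have k0 : k != 0 by rewrite mulf_neq0 // invr_eq0.
exists b, k; split => //.
have kn : 0 < nm k by rewrite nm_gt0.
pose d := Num.min (1 / nm k) (nm (qC (iC * RC 1)) * r).
have d0 : 0 < d by rewrite lt_min divr_gt0 //= mulr_gt0 // nm_gt0 qC_neq0.
have key w : nm (w - z) < d -> w != z -> f w = psum b (k * (w - z)).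
  rewrite lt_min => /andP[_ hw] wz.
  have wz0 : (w - z) / RC r != 0 by rewrite mulf_neq0 ?invr_eq0 // subr_eq0.
  have n1 : nm ((w - z) / RC r) < nm (qC (iC * RC 1)).
    by rewrite nmM nmV nmRC gtr0_norm // ltr_pdivrMr.
  have i1 : nm (qC (iC * RC 1)) < 1 by rewrite nm_qC_lt1 // /inH !ReImE; lra.
  have [v hv ev] := qC_onto wz0 (lt_trans n1 i1).
  have v1 : 1 < ImC v.
    rewrite ltNge; apply/negP => h; move: n1; rewrite -ev ltNge; apply/negP/negPn.
    have : ImC v <= ImC (iC * RC 1) by rewrite !ReImE; lra.
    rewrite le_eqVlt => /orP[/eqP e|/nm_qC_mono/ltW//].
    by rewrite !nm_qC e.
  have := hb v v1; rewrite /g ev mulrCA divff // mulr1 subrKC => ->.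
  congr psum; have -> : qC (v - iC * RC 1) = qC v * u by rewrite /u /qC eCD.
  by rewrite ev /k mulrC mulrA mulrAC.
have hd w : nm (w - z) < d -> nm (k * (w - z)) < 1.
  by rewrite lt_min => /andP[hw _]; rewrite nmM mulrC -ltr_pdivlMr.
exists d => // w hw; split; first exact: hd.
have [->|/(key w hw)//] := eqVneq w z.
apply: (@cts_dense_eq f (fun w => psum b (k * (w - z)))) => //.
  have h0 : nm (k * (z - z)) < 1 by rewrite subrr mulr0 nm0.
  have h1 : cts (fun w => k * (w - z)) z.
    by apply: ctsM (cts_cst _ _) (ctsD (cts_id _) (cts_cst _ _)).
  exact: cts_comp h1 (isd_cts (isd_psum pb h0)).
move=> e e0; pose t := Num.min d e / 2.
have m0 : 0 < Num.min d e by rewrite lt_min d0 e0.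
have t0 : 0 < t by rewrite divr_gt0.
have [td te] : t < d /\ t < e.
  have h1 : Num.min d e <= d by rewrite ge_min lexx.
  have h2 : Num.min d e <= e by rewrite ge_min lexx orbT.
  by rewrite /t; split; lra.
exists (z + RC t); rewrite addrAC subrr add0r nmRC gtr0_norm //; split => //.
rewrite [X in psum b (k * X)](_ : _ = z + RC t - z); last by ring.
apply: key; first by rewrite addrAC subrr add0r nmRC gtr0_norm.
by rewrite -subr_eq0 addrAC subrr add0r RC_eq0 gt_eqF.
Qed.

Lemma isd_scaled_psum b k z w : PSR b -> nm (k * (w - z)) < 1 ->
  isd (fun w => psum b (k * (w - z))) w (k * psum (da b) (k * (w - z))).
Proof.
move=> pb hw; have h : isd (fun w => k * (w - z)) w k.
  by apply: isd_eq (isdZ k (isdB (isd_id w) (isd_cst z w))) _; rewrite subr0 mulr1.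
by apply: isd_eq (isd_comp h (isd_psum pb hw)) _; rewrite mulrC.
Qed.

Lemma nb_nb z P : nb z P -> nb z (fun w => nb w P).
Proof.
move=> [d d0 hd]; exists d => // w hw; exists (d - nm (w - z)); first by rewrite subr_gt0.
by move=> v hv; apply: hd; have := nm_tri v w z; lra.
Qed.

Lemma nb_inH z : inH z -> nb z inH.
Proof.
move=> hz; exists (ImC z) => // w hw; have := Im_lip w z; rewrite /inH.
by rewrite ler_norml => /andP[h _]; lra.
Qed.

Lemma holC_isd f z : holC f -> inH z -> isd f z ('D_1 f z).
Proof. by move=> hf /hf[l hl]; rewrite (isd_derive hl). Qed.

(** Holomorphy passes to the derivative because a power series can be differentiated twice. *)
Lemma holC_der f : holC f -> holC (fun z => 'D_1 f z).
Proof.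
move=> hf z hz; have [b [k [pb hb]]] := hol_local_series hf hz.
exists (k * (k * psum (da (da b)) (k * (z - z)))).
apply: (@isd_loc _ (fun w => k * psum (da b) (k * (w - z)))).
  apply: nb_imp (nb_nb hb) => w hw; apply: isd_derive; have [h1 _] := nb_self hw.
  by apply: isd_loc (isd_scaled_psum pb h1); apply: nb_imp hw => v [].
by apply: isdZ; apply: isd_scaled_psum (PSR_da pb) _; rewrite subrr mulr0 nm0.
Qed.

(** * The maximum principle *)

Lemma Itg_eq0 g : ctrs g 0 1 -> (forall x, 0 <= x <= 1 -> 0 <= g x) -> Itg g 0 1 = 0 ->
  forall x, 0 <= x <= 1 -> g x = 0.
Proof.
move=> cg g0 I0 x hx; apply/eqP; rewrite eq_le g0 // andbT leNgt; apply/negP => gx.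
have [x0 x1] := andP hx.
have e0 : 0 < g x / 2 by rewrite divr_gt0.
have [d d0 hd] := cg x hx _ e0.
pose l := Num.max 0 (x - d / 2); pose u := Num.min 1 (x + d / 2).
have l0 : 0 <= l by rewrite le_max lexx.
have u1 : u <= 1 by rewrite ge_min lexx.
have lx : l <= x by rewrite ge_max x0; lra.
have xu : x <= u by rewrite le_min x1; lra.
have lu : l < u by rewrite gt_max !lt_min; apply/andP; split; apply/andP; split; lra.
have ld : x - d / 2 <= l by rewrite le_max lexx orbT.
have ud : u <= x + d / 2 by rewrite ge_min lexx orbT.
clearbody l u.
have l1 : l <= 1 by lra.
have c1 : ctrs g l 1 by apply: ctrs_sub cg.
have c2 : ctrs g 0 l by apply: ctrs_sub cg.
have c3 : ctrs g u 1 by apply: ctrs_sub c1 => //; exact: ltW.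
have c4 : ctrs g l u by apply: ctrs_sub c1.
have cc (k a b : R) : ctrs (fun=> k) a b by move=> y _; exact: ctr_cst.
have i1 : Itg (fun=> 0) 0 l <= Itg g 0 l.
  by apply: Itg_le => // y /andP[y0 y1]; apply: g0; rewrite y0; lra.
have i2 : Itg (fun=> 0) u 1 <= Itg g u 1.
  by apply: Itg_le => // y /andP[y0 y1]; apply: g0; rewrite y1 andbT; lra.
have i3 : Itg (fun=> g x / 2) l u <= Itg g l u.
  apply: Itg_le => //; first exact: ltW.
  move=> y /andP[y0 y1]; have : `|y - x| < d by rewrite ltr_norml; apply/andP; split; lra.
  by move/hd; rewrite ltr_norml => /andP[h _]; lra.
rewrite !Itg_const in i1 i2 i3.
have e1 := Itg_chasles l0 l1 cg; have e2 := Itg_chasles (ltW lu) u1 c1.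
have : 0 < (u - l) * (g x / 2) by rewrite mulr_gt0 // subr_gt0.
rewrite e1 e2 in I0; lra.
Qed.

Lemma cts_circle f z (r : R) w : holC f -> inH z -> 0 < r <= ImC z -> 0 < ImC w ->
  cts (fun w => f (z + RC r * qC w)) w.
Proof.
move=> hf hz hr hw; have [l hl] := hf _ (circle_in hz hr hw); exact: isd_cts (isd_circle hl).
Qed.

(** Circles about [z] are images of horizontal lines; raising the line shrinks the circle to [z]
    without changing the mean. *)
Lemma mean_value f z (r y : R) : holC f -> inH z -> 0 < r <= ImC z -> 0 < y ->
  per1 (fun w => f (z + RC r * qC w)) y = f z.
Proof.
move=> hf hz hr y0; set g := fun w => _.
have cg y' : 0 < y' -> ctsline g y' by move=> hy x hx; apply: cts_circle.
have hol : holstrip g (fun y => 0 < y).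
  move=> w hw; have [l hl] := hf _ (circle_in hz hr hw); eexists; exact: isd_circle hl.
have hp w : g (w + 1) = g w by rewrite /g qC_shift.
have [r0 rz] := andP hr.
apply/eqP; rewrite -subr_eq0 -nm_eq0 eq_le nm_ge0 andbT leNgt; apply/negP => P.
set e := nm _ in P; have e4 : 0 < e / 4 by rewrite divr_gt0.
have [l hl] := hf z hz; have [d d0 hd] := isd_cts hl e4.
have [Y hY] := qC_small (divr_gt0 d0 r0).
pose y2 := Num.max y (Y + 1).
have yy2 : y <= y2 by rewrite le_max lexx.
have Yy2 : Y < y2 by rewrite lt_max; apply/orP; right; lra.
have y20 : 0 < y2 := lt_le_trans y0 yy2.
have e1 : per1 g y = per1 g y2.
  apply: (per1_strip hol hp) => t; rewrite (min_idPl yy2) => /andP[h _]; exact: lt_le_trans h.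
have cz : ctsline (fun=> - f z) y2 by move=> x _; exact: cts_cst.
have := per1_lin 1 (cg y2 y20) cz; rewrite per1_cst mul1r => e2.
have : nm (per1 (fun z0 : C => 1 * g z0 + - f z) y2) <= 2 * (e / 4).
  apply: per1_bound; first exact: ctsline_lin (cg _ y20) cz.
  move=> x hx; rewrite mul1r; apply: ltW; apply: hd.
  rewrite addrAC subrr add0r nmM nmRC gtr0_norm // mulrC -ltr_pdivlMr //; exact: hY.
by rewrite e2 -e1 -/e; lra.
Qed.

(** On a circle about [z] the quotient [u] of [h] by [h z] has mean 1 and modulus at most 1. So
    [1 - Re u] is nonnegative with integral 0, which forces [u = 1]. *)
Lemma max_disc h z : holC h -> inH z -> (forall w, inH w -> nm (h w) <= nm (h z)) ->
  forall w, nm (w - z) < ImC z -> h w = h z.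
Proof.
move=> hh hz hmax w hw.
have hz0 : 0 < ImC z := hz; have hr : 0 < ImC z <= ImC z by rewrite hz0 lexx.
have wH : inH w.
  by have := Im_lip w z; rewrite ler_norml /inH => /andP[h1 _]; lra.
have [h0|h0] := eqVneq (h z) 0.
  have := hmax w wH; rewrite h0 nm0 => h1; apply/eqP; rewrite -nm_eq0.
  by rewrite eq_le h1 nm_ge0.
have [->//|wz] := eqVneq w z.
have iz : RC (ImC z) != 0 by rewrite RC_eq0 gt_eqF.
have q0 : (w - z) / RC (ImC z) != 0 by rewrite mulf_neq0 ?invr_eq0 // subr_eq0.
have q1 : nm ((w - z) / RC (ImC z)) < 1.
  by rewrite nmM nmV nmRC gtr0_norm // ltr_pdivrMr // mul1r.
have [v0 hv0 ev0] := qC_onto q0 q1.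
pose n := Num.floor (ReC v0).
have /andP[n1 n2] : n%:~R <= ReC v0 < n%:~R + 1 by rewrite floor_le /= -intrD1 floorD1_gt.
pose x := ReC v0 - n%:~R; pose y := ImC v0.
have ev : qC (x +i* y) = (w - z) / RC (ImC z).
  rewrite -ev0 -(per_int qC_shift n); congr qC; apply: CeqP.
    by rewrite -RCz !ReImE /x /=; ring.
  by rewrite -RCz !ReImE /y /=; ring.
have x01 : 0 <= x <= 1 by rewrite /x; apply/andP; split; lra.
pose u v := (h z)^-1 * h (z + RC (ImC z) * qC v).
have cu : ctsline u y.
  by move=> t ht; apply: (ctsM (cts_cst _ _)); apply: (cts_circle hh hz hr).
have mu : per1 u y = 1.
  have c0 : ctsline (fun=> 0) y by move=> t _; exact: cts_cst.
  have c1 : ctsline (fun v => h (z + RC (ImC z) * qC v)) y.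
    by move=> t _; exact: cts_circle.
  have := per1_lin (h z)^-1 c1 c0; rewrite per1_cst addr0 mean_value // mulVf // => <-.
  by apply: per1_ext => t _; rewrite addr0.
have nu1 t : nm (u (t +i* y)) <= 1.
  rewrite nmM nmV mulrC ler_pdivrMr ?nm_gt0 // mul1r; apply: hmax.
  exact: circle_in.
have I0 : Itg (fun t => 1 - ReC (u (t +i* y))) 0 1 = 0.
  rewrite Itg_sub ?ler01 //; last exact: ctr_Re.
    by rewrite Itg_const subr0 mulr1 -[Itg _ _ _]/(ReC (per1 u y)) mu Re1 subrr.
  by move=> t _; exact: ctr_cst.
have cI : ctrs (fun t => 1 - ReC (u (t +i* y))) 0 1.
  move=> t ht; apply: ctrD (ctr_cst _ _) _.
  have := ctrZ (-1) (ctr_Re cu ht); rewrite (_ : (fun y0 => _) = (fun y0 => - ReC (u (y0 +i* y)))) //.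
  by apply/funext => s; ring.
have pos t : 0 <= t <= 1 -> 0 <= 1 - ReC (u (t +i* y)).
  by move=> _; have := abs_Re_le (u (t +i* y)); have := nu1 t; rewrite ler_norml => h1 /andP[_ h2]; lra.
have R1 : ReC (u (x +i* y)) = 1 by have := Itg_eq0 cI pos I0 x01; lra.
have I1 : ImC (u (x +i* y)) = 0.
  have := nm_sqr (u (x +i* y)); rewrite R1 => e.
  have : nm (u (x +i* y)) ^+ 2 <= 1 by rewrite exprn_ile1 ?nm_ge0.
  have := sqr_ge0 (ImC (u (x +i* y))) => h1 h2; apply/eqP; rewrite -sqrf_eq0 eq_le h1 andbT.
  by rewrite e expr1n in h2; lra.
have : u (x +i* y) = 1 by apply: CeqP; rewrite ?R1 ?I1.
rewrite /u ev mulrCA divff // mulr1 subrKC => e.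
by rewrite -[LHS](mulKf h0) mulrCA e mulr1.
Qed.

Lemma evt2_realType (F : realType) (g : F * F -> F) (a b c d : F) : a <= b -> c <= d ->
  (forall p, a <= p.1 <= b -> c <= p.2 <= d -> forall e, 0 < e -> exists2 r, 0 < r &
     forall p', `|p'.1 - p.1| < r -> `|p'.2 - p.2| < r -> `|g p' - g p| < e) ->
  exists2 m, (a <= m.1 <= b) && (c <= m.2 <= d) &
    forall p, a <= p.1 <= b -> c <= p.2 <= d -> g p <= g m.
Proof.
move=> ab cd cg.
pose A : set (F * F) := `[a, b]%classic `*` `[c, d]%classic.
have inA p : (p \in A) = (a <= p.1 <= b) && (c <= p.2 <= d).
  apply/idP/idP; rewrite inE /A /= !in_itv /=; first by case=> -> ->.
  by move/andP.
have A0 : A !=set0 by exists (a, c); rewrite /A /= !in_itv /= !lexx ab cd.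
have cA : compact A by apply: compact_setX; exact: segment_compact.
have cf : {within A, continuous g}.
  apply: continuous_in_subspaceT => p; rewrite inA => /andP[p1 p2].
  apply/cvgrPdist_lt => e e0; have [r r0 hr] := cg p p1 p2 e e0.
  exists (ball p.1 r, ball p.2 r); first by split; exact: nbhsx_ballx.
  move=> p' [h1 h2].
  by rewrite distrC; apply: hr; rewrite distrC.
have [m] := compact_EVT_max A0 cA cf.
by rewrite inA => hm h; exists m => // p p1 p2; apply: h; rewrite inA p1.
Qed.

Lemma evt2 (g : R * R -> R) (a b c d : R) : a <= b -> c <= d ->
  (forall p, a <= p.1 <= b -> c <= p.2 <= d -> forall e : R, 0 < e -> exists2 r : R, 0 < r &
     forall p', `|p'.1 - p.1| < r -> `|p'.2 - p.2| < r -> `|g p' - g p| < e) ->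
  exists2 m, (a <= m.1 <= b) && (c <= m.2 <= d) &
    forall p, a <= p.1 <= b -> c <= p.2 <= d -> g p <= g m.
Proof. exact: evt2_realType. Qed.

Lemma ImV (z : C) : ImC z^-1 = - ImC z / nm z ^+ 2.
Proof. by rewrite nm_sqr mulNr; case: z. Qed.

(** Below height 1/2, translate so that the real part is at most 1/2 in absolute value; then
    [|v| ^ 2 <= 1/2] and the inversion at least doubles the height. *)
Lemma reduce_half (P : C -> Prop) : (forall z, inH z -> P (z + 1) <-> P z) ->
  (forall z, inH z -> P (- z^-1) <-> P z) -> forall z, inH z -> P z ->
  exists2 z', 1 / 2 <= ImC z' & P z'.
Proof.
move=> hT hS z hz Pz.
have hn (n : nat) w : inH w -> P (w + n%:R) <-> P w.
  move=> hw; elim: n => [|n IH]; rewrite ?addr0 // -natr1 addrA.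
  have hw' : inH (w + n%:R) by rewrite /inH ImD Imn addr0.
  by rewrite -IH; apply: hT.
have hi (n : int) w : inH w -> P (w + n%:~R) <-> P w.
  move=> hw; case: n => n; first exact: hn.
  have hw' : inH (w + (Negz n)%:~R) by rewrite /inH -RCz !ReImE addr0.
  by rewrite -(hn n.+1 _ hw') NegzE mulrNz -pmulrn subrK.
have key (n : nat) w : inH w -> (1 / 2) ^+ n / 2 <= ImC w -> P w -> exists2 z', 1 / 2 <= ImC z' & P z'.
  elim: n w => [|n IH] w hw hy Pw; first by exists w => //; rewrite expr0 in hy.
  have [|lt] := leP (1 / 2) (ImC w); first by exists w.
  pose k := Num.floor (ReC w + 1 / 2).
  have /andP[k1 k2] : k%:~R <= ReC w + 1 / 2 < k%:~R + 1 by rewrite floor_le /= -intrD1 floorD1_gt.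
  pose v := w + (- k)%:~R.
  have eR : ReC v = ReC w - k%:~R by rewrite /v -RCz !ReImE mulrNz.
  have eI : ImC v = ImC w by rewrite /v -RCz !ReImE addr0.
  have hv : inH v by rewrite /inH eI.
  have Pv : P v by apply/hi.
  have w0 : 0 < ImC w := hw.
  have n2 : nm v ^+ 2 <= 1 / 2.
    rewrite nm_sqr eI eR; have : (ReC w - k%:~R) ^+ 2 <= 1 / 4.
      by have : (1 / 2 + (ReC w - k%:~R)) * (1 / 2 - (ReC w - k%:~R)) >= 0 by [apply: mulr_ge0; lra]; rewrite expr2; lra.
    have : ImC w ^+ 2 <= 1 / 4 by rewrite expr2; nra.
    lra.
  have v0 : 0 < nm v ^+ 2.
    by rewrite exprn_gt0 // nm_gt0; apply: contraTneq hv => ->; rewrite /inH Im0 ltxx.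
  have eS : ImC (- v^-1) = ImC w / nm v ^+ 2 by rewrite ImN ImV eI mulNr opprK.
  have big : 2 * ImC w <= ImC (- v^-1) by rewrite eS ler_pdivlMr //; nra.
  apply: (IH (- v^-1)); last exact/hS.
    by rewrite /inH; lra.
  by apply: le_trans big; move: hy; rewrite exprS; lra.
have h01 : 0 <= (1 / 2 : R) < 1 by lra.
have [n /(_ n (leqnn n)) h] := geo_small (1 / 2) h01 hz.
apply: (key n z hz) Pz; apply: ltW; move: h.
by move: ((1 / 2 : R) ^+ n) => t; lra.
Qed.

(* Every value of [h] is taken on [Im z >= 1/2], hence [|h|] attains its maximum; the maximum
   spreads from disc to disc up to infinity, where [h] vanishes. *)
Lemma invariant_zero h : holC h -> (forall z, inH z -> h (z + 1) = h z) ->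
  (forall z, inH z -> h (- z^-1) = h z) ->
  (forall e : R, 0 < e -> exists Y : R, forall z, Y < ImC z -> nm (h z) < e) ->
  forall z, inH z -> h z = 0.
Proof.
move=> hh hT hS h0 z1 hz1; apply/eqP; apply/negPn/negP; rewrite -nm_gt0; set e := nm _ => e0.
have red z : inH z -> exists2 z', (1 / 2 <= ImC z') && (0 <= ReC z' <= 1) & h z' = h z.
  move=> hz; have [| |z' z'1 z'2] := @reduce_half (fun w => h w = h z) _ _ z hz erefl.
  - by move=> w hw; rewrite hT.
  - by move=> w hw; rewrite hS.
  pose k := Num.floor (ReC z').
  have /andP[k1 k2] : k%:~R <= ReC z' < k%:~R + 1 by rewrite floor_le /= -intrD1 floorD1_gt.
  have z'H : inH z' by rewrite /inH; lra.
  have hi (n : int) w : inH w -> h (w + n%:~R) = h w.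
    have hn (m : nat) v : inH v -> h (v + m%:R) = h v.
      move=> hv; elim: m => [|m IH]; rewrite ?addr0 // -natr1 addrA hT ?IH //.
      by rewrite /inH ImD Imn addr0.
    move=> hw; case: n => n; first exact: hn.
    rewrite -(hn n.+1); first by rewrite NegzE mulrNz -pmulrn subrK.
    by rewrite /inH -RCz !ReImE addr0.
  exists (z' + (- k)%:~R); last by rewrite hi.
  rewrite -RCz !ReImE addr0 z'1 /= mulrNz; apply/andP; split; lra.
have [Y hY] := h0 e e0.
pose Y' := Num.max Y 1; have Y'1 : 1 <= Y' by rewrite le_max lexx orbT.
have hY' z : Y' < ImC z -> nm (h z) < e by rewrite gt_max => /andP[/hY].
clearbody Y'; clear Y hY.
have l01 : (0 : R) <= 1 by exact: ler01.
have l2 : 1 / 2 <= Y' by lra.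
have [|m /andP[m1 m2] hm] := @evt2 (fun p => nm (h (p.1 +i* p.2))) 0 1 (1 / 2) Y' l01 l2.
  move=> [x y] /= hx hy t t0; have pH : inH (x +i* y) by rewrite /inH ImE; lra.
  have [l hl] := hh _ pH; have [d d0 hd] := isd_cts hl t0.
  exists (d / 2); first by rewrite divr_gt0.
  move=> [x' y'] /= hx' hy'.
  have hn : nm ((x' +i* y') - (x +i* y)) < d.
    by apply: (le_lt_trans (nm_le_ReIm _)); rewrite ReD ReN ImD ImN !ReE !ImE; lra.
  have := hd _ hn; have := nm_le_dist (h (x' +i* y')) (h (x +i* y)).
  have := nm_le_dist (h (x +i* y)) (h (x' +i* y')); rewrite (nm_distC (h (x +i* y))).
  by rewrite ltr_norml => *; apply/andP; split; lra.
pose zs := m.1 +i* m.2.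
have zsH : inH zs by rewrite /inH ImE; lra.
have inK z : inH z -> e <= nm (h z) -> nm (h z) <= nm (h zs).
  move=> hz he; have [z' /andP[z'1 z'2] e'] := red z hz.
  have : ImC z' <= Y' by rewrite leNgt; apply/negP => /hY'; rewrite e' ltNge he.
  move=> z'3; have := hm (ReC z', ImC z') z'2 => /=; rewrite z'1 z'3 => /(_ isT).
  by rewrite -e'; case: (z').
have es : e <= nm (h zs) by apply: inK => //; exact: lexx.
have hmax w : inH w -> nm (h w) <= nm (h zs).
  move=> hw; have [/inK|/ltW lt] := leP e (nm (h w)); first exact.
  exact: le_trans lt es.
(* The disc about [m.1 + i y] of radius [y] contains the point of height [3 y / 2], so the heights
   grow geometrically. *)
have up (n : nat) : exists2 y : R, (1 + 1 / 2) ^+ n * m.2 <= y & h (m.1 +i* y) = h zs.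
  elim: n => [|n [y y1 y2]]; first by exists m.2 => //; rewrite expr0 mul1r.
  have p0 : 0 < (1 + 1 / 2) ^+ n * m.2 by rewrite mulr_gt0 ?exprn_gt0 //; lra.
  have yH : inH (m.1 +i* y) by rewrite /inH ImE; lra.
  exists ((1 + 1 / 2) * y); first by rewrite exprS -mulrA ler_pM2l //; lra.
  rewrite -y2; apply: max_disc => //; first by move=> w hw; rewrite y2; exact: hmax.
  rewrite (_ : _ - _ = iC * RC (y / 2)); last by apply: CeqP; rewrite !ReImE /=; field.
  by rewrite nmM nm_i nmRC ImE mul1r gtr0_norm; lra.
have h01 : 0 <= (2 / 3 : R) < 1 by lra.
have q0 : 0 < m.2 / (Y' + 1) by rewrite divr_gt0 //; lra.
have [n /(_ n (leqnn n)) hn] := geo_small 1 h01 q0.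
have [y y1 y2] := up n.
have : Y' < y.
  have e23 : (1 + 1 / 2 : R) ^+ n = ((2 / 3) ^+ n)^-1 by rewrite -exprVn; congr (_ ^+ _); field.
  have p23 : 0 < (2 / 3 : R) ^+ n by rewrite exprn_gt0 //; lra.
  apply: lt_le_trans y1; rewrite e23 mulrC ltr_pdivlMr //.
  rewrite mul1r ltr_pdivlMr in hn; last lra.
  have : Y' * (2 / 3) ^+ n <= (2 / 3) ^+ n * (Y' + 1) by lra.
  lra.
move=> lt; have := hY' (m.1 +i* y) lt; rewrite y2; lra.
Qed.

(** * Convolution identities for divisor sums *)

Section Quadruples.
Variables (A : comNzRingType) (n : nat).
Local Notation T := 'I_n.+1.
Local Notation quadr := ((T * T) * (T * T))%type.

(** A quadruple [((a, x), (b, y))] of positive integers with [a x + b y = n]; this equation bounds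
    all entries by [n]. *)
Definition isq (u : quadr) : bool :=
  [&& (0 < u.1.1)%N, (0 < u.1.2)%N, (0 < u.2.1)%N, (0 < u.2.2)%N &
      (u.1.1 * u.1.2 + u.2.1 * u.2.2 == n)%N].

Lemma inordE m : (inord m : T) = (if (m < n.+1)%N then m else 0%N) :> nat.
Proof. by rewrite /inord val_insubd. Qed.

Lemma sum_swap (F : nat -> nat -> A) :
  \sum_(u | isq u && (u.1.2 < u.2.2)%N) F u.1.1 u.2.1 =
  \sum_(u | isq u && (u.2.2 < u.1.2)%N) F u.2.1 u.1.1.
Proof.
rewrite (reindex_onto (fun u : quadr => (u.2, u.1)) (fun u => (u.2, u.1))) /=; last by case.
apply: eq_bigl => -[[a x] [b y]] /=; rewrite eqxx andbT /isq /= addnC.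
by case: (0 < a)%N; case: (0 < x)%N; case: (0 < b)%N; case: (0 < y)%N.
Qed.

Lemma sum_swap1 (F : nat -> nat -> A) :
  \sum_(u | isq u && (u.1.1 < u.2.1)%N) F u.1.1 u.2.1 =
  \sum_(u | isq u && (u.2.1 < u.1.1)%N) F u.2.1 u.1.1.
Proof.
rewrite (reindex_onto (fun u : quadr => (u.2, u.1)) (fun u => (u.2, u.1))) /=; last by case.
apply: eq_bigl => -[[a x] [b y]] /=; rewrite eqxx andbT /isq /= addnC.
by case: (0 < a)%N; case: (0 < x)%N; case: (0 < b)%N; case: (0 < y)%N.
Qed.

(* Skoruppa's bijection: a x + b y = (a + b) y + a (x - y). *)
Lemma sum_shear (F : nat -> nat -> A) :
  \sum_(u | isq u && (u.2.1 < u.1.1)%N) F u.1.1 u.2.1 =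
  \sum_(u | isq u && (u.2.2 < u.1.2)%N) F (u.1.1 + u.2.1)%N u.1.1.
Proof.
(* On the quadruples concerned all sums and differences stay between 0 and [n], so [inord] does not
   truncate. *)
pose h (u : quadr) : quadr := ((inord (u.1.1 + u.2.1), u.2.2), (u.1.1, inord (u.1.2 - u.2.2))).
pose h' (u : quadr) : quadr := ((u.2.1, inord (u.1.2 + u.2.2)), (inord (u.1.1 - u.2.1), u.1.2)).
rewrite (reindex_onto h h') /=; last first.
  move=> [[a x] [b y]] /=; rewrite /isq /= => /andP[/and5P[a0 x0 b0 y0 /eqP e] ba].
  have b1 : (x + y < n.+1)%N by nia.
  have b2 : (a - b < n.+1)%N by have := ltn_ord a; lia.
  congr ((_, _), (_, _)); apply/val_inj; rewrite /= ?inordE /= ?inordE ?b1 ?b2 /=.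
    by have -> : (b + (a - b) < n.+1)%N by [have := ltn_ord a; lia]; lia.
  by have -> : (x + y - x < n.+1)%N by [have := ltn_ord y; lia]; lia.
rewrite (eq_bigl (fun u => isq u && (u.2.2 < u.1.2)%N)).
  apply: eq_bigr => -[[a x] [b y]] /=; rewrite /isq /= => /andP[/and5P[a0 x0 b0 y0 /eqP e] yx].
  by rewrite inordE; have -> : (a + b < n.+1)%N by nia.
move=> [[a x] [b y]]; rewrite /isq /h /h' /=.
rewrite !inordE; apply/idP/idP.
  move=> /andP[/andP[/and5P[_ y0 a0 c2 /eqP e] c3] /eqP[/(congr1 val) /= e1 _]].
  move: c2 c3 e e1; rewrite ?inordE.
  case: ifP => // xy c2; case: ifP => // ab c3 e.
  have -> : (y + (x - y) < n.+1)%N by have := ltn_ord x; lia.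
  move=> _; have b0 : (0 < b)%N by lia.
  have x0 : (0 < x)%N by lia.
  by rewrite a0 x0 b0 y0 /=; apply/andP; split; [apply/eqP; nia|lia].
move=> /andP[/and5P[a0 x0 b0 y0 /eqP e] yx].
have ab : (a + b < n.+1)%N by nia.
have xy : (x - y < n.+1)%N by have := ltn_ord x; lia.
rewrite ab xy y0 a0 /=; apply/andP; split.
  by apply/andP; split; [apply/and3P; split; [lia|lia|apply/eqP; nia]|lia].
apply/eqP; congr ((_, _), (_, _)); apply/val_inj; rewrite /= ?inordE /= ?inordE ?xy ?ab /=.
  by have -> : (y + (x - y) < n.+1)%N by [have := ltn_ord x; lia]; lia.
by have -> : (a + b - a < n.+1)%N by [have := ltn_ord b; lia]; lia.
Qed.

Lemma sum_trichotomy (F : quadr -> A) (p q : quadr -> nat) :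
  \sum_(u | isq u) F u = \sum_(u | isq u && (p u < q u)%N) F u +
    (\sum_(u | isq u && (q u < p u)%N) F u + \sum_(u | isq u && (p u == q u)) F u).
Proof.
rewrite (bigID (fun u => (p u < q u)%N)) /=; congr (_ + _).
rewrite (bigID (fun u => (q u < p u)%N)) /=; congr (_ + _); apply: eq_bigl => u.
  by case: (isq u) => //=; case: ltngtP.
by case: (isq u) => //=; case: ltngtP.
Qed.

(** Split the sum of [g] once by comparing [x] with [y] and once by comparing [a] with [b]. By
    [sum_shear] the terms of [g] with [a != b] add up to those of [g + h] with [x != y], so the
    difference of the two splittings expresses the sum of [h] by diagonal terms. *)
Lemma sum_quadruples (g h : nat -> nat -> A) :
  (forall a b, g a b = g b a) -> (forall a b, h a b = h b a) ->
  (forall a b, g (a + b)%N a = g a b + h a b) ->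
  \sum_(u | isq u) h u.1.1 u.2.1 =
  \sum_(u | isq u && (u.1.2 == u.2.2 :> nat)) (g u.1.1 u.2.1 + h u.1.1 u.2.1) -
  \sum_(u | isq u && (u.1.1 == u.2.1 :> nat)) g u.1.1 u.2.1.
Proof.
move=> sg sh gh.
have e1 := sum_trichotomy (fun u => g u.1.1 u.2.1) (fun u => u.1.2) (fun u => u.2.2).
have e2 := sum_trichotomy (fun u => g u.1.1 u.2.1) (fun u => u.1.1) (fun u => u.2.1).
have e3 := sum_trichotomy (fun u => h u.1.1 u.2.1) (fun u => u.1.2) (fun u => u.2.2).
rewrite sum_swap in e1; rewrite sum_swap1 in e2; rewrite sum_swap in e3.
have s1 : \sum_(u | isq u && (u.2.2 < u.1.2)%N) g u.2.1 u.1.1 =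
          \sum_(u | isq u && (u.2.2 < u.1.2)%N) g u.1.1 u.2.1 by apply: eq_bigr.
have s2 : \sum_(u | isq u && (u.2.1 < u.1.1)%N) g u.2.1 u.1.1 =
          \sum_(u | isq u && (u.2.1 < u.1.1)%N) g u.1.1 u.2.1 by apply: eq_bigr.
have s3 : \sum_(u | isq u && (u.2.2 < u.1.2)%N) h u.2.1 u.1.1 =
          \sum_(u | isq u && (u.2.2 < u.1.2)%N) h u.1.1 u.2.1 by apply: eq_bigr.
have s4 : \sum_(u | isq u && (u.2.1 < u.1.1)%N) g u.1.1 u.2.1 =
   \sum_(u | isq u && (u.2.2 < u.1.2)%N) g u.1.1 u.2.1 +
   \sum_(u | isq u && (u.2.2 < u.1.2)%N) h u.1.1 u.2.1.
  by rewrite sum_shear -big_split /=; apply: eq_bigr => u _; rewrite gh.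
rewrite s1 in e1; rewrite s2 s4 in e2; rewrite s3 in e3.
rewrite big_split /=.
move: e1 e2 e3; move: (\sum_(u | isq u) _) (\sum_(u | isq u) _) => G H.
move: (\sum_(u | isq u && (u.2.2 < u.1.2)%N) _) (\sum_(u | isq u && (u.2.2 < u.1.2)%N) _) => X Y.
move: (\sum_(u | _) _) (\sum_(u | _) _) (\sum_(u | _) _) => U V W e1 e2 ->.
have {}e2 : Y + Y + W = Y + Y + (X + X + V).
  by rewrite -addrA -e1 e2; ring.
by rewrite (addrI _ e2); ring.
Qed.

Definition dsum (f : nat -> A) (k : nat) : A := \sum_(d < k.+1 | (d %| k)%N && (0 < d)%N) f d.

Lemma dsum_widen (f : nat -> A) k : (k <= n)%N ->
  dsum f k = \sum_(d < n.+1 | [&& (d %| k)%N, (0 < d)%N & (0 < k)%N]) f d.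
Proof.
move=> kn; case: k kn => [|k] kn.
  rewrite /dsum big1 ?big1 // => -[d hd] /=; first by rewrite !andbF.
  by case/andP => _ /=; have -> : d = 0%N by lia.
rewrite /dsum (big_ord_widen_cond n.+1 (fun d => (d %| k.+1)%N && (0 < d)%N) f) //.
apply: eq_bigl => d /=; case: (boolP (d %| k.+1)%N) => //= dk.
by rewrite andbC [in LHS]ltnS (dvdn_leq _ dk) // andbC.
Qed.

Lemma dsum_pairs (f : nat -> A) k : (k <= n)%N ->
  dsum f k = \sum_(p : T * T | [&& (0 < p.1)%N, (0 < p.2)%N & (p.1 * p.2 == k)%N]) f p.1.
Proof.
move=> kn; rewrite dsum_widen //.
rewrite [RHS](reindex_onto (fun d : T => (d, inord (k %/ d))) (fun p => p.1)) /=; last first.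
  move=> [a x] /= /and3P[a0 x0 /eqP e]; congr (_, _); apply/val_inj; rewrite /= inordE -e mulKn //.
  by have -> : (x < n.+1)%N by [].
apply: eq_bigl => d /=; rewrite eqxx andbT inordE.
have -> : (k %/ d < n.+1)%N by rewrite ltnS (leq_trans (leq_div _ _)).
apply/idP/idP => [/and3P[dk d0 k0]|/and3P[d0 q0 /eqP e]].
  by rewrite d0 divn_gt0 // dvdn_leq //= mulnC divnK.
by rewrite d0 -e dvdn_mulr // muln_gt0 d0 q0.
Qed.

Lemma sum_prod (f g : nat -> A) :
  \sum_(u | isq u) f u.1.1 * g u.2.1 = \sum_(k < n.+1) dsum f k * dsum g (n - k).
Proof.
pose c (u : quadr) : T := inord (u.1.1 * u.1.2).
rewrite (partition_big c xpredT) //=; apply: eq_bigr => k _.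
have kn : (k <= n)%N by rewrite -ltnS ltn_ord.
rewrite (dsum_pairs f kn) (dsum_pairs g (leq_subr k n)).
rewrite big_distrlr /= pair_big_dep /=; apply: eq_bigl => -[[a x] [b y]] /=.
rewrite /isq /c /= -val_eqE /= inordE.
have hk := ltn_ord k.
apply/idP/idP.
  move=> /andP[/and5P[a0 x0 b0 y0 /eqP e]]; have -> : (a * x < n.+1)%N by lia.
  by move=> /eqP ek; rewrite a0 x0 b0 y0 ek eqxx /=; apply/eqP; lia.
move=> /andP[/and3P[a0 x0 /eqP ek] /and3P[b0 y0 /eqP e2]].
rewrite a0 x0 b0 y0 ek /=; have -> : (k < n.+1)%N by [].
by rewrite eqxx andbT; apply/eqP; lia.
Qed.

(** For [x = y] one has [x (a + b) = n]: the divisor [d = a + b] and its decomposition determine the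
    quadruple. *)
Lemma sum_diag_x (F : nat -> nat -> A) :
  \sum_(u | isq u && (u.1.2 == u.2.2 :> nat)) F u.1.1 u.2.1 =
  dsum (fun d => \sum_(1 <= a < d) F a (d - a)%N) n.
Proof.
have -> : dsum (fun d => \sum_(1 <= a < d) F a (d - a)%N) n =
    \sum_(d < n.+1 | (d %| n)%N && (0 < d)%N) \sum_(a < n.+1 | (0 < a < d)%N) F a (d - a)%N.
  apply: eq_bigr => d _; rewrite (big_nat_widenl _ 0%N) //= (big_nat_widen _ _ n.+1) ?(ltnW (ltn_ord _)) //.
  by rewrite big_mkord.
rewrite pair_big_dep /=.
pose h (p : T * T) : quadr := ((p.2, inord (n %/ p.1)), (inord (p.1 - p.2), inord (n %/ p.1))).
pose h' (u : quadr) : T * T := (inord (u.1.1 + u.2.1), u.1.1).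
have qn d : (n %/ d < n.+1)%N by rewrite ltnS leq_div.
rewrite (reindex_onto h h') /=; last first.
  move=> [[a x] [b y]] /=; rewrite /isq /= => /andP[/and5P[a0 x0 b0 y0 /eqP e] /eqP xy].
  have ab : (a + b < n.+1)%N by nia.
  have e2 : (n = x * (a + b))%N by apply/esym; rewrite -[RHS]e -xy mulnDr mulnC (mulnC x).
  have e3 : (n %/ (a + b) = x)%N by rewrite [X in (X %/ _)%N]e2 mulnK // addn_gt0 a0.
  congr ((_, _), (_, _)); apply/val_inj; rewrite /= ?inordE ?ab ?qn /= ?inordE ?ab ?e3 //.
  by have -> : (a + b - a < n.+1)%N by [lia]; lia.
rewrite (eq_bigl (fun p : T * T => ((p.1 %| n)%N && (0 < p.1)%N) && (0 < p.2 < p.1)%N)).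
  apply: eq_bigr => -[d a] /= /andP[_ /andP[a0 ad]]; rewrite inordE.
  by have -> : (d - a < n.+1)%N by have := ltn_ord d; lia.
move=> [d a]; rewrite /isq /h /h' /= !inordE qn eqxx andbT.
have -> : (d - a < n.+1)%N by have := ltn_ord d; lia.
apply/idP/idP.
  move=> /andP[/and5P[a0 q0 b0 _ /eqP e] /eqP[/(congr1 val) /= e1]].
  have ead : (a + (d - a) = d)%N by lia.
  have d0 : (0 < d)%N by lia.
  have dn : (d %| n)%N by apply/dvdnP; exists (n %/ d)%N; rewrite -[LHS]e -mulnDl ead mulnC.
  by rewrite dn a0 d0 /=; lia.
move=> /andP[/andP[dn d0] /andP[a0 ad]].
have e := divnK dn; have n0 : (0 < n %/ d)%N.
  by case: (posnP (n %/ d)%N) => // q0; move: e (ltn_ord d); rewrite q0; lia.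
rewrite a0 n0 subn_gt0 ad -mulnDl subnKC ?(ltnW ad) // mulnC e eqxx /=.
by rewrite inord_val.
Qed.

(** For [a = b] one has [a (x + y) = n], which leaves [n / a - 1] choices for [x]. *)
Lemma sum_diag_a (F : nat -> nat -> A) :
  \sum_(u | isq u && (u.1.1 == u.2.1 :> nat)) F u.1.1 u.2.1 =
  dsum (fun a => (n %/ a).-1%:R * F a a) n.
Proof.
pose h (p : T * T) : quadr := ((p.1, p.2), (p.1, inord (n %/ p.1 - p.2))).
pose h' (u : quadr) : T * T := u.1.
have qn d : (n %/ d < n.+1)%N by rewrite ltnS leq_div.
have -> : dsum (fun a => (n %/ a).-1%:R * F a a) n =
   \sum_(a < n.+1 | (a %| n)%N && (0 < a)%N) \sum_(x < n.+1 | (0 < x < n %/ a)%N) F a a.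
  apply: eq_bigr => a _; rewrite sumr_const mulr_natl; congr (_ *+ _).
  rewrite -sum1_card (eq_bigl (fun x : T => (0 < x < n %/ a)%N)) //.
  rewrite -(big_mkord (fun x => (0 < x < n %/ a)%N) (fun=> 1%N)).
  rewrite -(big_nat_widen 0 (n %/ a) n.+1 (fun x => 0 < x)%N) ?(ltnW (qn _)) //.
  by rewrite -subn1 -[LHS]muln1 -sum_nat_const_nat (big_nat_widenl 1 0).
rewrite pair_big_dep /= (reindex_onto h h') /=; last first.
  move=> [[a x] [b y]] /=; rewrite /isq /= => /andP[/and5P[a0 x0 b0 y0 /eqP e] /eqP ab].
  have e2 : (n = (x + y) * a)%N by apply/esym; rewrite -[RHS]e -ab mulnDl mulnC (mulnC y).
  have e3 : (n %/ a = x + y)%N by rewrite [X in (X %/ _)%N]e2 mulnK.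
  congr ((_, _), (_, _)); apply/val_inj; rewrite //= ?inordE.
  by rewrite e3 addKn ltn_ord.
rewrite (eq_bigl (fun p : T * T => ((p.1 %| n)%N && (0 < p.1)%N) && (0 < p.2 < n %/ p.1)%N)) //.
move=> [a x]; rewrite /isq /h /h' /= !inordE eqxx andbT.
have -> : (n %/ a - x < n.+1)%N by rewrite (leq_ltn_trans (leq_subr _ _)).
apply/idP/idP.
  move=> /andP[/and5P[a0 x0 _ y0 /eqP e] _].
  have xq : (x <= n %/ a)%N by lia.
  have an : (a %| n)%N by apply/dvdnP; exists (n %/ a)%N; rewrite -[LHS]e -mulnDr subnKC // mulnC.
  by rewrite an a0 x0 /=; lia.
move=> /andP[/andP[an a0] /andP[x0 xq]].
by rewrite a0 x0 subn_gt0 xq -mulnDr subnKC ?(ltnW xq) // mulnC divnK // !eqxx.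
Qed.

End Quadruples.

(** The divisor 0 occurs in [sigmaf] only for [k = 0], and its positive power vanishes. *)
Lemma dsum_sigma (A : comNzRingType) j k : dsum (fun d => d%:R ^+ j.+1) k = (sigmaf j.+1 k)%:R :> A.
Proof.
rewrite /dsum /sigmaf natr_sum; rewrite [RHS](bigID (fun d : 'I_k.+1 => (0 < d)%N)) /=.
rewrite [X in _ + X]big1 ?addr0; first by apply: eq_bigr => d _; rewrite natrX.
by move=> d /andP[_]; rewrite -eqn0Ngt => /eqP ->; rewrite exp0n.
Qed.

Lemma dsumD (A : comNzRingType) (f g : nat -> A) n : dsum (fun d => f d + g d) n = dsum f n + dsum g n.
Proof. exact: big_split. Qed.

Lemma dsumZ (A : comNzRingType) (c : A) (f : nat -> A) n : dsum (fun d => c * f d) n = c * dsum f n.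
Proof. by rewrite /dsum big_distrr. Qed.

Lemma dsum_ext (A : comNzRingType) (f g : nat -> A) n :
  (forall d, (d %| n)%N -> (0 < d <= n)%N -> f d = g d) -> dsum f n = dsum g n.
Proof. by move=> h; apply: eq_bigr => d /andP[d1 d2]; apply: h; rewrite // d2 -ltnS ltn_ord. Qed.

Lemma sum_quadratic (A : comNzRingType) (d : A) m :
  6 * \sum_(1 <= a < m.+1) (d ^+ 2 - d * a%:R + a%:R ^+ 2) =
  6 * d ^+ 2 * m%:R - 3 * d * m%:R * (m%:R + 1) + m%:R * (m%:R + 1) * (2 * m%:R + 1).
Proof.
elim: m => [|m IH]; first by rewrite big_geq //; ring.
by rewrite big_nat_recr //= mulrDr IH -natr1; ring.
Qed.

Lemma sum_quartic (A : comNzRingType) (d : A) m :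
  30 * \sum_(1 <= a < m.+1) (d ^+ 2 - d * a%:R + a%:R ^+ 2) ^+ 2 =
  30 * d ^+ 4 * m%:R - 30 * d ^+ 3 * m%:R * (m%:R + 1)
  + 15 * d ^+ 2 * m%:R * (m%:R + 1) * (2 * m%:R + 1) - 15 * d * m%:R ^+ 2 * (m%:R + 1) ^+ 2
  + m%:R * (m%:R + 1) * (2 * m%:R + 1) * (3 * m%:R ^+ 2 + 3 * m%:R - 1).
Proof.
elim: m => [|m IH]; first by rewrite big_geq //; ring.
by rewrite big_nat_recr //= mulrDr IH -natr1; ring.
Qed.

(** [g = a^2 - a b + b^2] and [h = 2 a b] satisfy [g (a + b, a) = g + h]. The factor 12 is 2 from
    [h] times the denominator 6 of the power sums in [sum_quadratic]. *)
Lemma sigma11 (A : comNzRingType) n :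
  12 * \sum_(k < n.+1) (sigmaf 1 k)%:R * (sigmaf 1 (n - k))%:R =
  5 * (sigmaf 3 n)%:R + (sigmaf 1 n)%:R - 6 * n%:R * (sigmaf 1 n)%:R :> A.
Proof.
pose g (a b : nat) : A := a%:R ^+ 2 - a%:R * b%:R + b%:R ^+ 2.
pose h (a b : nat) : A := a%:R ^+ 1 * (2 * b%:R ^+ 1).
have hg a b : g a b = g b a by rewrite /g; ring.
have hh a b : h a b = h b a by rewrite /h; ring.
have gh a b : g (a + b)%N a = g a b + h a b by rewrite /g /h natrD; ring.
have e := sum_quadruples n hg hh gh.
rewrite (sum_diag_x n (fun a b => g a b + h a b)) (sum_diag_a n g) in e.
have e1 : \sum_(u | isq (n := n) u) h u.1.1 u.2.1 =
  \sum_(k < n.+1) dsum (fun a => a%:R ^+ 1) k * dsum (fun b => 2 * b%:R ^+ 1) (n - k) := sum_prod n _ _.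
rewrite e1 in e.
have -> : 12 * \sum_(k < n.+1) (sigmaf 1 k)%:R * (sigmaf 1 (n - k))%:R =
   6 * \sum_(k < n.+1) dsum (fun a => a%:R ^+ 1) k * dsum (fun b => 2 * b%:R ^+ 1) (n - k) :> A.
  rewrite !big_distrr /=; apply: eq_bigr => k _; rewrite dsumZ !dsum_sigma; ring.
rewrite e.
transitivity (dsum (fun d => 6 * (\sum_(1 <= a < d) (g a (d - a)%N + h a (d - a)%N)) +
    (- 6) * ((n %/ d).-1%:R * g d d)) n).
  by rewrite dsumD !dsumZ; ring.
transitivity (dsum (fun d => 5 * (d%:R ^+ 3) + (1 - 6 * n%:R) * (d%:R ^+ 1)) n : A); last first.
  by rewrite dsumD !dsumZ !dsum_sigma; ring.
apply: dsum_ext => d dn /andP[d0 dn']; apply/eqP; rewrite -subr_eq0; apply/eqP.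
have en : n%:R = (n %/ d)%:R * d%:R :> A by rewrite -natrM divnK.
have q0 : (0 < n %/ d)%N by rewrite divn_gt0.
rewrite en; case: (n %/ d)%N q0 => // q _; case: d d0 {dn dn' en} => // d _.
have -> : \sum_(1 <= a < d.+1) (g a (d.+1 - a)%N + h a (d.+1 - a)%N) =
   \sum_(1 <= a < d.+1) (d.+1%:R ^+ 2 - d.+1%:R * a%:R + a%:R ^+ 2) :> A.
  by rewrite !big_nat; apply: eq_bigr => a /andP[_ ad]; rewrite /g /h natrB ?(ltnW ad) //; ring.
by rewrite sum_quadratic /g /= -!natr1; ring.
Qed.

(** Here [g] is the square of the form used for [sigma11], and [(a^2 + a b + b^2)^2 - (a^2 - a b +
    b^2)^2 = 4 a b (a^2 + b^2)], which sums to 8 times the convolution. With the denominator 30 of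
    [sum_quartic] this gives 240. *)
Lemma sigma13 (A : comNzRingType) n :
  240 * \sum_(k < n.+1) (sigmaf 1 k)%:R * (sigmaf 3 (n - k))%:R =
  21 * (sigmaf 5 n)%:R + 10 * (sigmaf 3 n)%:R - (sigmaf 1 n)%:R - 30 * n%:R * (sigmaf 3 n)%:R :> A.
Proof.
pose g (a b : nat) : A := (a%:R ^+ 2 - a%:R * b%:R + b%:R ^+ 2) ^+ 2.
pose h (a b : nat) : A := 4 * a%:R * b%:R * (a%:R ^+ 2 + b%:R ^+ 2).
have hg a b : g a b = g b a by rewrite /g; ring.
have hh a b : h a b = h b a by rewrite /h; ring.
have gh a b : g (a + b)%N a = g a b + h a b by rewrite /g /h natrD; ring.
have e := sum_quadruples n hg hh gh.
rewrite (sum_diag_x n (fun a b => g a b + h a b)) (sum_diag_a n g) in e.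
have e1 : \sum_(u | isq (n := n) u) h u.1.1 u.2.1 =
    \sum_(k < n.+1) dsum (fun a => a%:R ^+ 3) k * dsum (fun b => 4 * b%:R ^+ 1) (n - k) +
    \sum_(k < n.+1) dsum (fun a => a%:R ^+ 1) k * dsum (fun b => 4 * b%:R ^+ 3) (n - k).
  by rewrite -!sum_prod -big_split /=; apply: eq_bigr => u _; rewrite /h; ring.
have sw : \sum_(k < n.+1) dsum (fun a => a%:R ^+ 3) k * dsum (fun b => 4 * b%:R ^+ 1) (n - k) =
    \sum_(k < n.+1) dsum (fun a => a%:R ^+ 1) k * dsum (fun b => 4 * b%:R ^+ 3) (n - k) :> A.
  rewrite (reindex_inj rev_ord_inj) /=; apply: eq_bigr => k _.
  have kn : (k <= n)%N by rewrite -ltnS.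
  by rewrite subSS subKn // !dsumZ [LHS]mulrC mulrCA -!mulrA mulrCA.
rewrite sw in e1.
have -> : 240 * \sum_(k < n.+1) (sigmaf 1 k)%:R * (sigmaf 3 (n - k))%:R =
   30 * \sum_(u | isq (n := n) u) h u.1.1 u.2.1 :> A.
  rewrite e1 mulrDr !big_distrr -big_split /=; apply: eq_bigr => k _.
  by rewrite dsumZ !dsum_sigma; ring.
rewrite e.
transitivity (dsum (fun d => 30 * (\sum_(1 <= a < d) (g a (d - a)%N + h a (d - a)%N)) +
    (- 30) * ((n %/ d).-1%:R * g d d)) n).
  by rewrite dsumD !dsumZ; ring.
transitivity (dsum (fun d => 21 * (d%:R ^+ 5) + ((10 - 30 * n%:R) * (d%:R ^+ 3) +
    (- 1) * (d%:R ^+ 1))) n : A); last first.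
  by rewrite !dsumD !dsumZ !dsum_sigma; ring.
apply: dsum_ext => d dn /andP[d0 dn']; apply/eqP; rewrite -subr_eq0; apply/eqP.
have en : n%:R = (n %/ d)%:R * d%:R :> A by rewrite -natrM divnK.
have q0 : (0 < n %/ d)%N by rewrite divn_gt0.
rewrite en; case: (n %/ d)%N q0 => // q _; case: d d0 {dn dn' en} => // d _.
have -> : \sum_(1 <= a < d.+1) (g a (d.+1 - a)%N + h a (d.+1 - a)%N) =
   \sum_(1 <= a < d.+1) (d.+1%:R ^+ 2 - d.+1%:R * a%:R + a%:R ^+ 2) ^+ 2 :> A.
  by rewrite !big_nat; apply: eq_bigr => a /andP[_ ad]; rewrite /g /h natrB ?(ltnW ad) //; ring.
by rewrite sum_quartic /g /= -!natr1; ring.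
Qed.

(** * The eta function and Ramanujan's differential equations *)

Lemma zero_deriv_realType (F : realType) (f : F -> F) :
  (forall x : F, 0 <= x <= 1 -> forall e : F, 0 < e -> exists2 d : F, 0 < d &
     forall h : F, `|h| < d -> `|f (x + h) - f x| <= e * `|h|) -> f 1 = f 0.
Proof.
move=> hf.
have dr (x : F) : 0 <= x <= 1 -> is_derive x 1 f 0.
  move=> hx; have c : (fun h : F => h^-1 *: ((f \o shift x) (h *: (1 : F)) - f x)) @ (0 : F)^' --> (0 : F).
    apply/cvgrPdist_le => e e0; have [d d0 hd] := hf x hx e e0.
    exists d => //= h /=; rewrite sub0r normrN => hh h0.
    rewrite sub0r normrN /shift /= normrZ normfV mulrC ler_pdivrMr ?normr_gt0 //.
    by rewrite -[h%:A]/(h * 1) mulr1 (addrC h); exact: hd.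
  by apply: DeriveDef; [apply: (cvgP _ c)|exact: (cvg_lim _ c)].
have [||c _] := @MVT_segment F f (fun=> 0) 0 1 ler01.
- by move=> x; rewrite in_itv /= => /andP[/ltW a /ltW b]; apply: dr; rewrite a b.
- apply: derivable_within_continuous => x; rewrite in_itv /= => hx.
  by have [] := dr x hx.
by rewrite mul0r => /eqP; rewrite subr_eq0 => /eqP.
Qed.

Lemma zero_derivR (f : R -> R) :
  (forall x : R, 0 <= x <= 1 -> forall e : R, 0 < e -> exists2 d : R, 0 < d &
     forall h : R, `|h| < d -> `|f (x + h) - f x| <= e * `|h|) -> f 1 = f 0.
Proof. exact: zero_deriv_realType. Qed.

(** Along the segment from [z] to [w] the derivative is 0; the real mean value theorem is applied to
    both coordinates. *)
Lemma isd0_const (D : C -> Prop) (f : C -> C) z w :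
  (forall t : R, 0 <= t <= 1 -> D (z + RC t * (w - z))) -> (forall u, D u -> isd f u 0) -> f w = f z.
Proof.
move=> hD df; have key (t : R) : 0 <= t <= 1 -> forall e : R, 0 < e -> exists2 d : R, 0 < d &
    forall h : R, `|h| < d ->
    nm (f (z + RC (t + h) * (w - z)) - f (z + RC t * (w - z))) <= e * `|h|.
  move=> ht e e0; have /isdP/(_ (e / (1 + nm (w - z)))) := df _ (hD t ht).
  have c0 : 0 < 1 + nm (w - z) by rewrite ltr_wpDr ?nm_ge0.
  rewrite divr_gt0 // => /(_ isT)[d d0 hd]; exists (d / (1 + nm (w - z))).
    by rewrite divr_gt0.
  move=> h hh; have eh : z + RC (t + h) * (w - z) - (z + RC t * (w - z)) = RC h * (w - z).
    by rewrite RCD; ring.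
  have := hd (z + RC (t + h) * (w - z)); rewrite eh nmM nmRC mul0r subr0.
  have lb : `|h| * nm (w - z) <= `|h| * (1 + nm (w - z)) by rewrite ler_wpM2l // lerDr ler01.
  move: hh; rewrite ltr_pdivlMr // => hh /(_ (le_lt_trans lb hh)) /le_trans; apply.
  have -> : e / (1 + nm (w - z)) * (`|h| * nm (w - z)) = e * (`|h| * nm (w - z) / (1 + nm (w - z))).
    by rewrite -!mulrA; congr (_ * _); rewrite mulrC -!mulrA.
  by rewrite ler_wpM2l ?(ltW e0) // ler_pdivrMr.
have [e0 e1] : z + RC 0 * (w - z) = z /\ z + RC 1 * (w - z) = w by rewrite RC0 RC1; split; ring.
apply: CeqP.
  have := @zero_derivR (fun t => ReC (f (z + RC t * (w - z)))).
  rewrite e0 e1; apply=> t ht e ep; have [d d0 hd] := key t ht e ep; exists d => // h hh.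
  by apply: le_trans (hd h hh); rewrite -ReN -ReD; exact: abs_Re_le.
have := @zero_derivR (fun t => ImC (f (z + RC t * (w - z)))).
rewrite e0 e1; apply=> t ht e ep; have [d d0 hd] := key t ht e ep; exists d => // h hh.
by apply: le_trans (hd h hh); rewrite -ImN -ImD; exact: abs_Im_le.
Qed.

Lemma isd0_H (f : C -> C) z w : (forall u, inH u -> isd f u 0) -> inH z -> inH w -> f w = f z.
Proof.
move=> df hz hw; apply: (isd0_const (D := fun u => inH u)) => // t /andP[t0 t1].
rewrite /inH !ReImE in hz hw *.
have -> : ImC z + (t * (ImC w - ImC z) + 0 * (ReC w - ReC z)) = (1 - t) * ImC z + t * ImC w by ring.
case: (ltgtP t 1) t1 => // [t1|->] _; last by rewrite subrr mul0r add0r mul1r.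
by rewrite ltr_pwDl ?mulr_gt0 ?subr_gt0 // mulr_ge0 // ltW.
Qed.

(** Taylor coefficients of [log (1 - w)]; at [n = 0] the value is 0, since the inverse of 0 is 0. *)
Definition logcoef (n : nat) : C := - n%:R^-1.

Lemma PSR_logcoef : PSR logcoef.
Proof.
apply: PSR_le PSR1 => n; rewrite /logcoef nmN nmV nm_nat nm1.
by case: n => [|n]; rewrite ?invr0 ?ler01 // invf_le1 ?ltr0n // ler1n.
Qed.

Lemma psum0 a : PSR a -> psum a 0 = a 0%N.
Proof. by move=> ha; rewrite psum_shift // ?nm0 ?ltr01 // mul0r addr0. Qed.

Lemma psum1 w : nm w < 1 -> (1 - w) * psum (fun=> 1) w = 1.
Proof.
move=> hw; have := psum_shift PSR1 hw => e.
by rewrite mulrBl mul1r {1}e addrK.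
Qed.

(** The product of [1 - u] and [exp (- psum logcoef u)] has derivative 0 on the unit disc. *)
Lemma exp_log w : nm w < 1 -> expC (psum logcoef w) = 1 - w.
Proof.
move=> hw; pose f u := (1 - u) * expC (- psum logcoef u).
have : f w = f 0.
  apply: (isd0_const (D := fun u => nm u < 1)) => [t /andP[t0 t1]|u hu].
    by rewrite add0r subr0 nmM nmRC ger0_norm // (le_lt_trans _ hw) // ler_piMl // nm_ge0.
  have d1 := isdB (isd_cst 1 u) (isd_id u).
  have d2 := isd_comp (isdN (isd_psum PSR_logcoef hu)) (isd_expC _).
  apply: isd_eq (isdM d1 d2) _.
  have -> : psum (da logcoef) u = - psum (fun=> 1) u.
    rewrite -mulN1r -(psumZ _ PSR1 hu); congr psum; apply: funext => n; rewrite /da /logcoef mulrN mulfV ?mulN1r ?mulr1 //.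
  have := psum1 hu; set s := psum _ u; set E := expC _ => e.
  have -> : (0 - 1) * E + (1 - u) * (E * - - s) = E * ((1 - u) * s - 1) by ring.
  by rewrite e subrr mulr0.
rewrite /f psum0; last exact: PSR_logcoef.
rewrite /logcoef invr0 !oppr0 expC0 addr0 mulr1 expCN => /(canRL (mulfK _)) ->.
  by rewrite invrK mul1r.
by rewrite invr_neq0 // expC_neq0.
Qed.

(** Coefficients of the series obtained by substituting [w ^ n] for [w]. *)
Definition spread (n : nat) (a : nat -> C) (k : nat) : C := if (n %| k)%N then a (k %/ n)%N else 0.

Lemma PSR_spread n a : (0 < n)%N -> PSR a -> PSR (spread n a).
Proof.
move=> n0 ha r hr; have hr' : 0 < r ^+ n < 1.
  by case/andP: hr => r0 r1; rewrite exprn_gt0 // exprn_ilt1 // ?(ltW r0) // -lt0n.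
have [K hK] := ha _ hr'; exists K => k; rewrite /spread; case: ifP => [nk|_].
  by rewrite -[in X in _ * X](divnK nk) mulnC exprM.
rewrite nm0 mul0r; apply: le_trans (hK 0%N); rewrite mulr_ge0 ?nm_ge0 ?exprn_ge0 //.
by case/andP: hr => /ltW.
Qed.

Lemma psum_spread n a w : (0 < n)%N -> PSR a -> nm w < 1 -> psum (spread n a) w = psum a (w ^+ n).
Proof.
move=> n0 ha hw; have hwn : nm (w ^+ n) < 1 by rewrite nmX exprn_ilt1 ?nm_ge0 // -lt0n.
have c1 := psum_cs (PSR_spread n0 ha) hw; have c2 := psum_cs ha hwn.
apply: cs_unique c2 => e e0; have [N hN] := c1 e e0; exists N => M NM.
suff <- : series (fun k => spread n a k * w ^+ k) (n * M)%N = series (fun k => a k * (w ^+ n) ^+ k) M.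
  by apply: hN; rewrite (leq_trans NM) // leq_pmull.
elim: M {NM} => [|M IH]; first by rewrite muln0 /series /= !big_geq.
rewrite /series /= in IH *; rewrite big_nat_recr //= -IH mulnS addnC.
rewrite (big_cat_nat (n := (n * M)%N)) //= ?leq_addr //; congr (_ + _).
rewrite big_ltn; last by rewrite -[X in (X < _)%N]addn0 ltn_add2l.
rewrite /spread dvdn_mulr // mulKn // exprM big1_seq ?addr0 // => k /=.
rewrite mem_index_iota => /andP[k1 k2]; rewrite ifN ?mul0r //.
apply/negP => /dvdnP[c ec]; move: k1 k2; rewrite ec -mulnSr (mulnC c) !ltn_pmul2l //; lia.
Qed.

(** Coefficients of the logarithm of the infinite product: summing [log (1 - w ^ d)] over [d]
    produces minus the sum of [d / n] over the divisors [d] of [n]. *)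
Definition etacoef (n : nat) : C := - ((sigmaf 1 n)%:R / n%:R).

Definition etacoefN (N n : nat) : C := \sum_(1 <= d < N.+1) spread d logcoef n.

Lemma sigma0 k : sigmaf k.+1 0 = 0%N.
Proof. by rewrite /sigmaf big_mkcond big_ord_recl big_ord0 /= exp0n. Qed.

Lemma nm_logcoef n : nm (logcoef n) <= 1.
Proof.
rewrite /logcoef nmN nmV nm_nat.
by case: n => [|n]; rewrite ?invr0 ?ler01 // invf_le1 ?ltr0n // ler1n.
Qed.

(** A factor [1 - w ^ d] with [d > n] does not affect the coefficient of [w ^ n]. *)
Lemma etacoefN_stable N n : (n <= N)%N -> etacoefN N n = etacoef n.
Proof.
case: n => [_|n nN].
  rewrite /etacoefN /etacoef sigma0 mul0r oppr0 big1 // => d _.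
  by rewrite /spread dvdn0 div0n /logcoef invr0 oppr0.
rewrite /etacoefN (big_cat_nat (n := n.+2)) //= [X in _ + X]big_nat_cond [X in _ + X]big1 ?addr0; last first.
  move=> d /andP[/andP[d1 _] _]; rewrite /spread ifN //.
  by apply/negP => /dvdn_leq -/(_ isT); lia.
rewrite /etacoef /sigmaf natr_sum big_distrl -sumrN [LHS]big_mkcond /=.
rewrite -(big_mkord (fun d => d %| n.+1)%N (fun d => - ((d ^ 1)%:R / n.+1%:R : C))).
rewrite [RHS]big_mkcond [RHS]big_ltn //= ?dvd0n /= ?add0r !big_nat.
apply: eq_bigr => d /andP[d0 _]; rewrite /spread; case: ifP => // dn.
rewrite /logcoef expn1 -[in RHS](divnK dn) natrM invfM mulrCA mulfV ?mulr1 //.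
by rewrite pnatr_eq0 -lt0n.
Qed.

(** At most [n] terms are nonzero, each of modulus at most 1, uniformly in [N]; this permits the
    limit in [eta_prod]. *)
Lemma etacoefN_le N n : nm (etacoefN N n) <= n%:R.
Proof.
have [nN|/ltnW Nn] := leqP n N.
  rewrite (etacoefN_stable nN) -(etacoefN_stable (leqnn n)) /etacoefN.
  apply: le_trans (nm_sum_le _ _ _) _.
  apply: (@le_trans _ _ (\sum_(1 <= d < n.+1) (1 : R))); last by rewrite sumr_const_nat subn1.
  by apply: ler_sum => d _; rewrite /spread; case: ifP; rewrite ?nm_logcoef ?nm0.
apply: le_trans (nm_sum_le _ _ _) _.
apply: (@le_trans _ _ (\sum_(1 <= d < N.+1) (1 : R))); last by rewrite sumr_const_nat subn1 ler_nat.
by apply: ler_sum => d _; rewrite /spread; case: ifP; rewrite ?nm_logcoef ?nm0.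
Qed.

Lemma PSR_nat : PSR (fun n => n%:R).
Proof. by have := PSR_pow 1; congr PSR; apply: funext => n; rewrite expr1. Qed.

Lemma PSR_etacoef : PSR etacoef.
Proof.
by apply: PSR_le PSR_nat => n; rewrite -(etacoefN_stable (leqnn n)) nm_nat etacoefN_le.
Qed.

Lemma PSR_etacoefN N : PSR (etacoefN N).
Proof. by apply: PSR_le PSR_nat => n; rewrite nm_nat etacoefN_le. Qed.

Lemma eta_partial N w : nm w < 1 ->
  \prod_(1 <= n < N.+1) (1 - w ^+ n) = expC (psum (etacoefN N) w).
Proof.
move=> hw; elim: N => [|N IH].
  rewrite big_geq // /etacoefN.
  have -> : (fun n : nat => \sum_(1 <= d < 1) spread d logcoef n) = (fun n => if n == 0%N then 0 else 0).
    by apply: funext => n; rewrite big_geq //; case: ifP.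
  by rewrite psum_cst expC0.
have hwn : nm (w ^+ N.+1) < 1 by rewrite nmX exprn_ilt1 ?nm_ge0.
rewrite big_nat_recr //= IH -(exp_log hwn) -psum_spread //; last exact: PSR_logcoef.
rewrite -expCD -psumD //; [|exact: PSR_etacoefN|exact: PSR_spread PSR_logcoef].
have -> // : (fun n : nat => etacoefN N n + spread N.+1 logcoef n) = etacoefN N.+1.
by apply: funext => n; rewrite /etacoefN [RHS]big_nat_recr.
Qed.

(** The logarithms of the partial product and of the limit have the same coefficients up to index
    [N] and coefficients bounded by [n] throughout, so their difference lies under a geometric
    tail. *)
Lemma eta_prod w : nm w < 1 ->
  limn (fun N => \prod_(1 <= n < N.+1) (1 - w ^+ n)) = expC (psum etacoef w).
Proof.
move=> hw; apply: limn_cs.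
suff h : cs (fun N => psum (etacoefN N) w) (psum etacoef w).
  by apply: cs_ext (cts_cs (isd_cts (isd_expC _)) h) => N; rewrite eta_partial.
have hw' : 0 <= nm w < 1 by rewrite nm_ge0.
have [K [t [K0 ht hK]]] := PSR_geo (PSRZ (2 : C) PSR_nat) hw'.
have key N : nm (psum (etacoefN N) w - psum etacoef w) <= K / (1 - t) * t ^+ N.
  pose u k := (etacoefN N k + -1 * etacoef k) * w ^+ k.
  have hu k : nm (u k) <= K * t ^+ k.
    apply: le_trans (hK k w (lexx _)); rewrite /u !nmM ler_wpM2r ?nm_ge0 //.
    apply: le_trans (nmD _ _) _; rewrite nmM nmN nm1 mul1r !nm_nat mulr_natl mulr2n lerD ?etacoefN_le //.
    by rewrite -(etacoefN_stable (leqnn k)) etacoefN_le.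
  have [l [c1 c2]] := geo_cvg K0 ht hu.
  have el : psum (etacoefN N) w - psum etacoef w = l.
    rewrite -(psum_eq c1) (psumD (PSR_etacoefN N) (PSRZ _ PSR_etacoef) hw) (psumZ _ PSR_etacoef hw).
    by rewrite mulN1r.
  have := c2 N; rewrite el; have -> : series u N = 0.
    rewrite /series /= big_nat big1 // => k /andP[_ kN].
    by rewrite /u etacoefN_stable ?(ltnW kN) // mulN1r subrr mul0r.
  by rewrite subr0 mulrAC.
move=> e e0; have [N0 hN] := geo_small (K / (1 - t)) ht e0; exists N0 => n /hN.
exact: le_lt_trans.
Qed.

Definition theta (f : C -> C) (z : C) : C := 'D_1 f z / tpi.

Definition sigmac (k n : nat) : C := (sigmaf k n)%:R.

Lemma sigmaf_le k n : (sigmaf k n <= n ^ k * n.+1)%N.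
Proof.
rewrite /sigmaf; apply: (@leq_trans (\sum_(d < n.+1) n ^ k)%N); last by rewrite sum_nat_const card_ord mulnC.
rewrite big_mkcond; apply: leq_sum => d _; case: ifP => // _.
by case: k => // k; rewrite leq_exp2r // -ltnS.
Qed.

Lemma PSR_sigmac k : PSR (sigmac k).
Proof.
apply: PSR_le (PSRD (PSR_pow k.+1) (PSR_pow k)) => n; rewrite /sigmac nm_nat.
by rewrite -!natrX -natrD nm_nat ler_nat (leq_trans (sigmaf_le k n)) // mulnS expnS addnC mulnC.
Qed.

Definition Sg (k : nat) (z : C) : C := psum (sigmac k) (qC z).

Definition E2 (z : C) : C := 1 - 24 * Sg 1 z.

Lemma isd_psum_qC a z : PSR a -> inH z ->
  isd (fun z => psum a (qC z)) z (tpi * psum (fun n => n%:R * a n) (qC z)).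
Proof.
move=> ha hz; have hq := nm_qC_lt1 hz.
apply: isd_eq (isd_comp (isd_qC z) (isd_psum ha hq)) _.
by rewrite (psum_natM ha hq); ring.
Qed.

Lemma isd_Sg k z : inH z ->
  isd (Sg k) z (tpi * psum (fun n => n%:R * sigmac k n) (qC z)).
Proof. exact: isd_psum_qC (PSR_sigmac k). Qed.

Lemma sigma_tail k z : inH z ->
  limn (series (fun n => (sigmaf k.+1 n.+1)%:R * qC z ^+ n.+1)) = Sg k.+1 z.
Proof.
move=> hz; have hq := nm_qC_lt1 hz; apply: limn_cs.
rewrite /Sg (psum_shift (PSR_sigmac _) hq) {1}/sigmac sigma0 add0r.
have := csZ (qC z) (psum_cs (PSR_sub (PSR_sigmac k.+1)) hq).
apply: cs_ext => n; rewrite /series /= big_distrr; apply: eq_bigr => i _ /=.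
by rewrite exprS mulrCA.
Qed.

Lemma E4E z : inH z -> E4 z = 1 + 240 * Sg 3 z.
Proof. by move=> hz; rewrite /E4 sigma_tail. Qed.

Lemma E6E z : inH z -> E6 z = 1 - 504 * Sg 5 z.
Proof. by move=> hz; rewrite /E6 sigma_tail. Qed.

Lemma etaE z : inH z -> Defs.eta z = eC (z / 24) * expC (psum etacoef (qC z)).
Proof. by move=> hz; rewrite /Defs.eta; congr (_ * _); apply: eta_prod; exact: nm_qC_lt1. Qed.

Lemma eta_neq0 z : inH z -> Defs.eta z != 0.
Proof. by move=> hz; rewrite etaE //; apply: mulf_neq0; [exact: eC_neq0|exact: expC_neq0]. Qed.

Lemma nb_H z f g : inH z -> (forall w, inH w -> f w = g w) -> nb z (fun w => f w = g w :> C).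
Proof. by move=> hz h; apply: nb_imp h (nb_inH hz). Qed.

(** Since [n * etacoef n] is minus the divisor sum of [n], the logarithmic derivative is
    [tpi E2 / 24]. *)
Lemma isd_eta z : inH z -> isd Defs.eta z (tpi / 24 * E2 z * Defs.eta z).
Proof.
move=> hz; apply: isd_loc (nb_H hz etaE) _; rewrite (etaE hz).
have d1 : isd (fun w => eC (w / 24)) z (tpi / 24 * eC (z / 24)).
  have -> : (fun w => eC (w / 24)) = (fun w => eC (24^-1 * w)) by apply: funext => w; rewrite mulrC.
  by rewrite [z / 24]mulrC; exact: isd_eC.
have d2 := isd_comp (isd_psum_qC PSR_etacoef hz) (isd_expC _).
apply: isd_eq (isdM d1 d2) _; rewrite /E2 /Sg.
have -> : (fun n => n%:R * etacoef n) = (fun n => -1 * sigmac 1 n).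
  apply: funext => -[|n]; first by rewrite mul0r /sigmac sigma0 mulr0.
  rewrite /etacoef mulrN mulN1r mulrCA mulfV ?mulr1 // pnatr_eq0.
rewrite (psumZ _ (PSR_sigmac 1) (nm_qC_lt1 hz)).
by field.
Qed.

Lemma PfunE z : inH z -> Defs.Pfun z = - (E2 z / 12).
Proof.
move=> hz; rewrite /Defs.Pfun (isd_derive (isd_eta hz)) mulfK ?eta_neq0 //.
rewrite /tpi RCM (_ : RC 2 = 2); last exact: RCn.
have p0 : RC pi != 0 by rewrite RC_eq0 pi_neq0.
have -> : iC / RC pi * (2 * RC pi * iC / 24 * E2 z) = (iC * iC) * (2 / 24 * E2 z) by field.
by rewrite iC2; field.
Qed.

Lemma theta_Sg k z : inH z -> theta (Sg k) z = psum (fun n => n%:R * sigmac k n) (qC z).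
Proof. by move=> hz; rewrite /theta (isd_derive (isd_Sg k hz)) mulrC mulKf ?tpi_neq0. Qed.

(** The identity [sigma11], read as an equation between power series in [q]. *)
Lemma conv11 z : inH z -> 12 * Sg 1 z ^+ 2 = 5 * Sg 3 z + Sg 1 z - 6 * theta (Sg 1) z.
Proof.
move=> hz; have hq := nm_qC_lt1 hz; have h k := PSR_sigmac k.
rewrite theta_Sg // /Sg expr2 -(psum_conv (h 1%N) (h 1%N) hq) -mulNr.
have hn := PSR_natM (h 1%N).
rewrite -(psumZ _ (PSR_conv (h 1%N) (h 1%N)) hq) -(psumZ _ (h 3%N) hq) -(psumZ _ hn hq).
rewrite -(psumD (PSRZ _ (h 3%N)) (h 1%N) hq) -psumD //; last exact: PSRZ hn.
  apply: (congr1 (fun a => psum a (qC z))); apply: funext => n; by rewrite /conv sigma11 /sigmac mulNr mulrA.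
exact: PSRD (PSRZ _ (h 3%N)) (h 1%N).
Qed.

Lemma conv13 z : inH z ->
  240 * (Sg 1 z * Sg 3 z) = 21 * Sg 5 z + 10 * Sg 3 z - Sg 1 z - 30 * theta (Sg 3) z.
Proof.
move=> hz; have hq := nm_qC_lt1 hz; have h k := PSR_sigmac k.
rewrite theta_Sg // /Sg -(psum_conv (h 1%N) (h 3%N) hq) -[- psum (sigmac 1) _]mulN1r -mulNr.
have hn := PSR_natM (h 3%N).
rewrite -(psumZ _ (PSR_conv (h 1%N) (h 3%N)) hq) -(psumZ _ (h 5%N) hq) -(psumZ _ (h 3%N) hq).
rewrite -(psumZ _ (h 1%N) hq) -(psumZ _ hn hq).
have p1 := PSRD (PSRZ 21 (h 5%N)) (PSRZ 10 (h 3%N)).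
have p2 := PSRD p1 (PSRZ (-1) (h 1%N)).
rewrite -(psumD (PSRZ _ (h 5%N)) (PSRZ _ (h 3%N)) hq) -(psumD p1 (PSRZ _ (h 1%N)) hq).
rewrite -(psumD p2 (PSRZ _ hn) hq).
apply: (congr1 (fun a => psum a (qC z))); apply: funext => n; rewrite /conv sigma13 /sigmac.
by rewrite mulN1r [-30 * _]mulNr mulrA.
Qed.

Lemma isd_E2 z : inH z -> isd E2 z (tpi * ((E2 z ^+ 2 - E4 z) / 12)).
Proof.
move=> hz; apply: isd_eq (isdB (isd_cst 1 z) (isdZ 24 (isd_Sg 1 hz))) _.
rewrite E4E // -theta_Sg // /E2; have := conv11 hz => e.
have -> : theta (Sg 1) z = (5 * Sg 3 z + Sg 1 z - 12 * Sg 1 z ^+ 2) / 6 by rewrite e; field.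
by field.
Qed.

Lemma isd_E4 z : inH z -> isd E4 z (tpi * ((E2 z * E4 z - E6 z) / 3)).
Proof.
move=> hz; apply: isd_loc (nb_H hz E4E) _.
apply: isd_eq (isdD (isd_cst 1 z) (isdZ 240 (isd_Sg 3 hz))) _.
rewrite E4E // E6E // -theta_Sg // /E2; have := conv13 hz => e.
have -> : theta (Sg 3) z = (21 * Sg 5 z + 10 * Sg 3 z - Sg 1 z - 240 * (Sg 1 z * Sg 3 z)) / 30.
  by rewrite e; field.
by field.
Qed.

Lemma isd_E6 z : inH z -> exists l, isd E6 z l.
Proof.
move=> hz; exists (0 - 504 * (tpi * psum (fun n => n%:R * sigmac 5 n) (qC z))).
apply: isd_loc (nb_H hz E6E) _.
exact: isdB (isd_cst 1 z) (isdZ 504 (isd_Sg 5 hz)).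
Qed.

Lemma psum_qC_bound a : PSR a -> exists2 K : R, 0 <= K &
  exists Y : R, forall z, Y < ImC z -> nm (psum a (qC z) - a 0%N) <= K * nm (qC z).
Proof.
move=> ha; have [K K0 hK] := psum_near0 ha; exists K => //.
have [|Y hY] := qC_small (e := 1 / 2); first by [].
by exists Y => z /hY /ltW /hK.
Qed.

(** * Wronskian of the solutions *)

Lemma isd_prod n (f : 'I_n -> C -> C) z (a : 'I_n -> C) : (forall i, isd (f i) z (a i)) ->
  isd (fun w => \prod_i f i w) z (\sum_i a i * \prod_(j | j != i) f j z).
Proof.
elim: n f a => [|n IH] f a h.
  rewrite [X in isd _ _ X]big_ord0.
  have -> : (fun w => \prod_(i < 0) f i w) = (fun=> 1) by apply: funext => w; rewrite big_ord0.
  exact: isd_cst.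
have -> : (fun w => \prod_i f i w) = (fun w => f ord0 w * \prod_(i < n) f (lift ord0 i) w).
  by apply: funext => w; rewrite big_ord_recl.
apply: isd_eq (isdM (h ord0) (IH _ _ (fun i => h (lift ord0 i)))) _.
rewrite [RHS]big_ord_recl; congr (a ord0 * _ + _).
  by rewrite [RHS]big_mkcond [RHS]big_ord_recl /= mul1r; apply: eq_bigr.
rewrite big_distrr; apply: eq_bigr => i _ /=; rewrite mulrCA; congr (_ * _).
by rewrite [RHS]big_mkcond [RHS]big_ord_recl /= [in LHS]big_mkcond.
Qed.

Lemma isd_det n (A : C -> 'M[C]_n) z (A' : 'M[C]_n) :
  (forall i j, isd (fun w => A w i j) z (A' i j)) ->
  isd (fun w => \det (A w)) z (\sum_i \sum_j A' i j * cofactor (A z) i j).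
Proof.
move=> h.
have e : (fun w => \det (A w)) =
    (fun w => \sum_(s : 'S_n) (-1) ^+ s * \prod_i A w i (s i)) by [].
have d (s : 'S_n) : isd (fun w => (-1) ^+ s * \prod_i A w i (s i)) z
     ((-1) ^+ s * (\sum_i A' i (s i) * \prod_(j | j != i) A z j (s j))).
  by apply: isdZ; apply: isd_prod => i.
rewrite e; apply: isd_eq (isd_sum (index_enum _) d) _.
under eq_bigr do rewrite big_distrr.
rewrite exchange_big; apply: eq_bigr => i _ /=.
(* [A z] with row [i] taken from [A']: its determinant is expanded along that row on one side and by
   the Leibniz formula on the other. *)
pose Ai := \matrix_(k, j) if k == i then A' i j else A z k j.
have -> : \sum_j A' i j * cofactor (A z) i j = \det Ai.
  rewrite (expand_det_row _ i); apply: eq_bigr => j _; rewrite mxE eqxx; congr (_ * _).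
  rewrite /cofactor; congr (_ * \det _); apply/matrixP => a b; rewrite !mxE.
  by rewrite eq_sym (negbTE (neq_lift _ _)).
apply: eq_bigr => s _; congr (_ * _); rewrite [RHS](bigD1 i) //= mxE eqxx; congr (_ * _).
by apply: eq_bigr => j ji; rewrite mxE (negbTE ji).
Qed.

(** Liouville's formula: the trace of a linear differential system governs the determinant of a
    matrix solution. *)
Lemma isd_det_mul n (A : C -> 'M[C]_n) z (B : 'M[C]_n) :
  (forall i j, isd (fun w => A w i j) z ((B *m A z) i j)) ->
  isd (fun w => \det (A w)) z (\tr B * \det (A z)).
Proof.
move=> h; apply: isd_eq (isd_det h) _.
transitivity (\tr (B *m A z *m \adj (A z))).
  by apply: eq_bigr => i _; rewrite [RHS]mxE; apply: eq_bigr => j _; rewrite [\adj _ _ _]mxE.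
by rewrite -mulmxA mul_mx_adj mul_mx_scalar mxtraceZ mulrC.
Qed.

Lemma isd_theta f z : holC f -> inH z -> isd f z (tpi * theta f z).
Proof. by move=> hf hz; apply: isd_eq (holC_isd hf hz) _; rewrite /theta mulrC divfK ?tpi_neq0. Qed.

Lemma thetaP f z l : isd f z l -> theta f z = l / tpi.
Proof. by move=> /isd_derive; rewrite /theta => ->. Qed.

Lemma theta_tpi f z l : isd f z (tpi * l) -> theta f z = l.
Proof. by move/thetaP ->; rewrite mulrC mulKf ?tpi_neq0. Qed.

Lemma holC_eq f g : (forall z, inH z -> f z = g z) -> holC g -> holC f.
Proof. by move=> e hg z hz; have [l hl] := hg z hz; exists l; apply: isd_loc hl; apply: nb_H. Qed.

Lemma theta_eq f g z : holC g -> inH z -> (forall w, inH w -> f w = g w) -> theta f z = theta g z.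
Proof.
by move=> hg hz e; apply: theta_tpi; apply: isd_loc (isd_theta hg hz); apply: nb_H.
Qed.

Lemma holC_theta f : holC f -> holC (theta f).
Proof.
move=> hf z hz; have [l hl] := holC_der hf hz; exists (tpi^-1 * l).
by apply: isd_loc (isdZ _ hl); apply: nb_true => w; rewrite /theta mulrC.
Qed.

Lemma holC_cst a : holC (fun=> a).
Proof. by move=> z _; exists 0; exact: isd_cst. Qed.

Lemma holCD f g : holC f -> holC g -> holC (fun z => f z + g z).
Proof. by move=> hf hg z hz; have [a ha] := hf z hz; have [b hb] := hg z hz; exists (a + b); exact: isdD. Qed.

Lemma holCM f g : holC f -> holC g -> holC (fun z => f z * g z).
Proof.
by move=> hf hg z hz; have [a ha] := hf z hz; have [b hb] := hg z hz; eexists; exact: isdM ha hb.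
Qed.

Lemma holCZ a f : holC f -> holC (fun z => a * f z).
Proof. exact: holCM (holC_cst a). Qed.

Lemma holCB f g : holC f -> holC g -> holC (fun z => f z - g z).
Proof. by move=> hf hg z hz; have [a ha] := hf z hz; have [b hb] := hg z hz; exists (a - b); exact: isdB. Qed.

Lemma holCX f n : holC f -> holC (fun z => f z ^+ n).
Proof. by move=> hf z hz; have [a ha] := hf z hz; eexists; exact: isdX ha. Qed.

Lemma holC_sum (I : Type) (s : seq I) (f : I -> C -> C) :
  (forall i, holC (f i)) -> holC (fun z => \sum_(i <- s) f i z).
Proof.
move=> hf; elim: s => [|i s IH].
  by apply: holC_eq (holC_cst 0) => z _; rewrite big_nil.
by apply: holC_eq (holCD (hf i) IH) => z _; rewrite big_cons.
Qed.

Lemma holC_div f g : holC f -> holC g -> (forall z, inH z -> g z != 0) -> holC (fun z => f z / g z).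
Proof.
move=> hf hg h z hz; have [a ha] := hf z hz; have [b hb] := hg z hz; eexists.
exact: isd_div ha hb (h z hz).
Qed.

Lemma holC_E2 : holC E2.
Proof. by move=> z hz; eexists; exact: isd_E2. Qed.

Lemma holC_E4 : holC E4.
Proof. by move=> z hz; eexists; exact: isd_E4. Qed.

Lemma holC_E6 : holC E6.
Proof. by move=> z hz; exact: isd_E6. Qed.

Lemma holC_P : holC Defs.Pfun.
Proof.
apply: holC_eq (holCZ (- 12^-1) holC_E2) => z hz.
by rewrite PfunE // mulNr mulrC.
Qed.

(* [Dg Q] is the iterated derivative of the paper with an arbitrary function [Q] in place
   of [P]; for [Q = P] it agrees with [Dn] on the upper half-plane. *)
Fixpoint Dg (Q : C -> C) (n : nat) (k : R) (f : C -> C) : C -> C :=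
  if n is n'.+1 then
    fun z => theta (Dg Q n' k f) z + RC (k + 2 * n'%:R) * Q z * Dg Q n' k f z
  else f.

Lemma holC_Dg Q n k f : holC Q -> holC f -> holC (Dg Q n k f).
Proof.
move=> hQ hf; elim: n => [//|n IH] /=.
exact: holCD (holC_theta IH) (holCM (holCZ _ hQ) IH).
Qed.

Lemma isd_Dg Q n k f z : holC Q -> holC f -> inH z ->
  isd (Dg Q n k f) z (tpi * (Dg Q n.+1 k f z - RC (k + 2 * n%:R) * Q z * Dg Q n k f z)).
Proof. by move=> hQ hf hz; rewrite /= addrK; apply: isd_theta => //; exact: holC_Dg. Qed.

Lemma DnE n k f z : holC f -> inH z -> Dn n k f z = Dg Defs.Pfun n k f z.
Proof.
move=> hf; elim: n z => [//|n IH] z hz /=.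
rewrite /Dk hz IH // -(theta_eq (holC_Dg n k holC_P hf) hz IH) /theta.
by rewrite [_ / tpi]mulrC.
Qed.

Lemma Dn_off n k f z : (forall w, ~~ inH w -> f w = 0) -> ~~ inH z -> Dn n k f z = 0.
Proof. by move=> h hz; case: n => [|n] /=; [exact: h|rewrite /Dk (negbTE hz)]. Qed.

(** The leading coefficient [c] is part of the predicate so that the effect of [D^n] on it can be
    followed. *)
Definition qseries (lam : R) (c : C) (f : C -> C) (a : nat -> C) : Prop :=
  [/\ PSR a, a 0%N = c & forall z, inH z -> f z = eC (RC lam * z) * psum a (qC z)].

Lemma qseries_holC lam c f a : qseries lam c f a -> holC f.
Proof.
move=> [ha _ e]; apply: holC_eq e _ => z hz.
by eexists; exact: isdM (isd_eC _ _) (isd_psum_qC ha hz).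
Qed.

Lemma qexp_qseries lam f : qexp_form lam f -> exists a, qseries lam 1 f a.
Proof.
move=> [b hb]; pose a n := if n is m.+1 then b m.+1 else 1 : C.
have cv z : inH z -> cs (series (fun n => a n * qC z ^+ n)) (f z / eC (RC lam * z)).
  move=> /hb /csP h.
  have [_ h'] := cs_shift (series (fun n => a n * qC z ^+ n)) (f z / eC (RC lam * z)) 1.
  apply: h'; have -> : f z / eC (RC lam * z) = 1 + (f z / eC (RC lam * z) - 1) by ring.
  apply: cs_ext (csD (cs_cst 1) h).
  by move=> n; rewrite /series /= addn1 big_nat_recl //= mulr1.
have ha : PSR a.
  (* Only nonzero [w] are values of [q]; at 0 the series is constant. *)
  apply: PSR_of_cvg => w hw; have [->|w0] := eqVneq w 0.
    exists (a 0%N) => e e0; exists 1%N => -[//|n] _.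
    rewrite /series /= big_nat_recl // big1 ?addr0 ?mulr1 ?subrr ?nm0 // => i _.
    by rewrite expr0n mulr0.
  by have [z hz <-] := qC_onto w0 hw; eexists; exact: cv.
exists a; split => // z hz.
by rewrite (psum_eq (cv z hz)) mulrC divfK // eC_neq0.
Qed.

Definition e2coef (n : nat) : C := if n is m.+1 then - 24 * sigmac 1 m.+1 else 1.

Lemma PSR_e2coef : PSR e2coef.
Proof.
apply: PSR_le (PSRD (PSR_cst 1) (PSRZ (-24) (PSR_sigmac 1))) => -[|n] /=.
  by rewrite /sigmac sigma0 mulr0 addr0.
by rewrite add0r.
Qed.

Lemma E2_psum z : inH z -> E2 z = psum e2coef (qC z).
Proof.
move=> hz; have hq := nm_qC_lt1 hz; rewrite /E2 -mulNr /Sg -(psumZ _ (PSR_sigmac 1) hq).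
rewrite -[X in X + _](psum_cst 1 (qC z)) -(psumD (PSR_cst 1) (PSRZ _ (PSR_sigmac 1)) hq).
congr (psum _ (qC z)); apply: funext => -[|n] /=; first by rewrite /sigmac sigma0 mulr0 addr0.
by rewrite add0r.
Qed.

(** The effect of [theta + k P] on the coefficients, by [P = - E2 / 12]. *)
Definition Dcoef (lam k : R) (a : nat -> C) (n : nat) : C :=
  RC lam * a n + (n%:R * a n + (- RC (k / 12)) * conv e2coef a n).

Lemma qseries_Dstep lam c f a k z : qseries lam c f a -> inH z ->
  theta f z + RC k * Defs.Pfun z * f z = eC (RC lam * z) * psum (Dcoef lam k a) (qC z).
Proof.
move=> [ha _ e] hz; have hq := nm_qC_lt1 hz.
have hc := PSR_conv PSR_e2coef ha; have hn := PSR_natM ha.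
rewrite (psumD (PSRZ _ ha) (PSRD hn (PSRZ _ hc)) hq) (psumD hn (PSRZ _ hc) hq) !psumZ //.
rewrite (psum_conv PSR_e2coef ha hq) -E2_psum // PfunE // (e z hz).
have -> : theta f z = eC (RC lam * z) * (RC lam * psum a (qC z) + psum (fun n => n%:R * a n) (qC z)).
  apply: theta_tpi; apply: isd_loc (nb_H hz e) _.
  by apply: isd_eq (isdM (isd_eC _ _) (isd_psum_qC ha hz)) _; ring.
by rewrite RCM RCV (_ : RC 12 = 12) ?RCn //; field.
Qed.

Lemma qseries_step lam c f g a k : qseries lam c f a ->
  (forall z, inH z -> g z = theta f z + RC k * Defs.Pfun z * f z) ->
  qseries lam (RC (lam - k / 12) * c) g (Dcoef lam k a).
Proof.
move=> h hg; have [ha a0 _] := h; split.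
- exact: PSRD (PSRZ _ ha) (PSRD (PSR_natM ha) (PSRZ _ (PSR_conv PSR_e2coef ha))).
- by rewrite /Dcoef /conv big_ord_recl big_ord0 /= a0 mul0r add0r addr0 mul1r RCB mulrBl mulNr.
- by move=> z hz; rewrite hg // (qseries_Dstep _ h hz).
Qed.

Fixpoint Dncoef (lam k : R) (n : nat) (a : nat -> C) : nat -> C :=
  if n is n'.+1 then Dcoef lam (k + 2 * n'%:R) (Dncoef lam k n' a) else a.

(** Its value at [lam] is the leading coefficient of [D^n] applied to [q ^ lam]. *)
Definition indpol (k : R) (n : nat) : {poly C} := \prod_(m < n) ('X - (RC ((k + 2 * m%:R) / 12))%:P).

Lemma qseries_Dg lam c f a k n : qseries lam c f a ->
  qseries lam ((indpol k n).[RC lam] * c) (Dg Defs.Pfun n k f) (Dncoef lam k n a).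
Proof.
move=> h; elim: n => [|n IH]; first by rewrite /indpol big_ord0 hornerE mul1r.
have := qseries_step (k := k + 2 * n%:R) (g := Dg Defs.Pfun n.+1 k f) IH (fun _ _ => erefl).
by congr qseries; rewrite /indpol big_ord_recr /= hornerM hornerXsubC RCB; ring.
Qed.

(** The first-order system for [f, D f, D^2 f, D^3 f]: one has [theta D^l f = D^(l+1) f - (k + 2 l)
    P D^l f], and the MLDE replaces [D^4 f]. The default of [nth] reflects the absence of a [D^3]
    term. *)
Definition ode_coef (k : R) (M4 M6 M8 : C -> C) (z : C) (l m : nat) : C :=
  (if (l == 3)%N then nth 0 [:: - M8 z; - M6 z; - M4 z] m else (m == l.+1)%:R) -
  (m == l)%:R * (RC (k + 2 * l%:R) * Defs.Pfun z).

Definition wronskian (k : R) (f : 'I_4 -> C -> C) (z : C) : 'M[C]_4 :=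
  \matrix_(l, i) Dg Defs.Pfun l k (f i) z.

Definition solves (k : R) (M4 M6 M8 : C -> C) (f : C -> C) : Prop := forall z, inH z ->
  Dg Defs.Pfun 4 k f z + M4 z * Dg Defs.Pfun 2 k f z + M6 z * Dg Defs.Pfun 1 k f z + M8 z * f z = 0.

Lemma wronskian_ode k M4 M6 M8 f z : (forall i, holC (f i)) ->
  (forall i, solves k M4 M6 M8 (f i)) -> inH z ->
  forall l i, isd (fun w => wronskian k f w l i) z
    (((tpi *: \matrix_(l, m) ode_coef k M4 M6 M8 z l m) *m wronskian k f z) l i).
Proof.
move=> hf hs hz l i.
have -> : (fun w => wronskian k f w l i) = Dg Defs.Pfun l k (f i) by apply: funext => w; rewrite mxE.
apply: isd_eq (isd_Dg l k holC_P (hf i) hz) _.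
rewrite -scalemxAl mxE; congr (_ * _); rewrite mxE !big_ord_recl big_ord0 !mxE.
case: l => [[|[|[|[|//]]]] hl]; rewrite /ode_coef.
- by rewrite /= ; ring.
- by rewrite /= ; ring.
- by rewrite /= ; ring.
have := hs i z hz; rewrite -[Dg Defs.Pfun (nat_of_ord (Ordinal hl)).+1 _ _ _]/(Dg Defs.Pfun 4 k (f i) z).
move: (Dg Defs.Pfun 4 k (f i) z) => d4 e.
rewrite (_ : d4 = - (M4 z * Dg Defs.Pfun 2 k (f i) z + M6 z * Dg Defs.Pfun 1 k (f i) z + M8 z * f i z)).
  by rewrite /=; ring.
by apply/eqP; rewrite -subr_eq0 opprK !addrA e.
Qed.

(** The MLDE contributes nothing to the diagonal, so the trace is [- (4 k + 12) P]. *)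
Lemma wronskian_det_ode k M4 M6 M8 f z : (forall i, holC (f i)) ->
  (forall i, solves k M4 M6 M8 (f i)) -> inH z ->
  isd (fun w => \det (wronskian k f w)) z
    (tpi * (RC ((4 * k + 12) / 12) * E2 z) * \det (wronskian k f z)).
Proof.
move=> hf hs hz; apply: isd_eq (isd_det_mul (wronskian_ode hf hs hz)) _.
congr (_ * _); rewrite mxtraceZ; congr (_ * _); rewrite /mxtrace !big_ord_recl big_ord0 !mxE.
rewrite /ode_coef /= /bump /= PfunE // !(RCD, RCM, RCV, RCn); by field.
Qed.

(** The power [eta ^ (24 s)] without choice of a branch, from the logarithm of the product; for
    [s = 1] it is the discriminant form. *)
Definition eta_pow (s : R) (z : C) : C := eC (RC s * z) * expC (24 * RC s * psum etacoef (qC z)).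

Lemma eta_pow_neq0 s z : eta_pow s z != 0.
Proof. by apply: mulf_neq0; [exact: eC_neq0|exact: expC_neq0]. Qed.

Lemma isd_eta_pow s z : inH z -> isd (eta_pow s) z (tpi * (RC s * E2 z) * eta_pow s z).
Proof.
move=> hz; have d := isd_comp (isdZ (24 * RC s) (isd_psum_qC PSR_etacoef hz)) (isd_expC _).
apply: isd_eq (isdM (isd_eC z (RC s)) d) _; rewrite /eta_pow /E2 /Sg.
have -> : (fun n => n%:R * etacoef n) = (fun n => -1 * sigmac 1 n).
  apply: funext => -[|n]; first by rewrite mul0r /sigmac sigma0 mulr0.
  by rewrite /etacoef mulrN mulN1r mulrCA mulfV ?mulr1 // pnatr_eq0.
by rewrite (psumZ _ (PSR_sigmac 1) (nm_qC_lt1 hz)); ring.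
Qed.

Lemma eta_pow_unique s (f : C -> C) :
  (forall z, inH z -> isd f z (tpi * (RC s * E2 z) * f z)) ->
  exists c, forall z, inH z -> f z = c * eta_pow s z.
Proof.
move=> hf; have h z : inH z -> isd (fun w => f w / eta_pow s w) z 0.
  move=> hz; apply: isd_eq (isd_div (hf z hz) (isd_eta_pow s hz) (eta_pow_neq0 s z)) _.
  by field; exact: eta_pow_neq0.
have hi : inH iC by rewrite /inH Imi.
exists (f iC / eta_pow s iC) => z hz.
by rewrite -(isd0_H h hi hz) divfK // eta_pow_neq0.
Qed.

(** Serves as the Wronskian matrix with [q ^ lam_i] removed from column [i]; in this form it makes
    sense at [q = 0]. *)
Definition series_mx (a : 'I_4 -> 'I_4 -> nat -> C) (w : C) : 'M[C]_4 :=
  \matrix_(l, i) psum (a l i) w.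

Lemma series_mx_det a w : (forall l i, PSR (a l i)) -> nm w < 1 ->
  exists l, isd (fun w => \det (series_mx a w)) w l.
Proof.
move=> ha hw; eexists; apply: isd_det => l i.
have -> : (fun w => series_mx a w l i) = psum (a l i) by apply: funext => u; rewrite mxE.
apply: isd_eq (isd_psum (ha l i) hw) _; pose d := \matrix_(l, i) psum (da (a l i)) w.
by transitivity (d l i); first by rewrite mxE.
Qed.

Lemma wronskian_series k lam f a z : (forall i, qseries (lam i) 1 (f i) (a i)) -> inH z ->
  wronskian k f z = series_mx (fun l i => Dncoef (lam i) k l (a i)) (qC z) *m
                    diag_mx (\row_i eC (RC (lam i) * z)).
Proof.
move=> h hz; apply/matrixP => l i; rewrite mul_mx_diag !mxE.
by have [_ _ ->] := qseries_Dg k l (h i); rewrite // mulrC.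
Qed.

Lemma size_indpol k n : size (indpol k n) = n.+1.
Proof. by rewrite /indpol size_prod_XsubC /index_enum -enumT size_enum_ord. Qed.

(** [indpol k l] is monic of degree [l], so the matrix is a unitriangular one times a Vandermonde
    matrix. *)
Lemma indpol_det k (lam : 'I_4 -> C) : injective lam ->
  \det (\matrix_(l < 4, i < 4) (indpol k l).[lam i]) != 0.
Proof.
move=> inj.
have -> : \matrix_(l < 4, i < 4) (indpol k l).[lam i] =
   (\matrix_(l < 4, m < 4) (indpol k l)`_m) *m Vandermonde 4 (\row_i lam i).
  apply/matrixP => l i; rewrite !mxE (@horner_coef_wide _ 4) ?size_indpol //.
  by apply: eq_bigr => m _; rewrite !mxE.
rewrite det_mulmx det_Vandermonde mulf_neq0 //.
  rewrite det_trig; last first.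
    apply/is_trig_mxP => l m lm; rewrite mxE nth_default // size_indpol //.
  apply/prodf_neq0 => l _; rewrite mxE.
  have : indpol k l \is monic by apply: monic_prod_XsubC.
  by rewrite monicE lead_coefE size_indpol /= => /eqP ->; exact: oner_neq0.
apply/prodf_neq0 => i _; apply/prodf_neq0 => j ij; rewrite !mxE subr_eq0.
by apply: contraTneq ij => /inj ->; rewrite ltnn.
Qed.

Lemma nm_small_dense (z : C) (d : R) : 0 < d -> exists w, [/\ nm (w - z) < d, w != z & nm (w - z) < 1].
Proof.
move=> d0; pose r := Num.min d 1 / 2.
have r0 : 0 < r by rewrite divr_gt0 // lt_min d0 ltr01.
have [rd r1] : r < d /\ r < 1.
  rewrite /r; have := ge_min d d 1; have := ge_min 1 d 1; rewrite !lexx orbT /=; lra.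
have e : nm (z + RC r - z) = r by rewrite addrC addKr nmRC gtr0_norm.
exists (z + RC r); split; rewrite ?e // -subr_eq0 -nm_eq0 e gt_eqF //.
Qed.

(** The equation for [k] makes the product of the [q ^ lam_i] cancel the power of [q] in [eta_pow].
    So [det W] is [c] times an exponential for nonzero [w], and at 0 by continuity, where
    [indpol_det] shows that [c] is not 0. *)
Lemma wronskian_unit k lam M4 M6 M8 f a : injective (fun i => RC (lam i)) ->
  (4 * k + 12) / 12 = \sum_i lam i ->
  (forall i, qseries (lam i) 1 (f i) (a i)) -> (forall i, solves k M4 M6 M8 (f i)) ->
  (forall w, nm w < 1 -> \det (series_mx (fun l i => Dncoef (lam i) k l (a i)) w) != 0) /\
  (forall z, inH z -> wronskian k f z \in unitmx).
Proof.
move=> inj ek h hs; set W := series_mx _.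
have hf i : holC (f i) := qseries_holC (h i).
have [c hc] := eta_pow_unique (fun z => wronskian_det_ode (z := z) hf hs).
have eW z : inH z -> \det (wronskian k f z) = eC (RC ((4 * k + 12) / 12) * z) * \det (W (qC z)).
  move=> hz; rewrite (wronskian_series k h hz) det_mulmx det_diag mulrC; congr (_ * _).
  rewrite ek; under eq_bigr do rewrite mxE.
  rewrite !big_ord_recl !big_ord0 mulr1 -!eCD addr0 !RCD; congr eC; ring.
have Wq w : nm w < 1 -> w != 0 -> \det (W w) = c * expC (24 * RC ((4 * k + 12) / 12) * psum etacoef w).
  move=> hw w0; have [z hz <-] := qC_onto w0 hw.
  apply: (mulfI (eC_neq0 (RC ((4 * k + 12) / 12) * z))).
  by rewrite -eW // hc // /eta_pow mulrCA.
have ha l i : PSR (Dncoef (lam i) k l (a i)) by have [] := qseries_Dg k l (h i).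
have n01 : nm 0 < 1 by rewrite nm0 ltr01.
have W0 : \det (W 0) = c * expC (24 * RC ((4 * k + 12) / 12) * psum etacoef 0).
  apply: (cts_dense_eq (f := fun w => \det (W w))
     (g := fun w => c * expC (24 * RC ((4 * k + 12) / 12) * psum etacoef w))).
  - by have [l hl] := series_mx_det ha n01; exact: isd_cts hl.
  - apply: (isd_cts (isdZ c (isd_comp (isdZ _ (isd_psum PSR_etacoef n01)) (isd_expC _)))).
  - move=> d d0; have [w [wd w0 w1]] := nm_small_dense 0 d0; exists w; split => //.
    by rewrite Wq // -[w]subr0.
have c0 : c != 0.
  have : \det (W 0) != 0.
    have -> : W 0 = \matrix_(l < 4, i < 4) (indpol k l).[RC (lam i)].
      apply/matrixP => l i; rewrite !mxE psum0; last exact: ha.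
      by have [_ -> _] := qseries_Dg k l (h i); rewrite mulr1.
    exact: indpol_det.
  by rewrite W0; apply: contraNneq => ->; rewrite mul0r.
have hW w : nm w < 1 -> \det (W w) != 0.
  move=> hw; have [->|w0] := eqVneq w 0; rewrite ?W0 ?Wq // mulf_neq0 //; exact: expC_neq0.
split=> // z hz; rewrite unitmxE unitfE eW //; apply: mulf_neq0; first exact: eC_neq0.
exact/hW/nm_qC_lt1.
Qed.

(** * Transformation of [E2], [E4] and [E6] *)

Definition jz (g : 'M[int]_2) (z : C) : C := gc g * z + gd g.

Lemma det22 (g : 'M[int]_2) : inSL g -> ga g * gd g - gb g * gc g = 1.
Proof.
rewrite /inSL (expand_det_row _ ord0) !big_ord_recl big_ord0 /cofactor /= !det_mx11 !mxE /= => e.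
have -> : (1 : C) = 1%:~R by []; rewrite -e /ga /gb /gc /gd.
rewrite addr0 expr0 expr1 mul1r mulN1r mulrN rmorphB !rmorphM /=; congr (_ * _ - _ * _); congr (_%:~R).
all: by congr (g _ _); apply/val_inj.
Qed.

Lemma gzE (n : int) : n%:~R = RC n%:~R.
Proof. by rewrite RCz. Qed.

Lemma Im_jz g z : ImC (jz g z) = (g i1 i0)%:~R * ImC z.
Proof. by rewrite /jz /gc /gd !gzE !ReImE; ring. Qed.

Lemma gc_neq0 g : (gc g == 0) = (g i1 i0 == 0).
Proof. by rewrite /gc intr_eq0. Qed.

Lemma jz_neq0 g z : inSL g -> inH z -> jz g z != 0.
Proof.
move=> hg hz; have [c0|c0] := eqVneq (g i1 i0) 0.
  have := det22 hg; rewrite /jz /gc c0 mul0r mulr0 add0r subr0 => e.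
  by apply: contraTneq isT => d0; move: e; rewrite d0 mulr0 => /esym/eqP; rewrite oner_eq0.
have : ImC (jz g z) != 0 by rewrite Im_jz mulf_neq0 // ?intr_eq0 // gt_eqF.
by apply: contraNneq => ->; rewrite Im0.
Qed.

Lemma isd_jz g z : isd (jz g) z (gc g).
Proof.
by apply: isd_eq (isdD (isdZ (gc g) (isd_id z)) (isd_cst (gd g) z)) _; rewrite mulr1 addr0.
Qed.

Lemma isd_mob g z : inSL g -> inH z -> isd (mob g) z (jz g z ^- 2).
Proof.
move=> hg hz; have j0 := jz_neq0 hg hz.
have d := isdD (isdZ (ga g) (isd_id z)) (isd_cst (gb g) z).
apply: isd_eq (isd_div d (isd_jz g z) j0) _; rewrite mulr1 addr0.
by rewrite -[RHS]mul1r -(det22 hg) /jz; congr (_ / _); ring.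
Qed.

Lemma mob_inH g z : inSL g -> inH z -> inH (mob g z).
Proof.
move=> hg hz; have j0 := jz_neq0 hg hz; have e := det22 hg.
have [c0|c0] := eqVneq (g i1 i0) 0.
  have c1 : gc g = 0 by rewrite /gc c0.
  have d0 : gd g != 0 by move: j0; rewrite /jz c1 mul0r add0r.
  have -> : mob g z = ga g ^+ 2 * z + ga g * gb g.
    have ei : ga g = (gd g)^-1 by move: e; rewrite c1 mulr0 subr0 => /(canRL (mulfK d0)); rewrite mul1r.
    by rewrite /mob c1 mul0r add0r ei; field.
  have a0 : (g i0 i0)%:~R != 0 :> R.
    apply/eqP => a0; move: e; rewrite c1 mulr0 subr0 /ga gzE a0 RC0 mul0r => /esym/eqP.
    by rewrite oner_eq0.
  rewrite /inH /ga /gb !gzE -RCX -RCM !ReImE mul0r !addr0.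
  by rewrite mulr_gt0 // exprn_even_gt0 //= a0.
have c1 : gc g != 0 by rewrite gc_neq0.
(* The imaginary part comes from the second term alone, and [c (c z + d)] has imaginary part
   [c^2 Im z]. *)
have -> : mob g z = ga g / gc g - (gc g * jz g z)^-1.
  have -> : (gc g * jz g z)^-1 = (ga g * gd g - gb g * gc g) / (gc g * jz g z) by rewrite e mul1r.
  by rewrite /mob -/(jz g z); move: j0; rewrite /jz => j0; field; rewrite c1 j0.
have p : 0 < ImC (gc g * jz g z).
  rewrite ImM Im_jz /gc gzE ReRC ImRC mul0r addr0 mulrA -expr2 mulr_gt0 //.
  by rewrite exprn_even_gt0 //= intr_eq0.
rewrite /inH ImD ImN ImV mulNr opprK.
have -> : ImC (ga g / gc g) = 0 by rewrite /ga /gc !gzE -RCV -RCM ImRC.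
rewrite add0r divr_gt0 // exprn_gt0 // nm_gt0.
by apply: contraTneq p => ->; rewrite Im0 ltxx.
Qed.

Lemma theta_mob g f h z l : inSL g -> inH z -> holC f ->
  (forall w, inH w -> f (mob g w) = h w) -> isd h z (tpi * l) ->
  theta f (mob g z) = jz g z ^+ 2 * l.
Proof.
move=> hg hz hf e dh; have j0 := jz_neq0 hg hz.
have d1 := isd_comp (isd_mob hg hz) (isd_theta hf (mob_inH hg hz)).
have := isd_unique (isd_loc (nb_H hz (fun w hw => esym (e w hw))) d1) dh.
rewrite -mulrA => /(mulfI tpi_neq0) <-; by field.
Qed.

(** [P] pulled back by [g]; the second term accounts for the derivative of the automorphy factor.
    The equality [Pt g = P] is the quasimodularity of [E2]. *)
Definition Pt (g : 'M[int]_2) (z : C) : C :=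
  Defs.Pfun (mob g z) / jz g z ^+ 2 + gc g / (tpi * jz g z).

Lemma holC_mob g f : inSL g -> holC f -> holC (fun z => f (mob g z)).
Proof.
move=> hg hf z hz; eexists; exact: isd_comp (isd_mob hg hz) (isd_theta hf (mob_inH hg hz)).
Qed.

Lemma holC_jz g : holC (jz g).
Proof. by move=> z _; eexists; exact: isd_jz. Qed.

Lemma holC_Pt g : inSL g -> holC (Pt g).
Proof.
move=> hg; apply: holCD.
  apply: holC_div (holC_mob hg holC_P) (holCX 2 (@holC_jz g)) _ => z hz.
  by rewrite expf_neq0 // jz_neq0.
apply: holC_div (holC_cst _) (holCZ _ (@holC_jz g)) _ => z hz.
by rewrite mulf_neq0 ?tpi_neq0 ?jz_neq0.
Qed.

(** Differentiating [jz ^ (2 n) * j] produces the factor [(k + 2 n) c / jz], which the second term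
    of [Pt g] absorbs. The rule is therefore available before any transformation law of [P] is
    known. *)
Lemma Dg_mob g n k f G j : inSL g -> holC f -> holC G ->
  (forall z, inH z -> f (mob g z) = j z * G z) ->
  (forall z, inH z -> isd j z (RC k * gc g / jz g z * j z)) ->
  forall z, inH z -> Dg Defs.Pfun n k f (mob g z) = jz g z ^+ (2 * n) * j z * Dg (Pt g) n k G z.
Proof.
move=> hg hf hG e dj; elim: n => [|n IH] z hz; first by rewrite /= mul1r e.
have j0 := jz_neq0 hg hz.
have hD := holC_Dg n k (holC_Pt hg) hG.
have dh := isdM (isdM (isdX (2 * n) (isd_jz g z)) (dj z hz)) (isd_theta hD hz).
rewrite [LHS]/= IH //.
pose l := jz g z ^+ (2 * n) * j z * (theta (Dg (Pt g) n k G) z +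
   RC (k + 2 * n%:R) * gc g / (tpi * jz g z) * Dg (Pt g) n k G z).
rewrite (theta_mob (l := l) hg hz (holC_Dg n k holC_P hf) IH).
  by rewrite /= mulnSr exprD /l /Pt; field; rewrite j0 tpi_neq0.
apply: isd_eq dh _; rewrite /l.
have -> : (2 * n)%:R * jz g z ^+ (2 * n).-1 * gc g = (2 * n)%:R * gc g / jz g z * jz g z ^+ (2 * n).
  case: n {IH hD l} => [|n]; first by rewrite !mul0r.
  have -> : (2 * n.+1 = (2 * n).+2)%N by lia.
  by rewrite [_.-1]/= [in RHS]exprS; set N := _%:R; field.
by rewrite RCD RCM !RCn natrM; field; rewrite j0 tpi_neq0.
Qed.

(** If [c = 0] the base is a real constant, possibly on the cut of the logarithm; otherwise it is
    never real on H. *)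
Lemma isd_cpow_jz g k z : inSL g -> inH z ->
  isd (fun z => cpow (jz g z) k) z (RC k * gc g / jz g z * cpow (jz g z) k).
Proof.
move=> hg hz; have [c0|c0] := eqVneq (g i1 i0) 0.
  have c1 : gc g = 0 by rewrite /gc c0.
  have -> : (fun z => cpow (jz g z) k) = (fun=> cpow (gd g) k).
    by apply: funext => w; rewrite /jz c1 mul0r add0r.
  by rewrite c1 mulr0 mul0r mul0r; exact: isd_cst.
have i0' : ImC (jz g z) != 0 by rewrite Im_jz mulf_neq0 ?intr_eq0 // gt_eqF.
by apply: isd_eq (isd_comp (isd_jz g z) (isd_cpow k i0')) _; ring.
Qed.

(* [cfn Q Qt k n l] is the coefficient of [Dg Q l k] in the expansion of [Dg Qt n k]. *)
Fixpoint cfn (Q Qt : C -> C) (k : R) (n : nat) : nat -> C -> C :=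
  if n is n'.+1 then fun l z =>
    theta (cfn Q Qt k n' l) z + (if l is l'.+1 then cfn Q Qt k n' l' z else 0) +
    (RC (k + 2 * n'%:R) * Qt z - RC (k + 2 * l%:R) * Q z) * cfn Q Qt k n' l z
  else fun l _ => (l == 0%N)%:R.

Lemma holC_cfn Q Qt k n l : holC Q -> holC Qt -> holC (cfn Q Qt k n l).
Proof.
move=> hQ hQt; elim: n l => [|n IH] l /=; first exact: holC_cst.
apply: holCD (holCD (holC_theta (IH l)) _) (holCM (holCB (holCZ _ hQt) (holCZ _ hQ)) (IH l)).
by case: l => [|l]; [exact: holC_cst|exact: IH].
Qed.

Lemma theta_cst c f z : inH z -> (forall w, inH w -> f w = c) -> theta f z = 0.
Proof.
move=> hz e; apply: theta_tpi; rewrite mulr0; apply: isd_loc (isd_cst c z).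
exact: nb_H.
Qed.

Lemma cfn_gt Q Qt k n l z : (n < l)%N -> inH z -> cfn Q Qt k n l z = 0.
Proof.
elim: n l z => [|n IH] l z nl hz /=; first by case: l nl.
rewrite (@theta_cst 0) // => [|w hw]; last by rewrite IH // (ltn_trans _ nl).
by case: l nl => // l nl; rewrite !IH // ?mulr0 ?addr0 // (ltn_trans _ nl).
Qed.

Lemma cfn_diag Q Qt k n z : inH z -> cfn Q Qt k n n z = 1.
Proof.
elim: n z => [|n IH] z hz //=.
by rewrite (@theta_cst 0) // => [|w hw]; rewrite ?IH ?(cfn_gt _ _ _ _ hz) ?(cfn_gt _ _ _ _ hw) // mulr0 addr0 add0r.
Qed.

(** The leading coefficient is constantly 1, so the [m]-th step adds just [(k + 2 m) (Qt - Q)]. *)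
Lemma cfn_sub Q Qt k n z : inH z ->
  cfn Q Qt k n.+1 n z = (\sum_(m < n.+1) RC (k + 2 * m%:R)) * (Qt z - Q z).
Proof.
move=> hz; elim: n => [|n IH].
  rewrite big_ord_recl big_ord0 addr0 /= (@theta_cst 1) // mulr1; ring.
rewrite big_ord_recr mulrDl -IH [LHS]/=.
rewrite (@theta_cst 1) // => [|w hw]; last exact: (cfn_diag Q Qt k n.+1).
have := cfn_diag Q Qt k n.+1 hz => /= ->; ring.
Qed.

Lemma Dg_expand Q Qt k f n z : holC Q -> holC Qt -> holC f -> inH z ->
  Dg Qt n k f z = \sum_(l < n.+1) cfn Q Qt k n l z * Dg Q l k f z.
Proof.
move=> hQ hQt hf; elim: n z => [|n IH] z hz.
  by rewrite big_ord_recl big_ord0 /= mul1r addr0.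
pose c := cfn Q Qt k n.
have hc l : holC (c l) by exact: holC_cfn.
rewrite [LHS]/= (IH z hz).
have -> : theta (Dg Qt n k f) z = \sum_(l < n.+1) (theta (c l) z * Dg Q l k f z +
    c l z * (Dg Q l.+1 k f z - RC (k + 2 * l%:R) * Q z * Dg Q l k f z)).
  apply: theta_tpi; apply: isd_loc (nb_H hz IH) _.
  apply: isd_eq (isd_sum _ (fun l : 'I_n.+1 => isdM (isd_theta (hc l) hz) (isd_Dg l k hQ hf hz))) _.
  by rewrite big_distrr; apply: eq_bigr => l _ /=; ring.
have -> : \sum_(l < n.+2) cfn Q Qt k n.+1 l z * Dg Q l k f z =
   \sum_(l < n.+2) (theta (c l) z + (RC (k + 2 * n%:R) * Qt z - RC (k + 2 * l%:R) * Q z) * c l z) * Dg Q l k f z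
   + \sum_(l < n.+2) (if (l : nat) is l'.+1 then c l' z else 0) * Dg Q l k f z.
  rewrite -big_split; apply: eq_bigr => l _ /=; rewrite -/c.
  by case: (l : nat) => [|l']; ring.
rewrite [X in _ = X + _]big_ord_recr [X in _ = _ + X]big_ord_recl /= mul0r add0r.
rewrite (@theta_cst 0) // => [|w hw]; last exact: cfn_gt.
have -> : c n.+1 z = 0 by exact: cfn_gt.
rewrite mulr0 addr0 mul0r addr0 big_distrr -!big_split; apply: eq_bigr => l _ /=.
by rewrite -/(c l); ring.
Qed.

Lemma Dg_sum Q n k (I : Type) (s : seq I) (a : I -> C) (f : I -> C -> C) z :
  holC Q -> (forall i, holC (f i)) -> inH z ->
  Dg Q n k (fun z => \sum_(i <- s) a i * f i z) z = \sum_(i <- s) a i * Dg Q n k (f i) z.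
Proof.
move=> hQ hf; elim: n z => [//|n IH] z hz /=.
have -> : theta (Dg Q n k (fun z => \sum_(i <- s) a i * f i z)) z = \sum_(i <- s) a i * theta (Dg Q n k (f i)) z.
  apply: theta_tpi; apply: isd_loc (nb_H hz IH) _.
  apply: isd_eq (isd_sum _ (fun i => isdZ (a i) (isd_theta (holC_Dg n k hQ (hf i)) hz))) _.
  by rewrite big_distrr; apply: eq_bigr => l _ /=; ring.
rewrite IH // big_distrr -big_split; apply: eq_bigr => i _ /=; ring.
Qed.

Arguments cfn : simpl never.
Arguments Dg : simpl never.

(* The [f i] solve the MLDE for [P] and, by the transformation rule, another one with [P] replaced
   by [Pt g] and with the same leading term.  Since the Wronskian matrix is invertible, the
   coefficients of [D^3] agree, that is [(4 k + 12) (Pt g - P) = 0]. *)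
Lemma P_mob g k M4 M6 M8 (f : 'I_4 -> C -> C) (A : 'M[C]_4) j :
  inSL g -> 4 * k + 12 != 0 -> (forall i, holC (f i)) -> (forall i, solves k M4 M6 M8 (f i)) ->
  (forall z, inH z -> wronskian k f z \in unitmx) ->
  (forall z, inH z -> j z != 0) ->
  (forall z, inH z -> isd j z (RC k * gc g / jz g z * j z)) ->
  (forall z i, inH z -> f i (mob g z) = j z * \sum_m A i m * f m z) ->
  forall z, inH z -> Pt g z = Defs.Pfun z.
Proof.
move=> hg k0 hf hs hX j0 dj fj z hz; set P := Defs.Pfun.
have J0 := jz_neq0 hg hz; have hQ := holC_Pt hg.
have D_mob n i : Dg P n k (f i) (mob g z) =
    jz g z ^+ (2 * n) * j z * \sum_m A i m * Dg (Pt g) n k (f m) z.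
  rewrite -(Dg_sum n k _ (A i) hQ hf hz).
  apply: (Dg_mob n hg (hf i)) => //.
  - by apply: holC_sum => m; exact: holCZ.
  - by move=> w hw; exact: fj.
(* The transpose of [A] is a factor of the Wronskian matrix at [mob g z], which is invertible. *)
have Au : A \in unitmx.
  have : wronskian k f (mob g z) = (\matrix_(l, m) (jz g z ^+ (2 * l) * j z * Dg (Pt g) l k (f m) z)) *m A^T.
    apply/matrixP => l i; rewrite !mxE D_mob big_distrr; apply: eq_bigr => m _; rewrite !mxE /=; ring.
  move/(congr1 (fun M => M \in unitmx)); rewrite hX ?mob_inH //= => /esym.
  by rewrite unitmxE det_mulmx unitrM => /andP[_]; rewrite det_tr unitmxE.
pose N4 := M4 (mob g z) / jz g z ^+ 4; pose N6 := M6 (mob g z) / jz g z ^+ 6.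
pose N8 := M8 (mob g z) / jz g z ^+ 8.
pose u m := Dg (Pt g) 4 k (f m) z + N4 * Dg (Pt g) 2 k (f m) z + N6 * Dg (Pt g) 1 k (f m) z + N8 * f m z.
have u0 m : u m = 0.
  have : A *m \col_m u m = 0.
    apply/matrixP => i o; rewrite !mxE; apply: (mulfI (mulf_neq0 (expf_neq0 8 J0) (j0 z hz))).
    rewrite mulr0 -[RHS](hs i (mob g z) (mob_inH hg hz)) fj // !D_mob.
    rewrite !big_distrr -!big_split; apply: eq_bigr => p _; rewrite mxE /u /N4 /N6 /N8.
    move: (Dg _ 4 _ _ _) (Dg _ 2 _ _ _) (Dg _ 1 _ _ _) => x4 x2 x1 /=.
    by field; rewrite J0.
  move/(congr1 (mulmx (invmx A))); rewrite mulKmx // mulmx0 => /matrixP/(_ m ord0).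
  by rewrite !mxE.
pose c n l := cfn P (Pt g) k n l z.
(* The coefficient of [D^l f] in the difference of the two equations. At [l = 3] the default of
   [nth] says that the MLDE has no [D^3] term. *)
pose e (l : 'I_4) := c 4%N l + N4 * c 2%N l + N6 * c 1%N l + N8 * c 0%N l - nth 0 [:: M8 z; M6 z; M4 z] l.
have e0 : \row_l e l = 0.
  have : \row_l e l *m wronskian k f z = 0.
    apply/matrixP => o i; rewrite !mxE -[RHS](u0 i) /u !(Dg_expand k _ holC_P hQ (hf i) hz) -/P.
    have sh n : (n < 4)%N -> \sum_(l < n.+1) cfn P (Pt g) k n l z * Dg P l k (f i) z =
        \sum_(l < 4) c n l * Dg P l k (f i) z.
      move=> n4; rewrite (big_ord_widen 4 (fun l => cfn P (Pt g) k n l z * Dg P l k (f i) z)) // big_mkcond.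
      apply: eq_bigr => l _; case: ifP => // /negbT; rewrite -leqNgt => nl.
      by rewrite /c cfn_gt // mul0r.
    have f0 : f i z = \sum_(l < 4) c 0%N l * Dg P l k (f i) z.
      by rewrite -sh // big_ord_recl big_ord0 /= mul1r addr0.
    rewrite (sh 2%N) // (sh 1%N) // [in RHS]f0 [X in _ = X + _ + _ + _]big_ord_recr /= cfn_diag // mul1r.
    have := hs i z hz; rewrite -/P; set d4 := Dg P 4 k (f i) z => h4.
    have {}h4 : d4 = - \sum_(l < 4) nth 0 [:: M8 z; M6 z; M4 z] l * Dg P l k (f i) z.
      rewrite !big_ord_recl big_ord0 (_ : d4 = - (M4 z * Dg P 2 k (f i) z + M6 z * Dg P 1 k (f i) z + M8 z * f i z)).
        by rewrite -[f i z]/(Dg P 0 k (f i) z) /= /bump /=; ring.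
      by apply/eqP; rewrite -subr_eq0 opprK !addrA h4.
    rewrite h4 !big_distrr -sumrN -!big_split; apply: eq_bigr => l _.
    by rewrite !mxE /= /e /c; ring.
  by move/(congr1 (mulmxr (invmx (wronskian k f z)))); rewrite /= mulmxK ?hX // mul0mx.
have := congr1 (fun M : 'rV_4 => M ord0 ord_max) e0; rewrite !mxE /e /c /=.
have z0 n : (n < 3)%N -> cfn P (Pt g) k n 3 z = 0 by move=> n3; exact: cfn_gt.
rewrite (z0 2%N) // (z0 1%N) // (z0 0%N) // !mulr0 !addr0 subr0.
rewrite cfn_sub //.
move/eqP; rewrite mulf_eq0 subr_eq0 => /orP[|/eqP //].
rewrite !big_ord_recl big_ord0 addr0 -!RCD RC_eq0 => /eqP h; exfalso; move/eqP: k0; apply.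
by rewrite -[RHS]h /= /bump /=; ring.
Qed.

(** * Modular forms of level one *)

Lemma E2_mob g z : inSL g -> inH z -> Pt g z = Defs.Pfun z ->
  E2 (mob g z) = jz g z ^+ 2 * E2 z + 12 * gc g * jz g z / tpi.
Proof.
move=> hg hz; have j0 := jz_neq0 hg hz; rewrite /Pt !PfunE ?mob_inH // => e.
have -> : E2 z = - 12 * (- (E2 z / 12)) by field.
by rewrite -e; field; rewrite j0 tpi_neq0.
Qed.

Lemma theta_E2 z : inH z -> theta E2 z = (E2 z ^+ 2 - E4 z) / 12.
Proof. by move=> hz; exact/theta_tpi/isd_E2. Qed.

Lemma theta_E4 z : inH z -> theta E4 z = (E2 z * E4 z - E6 z) / 3.
Proof. by move=> hz; exact/theta_tpi/isd_E4. Qed.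

(** Differentiate the law of [E2] and substitute it in [E4 = E2^2 - 12 theta E2]: the terms
    containing [c] cancel. *)
Lemma E4_mob g z : inSL g -> (forall z, inH z -> Pt g z = Defs.Pfun z) -> inH z ->
  E4 (mob g z) = jz g z ^+ 4 * E4 z.
Proof.
move=> hg hP hz; have j0 := jz_neq0 hg hz; have hm := mob_inH hg hz.
have e w : inH w -> E2 (mob g w) = jz g w ^+ 2 * E2 w + 12 * gc g / tpi * jz g w.
  by move=> hw; rewrite (E2_mob hg hw (hP w hw)); congr (_ + _); rewrite mulrAC.
have d := isdD (isdM (isdX 2 (isd_jz g z)) (isd_E2 hz)) (isdZ (12 * gc g / tpi) (isd_jz g z)).
pose l := 2 * jz g z * gc g * E2 z / tpi + jz g z ^+ 2 * ((E2 z ^+ 2 - E4 z) / 12) + 12 * gc g ^+ 2 / tpi ^+ 2.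
have := theta_mob (l := l) hg hz holC_E2 e.
rewrite theta_E2 // e // => h.
have {}h : E4 (mob g z) = (jz g z ^+ 2 * E2 z + 12 * gc g / tpi * jz g z) ^+ 2 - 12 * (jz g z ^+ 2 * l).
  by rewrite -h; [field; rewrite tpi_neq0|apply: isd_eq d _; rewrite /l /=; field; rewrite tpi_neq0].
by rewrite h /l; field; rewrite tpi_neq0.
Qed.

Lemma E6_mob g z : inSL g -> (forall z, inH z -> Pt g z = Defs.Pfun z) -> inH z ->
  E6 (mob g z) = jz g z ^+ 6 * E6 z.
Proof.
move=> hg hP hz; have j0 := jz_neq0 hg hz; have hm := mob_inH hg hz.
have e w : inH w -> E4 (mob g w) = jz g w ^+ 4 * E4 w by move=> hw; exact: E4_mob.
have d := isdM (isdX 4 (isd_jz g z)) (isd_E4 hz).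
pose l := 4 * jz g z ^+ 3 * gc g * E4 z / tpi + jz g z ^+ 4 * ((E2 z * E4 z - E6 z) / 3).
have := theta_mob (l := l) hg hz holC_E4 e.
rewrite theta_E4 // e // E2_mob // ?hP // => h.
have {}h : E6 (mob g z) = (jz g z ^+ 2 * E2 z + 12 * gc g * jz g z / tpi) * (jz g z ^+ 4 * E4 z)
    - 3 * (jz g z ^+ 2 * l).
  by rewrite -h; [field; rewrite tpi_neq0|apply: isd_eq d _; rewrite /l /=; field; rewrite tpi_neq0].
by rewrite h /l; field; rewrite tpi_neq0.
Qed.

(** The rate of convergence at the cusp is recorded because [qC z] is divided out later. *)
Definition limi (f : C -> C) (a : C) : Prop :=
  exists K Y : R, 0 <= K /\ forall z, Y < ImC z -> nm (f z - a) <= K * nm (qC z).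

Lemma nm_qC_le1 z : 0 < ImC z -> nm (qC z) <= 1.
Proof. by move=> hz; exact/ltW/nm_qC_lt1. Qed.

Lemma limi_bound f a : limi f a -> exists K Y : R, 0 <= K /\ forall z, Y < ImC z -> nm (f z) <= K.
Proof.
move=> [K [Y [K0 h]]]; exists (nm a + K), (Num.max Y 0); split; first by rewrite addr_ge0 ?nm_ge0.
move=> z; rewrite gt_max => /andP[hY hz].
have -> : f z = a + (f z - a) by rewrite addrC subrK.
apply: le_trans (nmD _ _) _; rewrite lerD2l (le_trans (h z hY)) // ler_piMr // nm_qC_le1 //.
Qed.

Lemma limi_eq f g a : (forall z, inH z -> f z = g z) -> limi g a -> limi f a.
Proof.
move=> e [K [Y [K0 h]]]; exists K, (Num.max Y 0); split=> // z.
by rewrite gt_max => /andP[hY hz]; rewrite e //; exact: h.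
Qed.

Lemma limi_cst a : limi (fun=> a) a.
Proof. by exists 0, 0; split=> // z _; rewrite subrr nm0 mul0r. Qed.

Lemma limi_q : limi qC 0.
Proof. by exists 1, 0; split=> // z _; rewrite subr0 mul1r. Qed.

Lemma limiD f g a b : limi f a -> limi g b -> limi (fun z => f z + g z) (a + b).
Proof.
move=> [K [Y [K0 h]]] [K' [Y' [K0' h']]]; exists (K + K'), (Num.max Y Y'); split; first exact: addr_ge0.
move=> z; rewrite gt_max => /andP[hY hY'].
have -> : f z + g z - (a + b) = (f z - a) + (g z - b) by ring.
by apply: le_trans (nmD _ _) _; rewrite mulrDl lerD ?h ?h'.
Qed.

Lemma limiM f g a b : limi f a -> limi g b -> limi (fun z => f z * g z) (a * b).
Proof.
move=> hf hg; have [B [Y1 [B0 hB]]] := limi_bound hf.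
have [K [Y [K0 h]]] := hf; have [K' [Y' [K0' h']]] := hg.
exists (B * K' + nm b * K), (Num.max (Num.max Y Y') Y1); split.
  by rewrite addr_ge0 ?mulr_ge0 ?nm_ge0.
move=> z; rewrite !gt_max => /andP[/andP[hY hY'] hY1].
have -> : f z * g z - a * b = f z * (g z - b) + b * (f z - a) by ring.
apply: le_trans (nmD _ _) _; rewrite (nmM (f z)) (nmM b) mulrDl -!mulrA.
by apply: lerD; [apply: ler_pM; rewrite ?nm_ge0 ?hB ?h'|rewrite ler_wpM2l ?nm_ge0 ?h].
Qed.

Lemma limiZ c f a : limi f a -> limi (fun z => c * f z) (c * a).
Proof. exact: limiM (limi_cst c). Qed.

Lemma limiB f g a b : limi f a -> limi g b -> limi (fun z => f z - g z) (a - b).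
Proof.
move=> hf hg; have := limiD hf (limiZ (-1) hg); rewrite mulN1r.
by apply: limi_eq => z _; rewrite mulN1r.
Qed.

Lemma limiX f a n : limi f a -> limi (fun z => f z ^+ n) (a ^+ n).
Proof.
move=> hf; elim: n => [|n IH]; first exact: limi_cst.
by rewrite exprS; apply: limi_eq (limiM hf IH) => z _; rewrite exprS.
Qed.

Lemma limi_unique f a b : limi f a -> limi f b -> a = b.
Proof.
move=> hf hg; have [K [Y [K0 h]]] := limiB hf hg.
apply/eqP; rewrite -subr_eq0 -nm_eq0 eq_le nm_ge0 andbT leNgt; apply/negP => ab.
have [|Y' hY'] := qC_small (e := nm (a - b) / (K + 1)); first by rewrite divr_gt0 // ltr_wpDl.
pose z : C := 0 +i* (Num.max (Num.max Y Y') 0 + 1).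
have Iz : ImC z = Num.max (Num.max Y Y') 0 + 1 by rewrite ImE.
have [z1 z2] : Y < ImC z /\ Y' < ImC z.
  by rewrite Iz; split; apply: ltr_pwDr; rewrite ?ltr01 // !le_max lexx ?orbT.
have := h z z1; rewrite subrr sub0r nmN; apply/negP; rewrite -ltNge.
have := hY' z z2; rewrite ltr_pdivlMr ?ltr_wpDl // => /(le_lt_trans _); apply.
by rewrite mulrC ler_wpM2l ?nm_ge0 // lerDl ler01.
Qed.

Lemma limi_psum a : PSR a -> limi (fun z => psum a (qC z)) (a 0%N).
Proof. by move=> ha; have [K K0 [Y h]] := psum_qC_bound ha; exists K, Y. Qed.

Lemma limi_Sg k : limi (Sg k.+1) 0.
Proof. by have := limi_psum (PSR_sigmac k.+1); rewrite {2}/sigmac sigma0. Qed.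

Lemma limi_E4 : limi E4 1.
Proof.
apply: limi_eq E4E _; have := limiD (limi_cst 1) (limiZ 240 (limi_Sg 2)).
by rewrite mulr0 addr0.
Qed.

Lemma limi_E6 : limi E6 1.
Proof.
apply: limi_eq E6E _; have := limiB (limi_cst 1) (limiZ 504 (limi_Sg 4)).
by rewrite mulr0 subr0.
Qed.

(** Invariance is asked for the generators [T] and [S]; the weight is an integer of either sign
    because quotients by the discriminant form occur. *)
Definition mf (w : int) (f : C -> C) : Prop :=
  [/\ holC f, forall z, inH z -> f (z + 1) = f z,
      forall z, inH z -> f (- z^-1) = z ^ w * f z &
      exists K Y : R, forall z, Y < ImC z -> nm (f z) <= K].

Lemma inH_S z : inH z -> inH (- z^-1).
Proof.
rewrite /inH => hz; rewrite ImN ImV mulNr opprK divr_gt0 // exprn_gt0 // nm_gt0.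
by apply: contraTneq hz => ->; rewrite Im0 ltxx.
Qed.

Lemma inH_T z : inH (z + 1) = inH z.
Proof. by rewrite /inH ImD Im1 addr0. Qed.

Lemma inH_neq0 z : inH z -> z != 0.
Proof. by rewrite /inH; apply: contraTneq => ->; rewrite Im0 ltxx. Qed.

Lemma mf_eq w f g : (forall z, inH z -> f z = g z) -> mf w g -> mf w f.
Proof.
move=> e [g1 g2 g3 [K [Y g4]]]; split.
- exact: holC_eq e g1.
- by move=> z hz; rewrite !e ?inH_T // g2.
- by move=> z hz; rewrite !e ?inH_S // g3.
- exists K, (Num.max Y 0) => z; rewrite gt_max => /andP[hY hz]; rewrite e //; exact: g4.
Qed.

(** Extended by 0 off H, [f] is periodic everywhere, as [periodic_limit] demands; boundedness makes
    [q f] tend to 0. *)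
Lemma mf_lim w f : mf w f -> exists a, limi f a.
Proof.
move=> [f1 f2 _ [K [Y f4]]]; pose f' z := if inH z then f z else 0.
have [||e e0|a [K' [Y' [K0 h]]]] := @periodic_limit f' 0.
- move=> z hz; have [l hl] := f1 z hz; exists l; apply: isd_loc hl.
  by apply: nb_H => // w' hw; rewrite /f' hw.
- by move=> z; rewrite /f' inH_T; case: ifP => // hz; rewrite f2.
- have K1 : 0 < `|K| + 1 by rewrite ltr_wpDl.
  have [|Y1 h1] := qC_small (e := e / (`|K| + 1)); first by rewrite divr_gt0.
  exists (Num.max Y1 Y) => z; rewrite gt_max => /andP[z1 z2].
  have b : nm (f' z) <= `|K|.
    rewrite /f'; case: ifP => [_|_]; last by rewrite nm0.
    exact: le_trans (f4 z z2) (ler_norm K).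
  have := h1 z z1; rewrite ltr_pdivlMr // nmM => /(le_lt_trans _); apply.
  by rewrite ler_wpM2l ?nm_ge0 // (le_trans b) // lerDl ler01.
exists a, K', (Num.max Y' 0); split=> // z; rewrite gt_max => /andP[hz z0].
by have := h z hz; rewrite /f' /inH z0.
Qed.

Lemma mf_of_lim w f a : holC f -> (forall z, inH z -> f (z + 1) = f z) ->
  (forall z, inH z -> f (- z^-1) = z ^ w * f z) -> limi f a -> mf w f.
Proof.
by move=> f1 f2 f3 /limi_bound[K [Y [_ f4]]]; split=> //; exists K, Y.
Qed.

Lemma mf_zero f : mf 0 f -> limi f 0 -> forall z, inH z -> f z = 0.
Proof.
move=> [f1 f2 f3 _] [K [Y [K0 h]]]; apply: invariant_zero => //.
  by move=> z hz; rewrite f3 // expr0z mul1r.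
move=> e e0; have K1 : 0 < K + 1 by rewrite ltr_wpDl.
have [|Y1 h1] := qC_small (e := e / (K + 1)); first by rewrite divr_gt0.
exists (Num.max Y Y1) => z; rewrite gt_max => /andP[z1 z2].
have := h z z1; rewrite subr0 => /le_lt_trans; apply.
have := h1 z z2; rewrite ltr_pdivlMr // => /(le_lt_trans _); apply.
by rewrite mulrC ler_wpM2l ?nm_ge0 // lerDl ler01.
Qed.

Lemma mfM w w' f g : mf w f -> mf w' g -> mf (w + w') (fun z => f z * g z).
Proof.
move=> hf hg; have [a ha] := mf_lim hf; have [b hb] := mf_lim hg.
have [f1 f2 f3 _] := hf; have [g1 g2 g3 _] := hg.
apply: mf_of_lim (holCM f1 g1) _ _ (limiM ha hb) => z hz; first by rewrite f2 // g2.
by rewrite f3 // g3 // expfzDr ?inH_neq0 //; ring.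
Qed.

Lemma mfX w f n : mf w f -> mf (w * n%:Z) (fun z => f z ^+ n).
Proof.
move=> hf; elim: n => [|n IH].
  rewrite mulr0; apply: mf_of_lim (holC_cst 1) _ _ (limi_cst 1) => // z hz.
  by rewrite expr0z mul1r.
have -> : w * n.+1%:Z = w + w * n%:Z by rewrite -addn1 PoszD mulrDr mulr1 addrC.
by apply: mf_eq (mfM hf IH) => z _; rewrite exprS.
Qed.

Lemma mf_lin w c f g : mf w f -> mf w g -> mf w (fun z => f z - c * g z).
Proof.
move=> hf hg; have [a ha] := mf_lim hf; have [b hb] := mf_lim hg.
have [f1 f2 f3 _] := hf; have [g1 g2 g3 _] := hg.
apply: mf_of_lim (holCB f1 (holCZ c g1)) _ _ (limiB ha (limiZ c hb)) => z hz; first by rewrite f2 // g2.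
by rewrite f3 // g3 //; ring.
Qed.

(** * The discriminant form *)

Definition Dl : C -> C := eta_pow 1.

Lemma holC_Dl : holC Dl.
Proof. by move=> z hz; eexists; exact: isd_eta_pow. Qed.

Lemma DlE z : Dl z = qC z * expC (24 * RC 1 * psum etacoef (qC z)).
Proof. by rewrite /Dl /eta_pow RC1 mul1r. Qed.

(** Differentiability at [q = 0] is what provides the rate of convergence. *)
Lemma limi_isd g l : isd g 0 l -> limi (fun z => g (qC z)) (g 0).
Proof.
move=> [phi [c _ e]]; have [d d0 hd] := c 1 ltr01.
have [Y hY] := qC_small d0; exists (nm (phi 0) + 1), Y; split; first by rewrite addr_ge0 ?nm_ge0.
move=> z /hY hz; rewrite e addrC addKr subr0 (nmM (phi _)) ler_wpM2r ?nm_ge0 //.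
have := hd (qC z); rewrite subr0 => /(_ hz) /ltW b.
have -> : phi (qC z) = phi 0 + (phi (qC z) - phi 0) by rewrite addrC subrK.
by apply: le_trans (nmD _ _) _; rewrite lerD2l.
Qed.

Lemma limi_Dl_q : limi (fun z => expC (24 * RC 1 * psum etacoef (qC z))) 1.
Proof.
have n0 : nm 0 < 1 by rewrite nm0 ltr01.
have := limi_isd (isd_comp (isdZ (24 * RC 1) (isd_psum PSR_etacoef n0)) (isd_expC _)).
by rewrite (psum0 PSR_etacoef) /etacoef sigma0 mul0r oppr0 mulr0 expC0.
Qed.

Lemma limi_Dl : limi Dl 0.
Proof.
have := limiM limi_q limi_Dl_q; rewrite mul0r.
by apply: limi_eq => z _; exact: DlE.
Qed.

Lemma Dl_T z : Dl (z + 1) = Dl z.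
Proof. by rewrite !DlE qC_shift. Qed.

(** Near infinity the modulus of [Dl] is at least half that of [q], since [Dl / q] tends to 1, while
    [g] is at most [K] times [q]. *)
Lemma mf_cusp w g : mf 12 Dl -> mf w g -> limi g 0 -> mf (w - 12) (fun z => g z / Dl z).
Proof.
move=> [_ _ D3 _] [g1 g2 g3 _] [K [Y [K0 h]]].
have D0 z : Dl z != 0 by exact: eta_pow_neq0.
split.
- by apply: holC_div g1 holC_Dl _ => z _.
- by move=> z hz; rewrite g2 // Dl_T.
- move=> z hz; rewrite g3 // D3 //; have z0 := inH_neq0 hz.
  rewrite (@expfzDr _ z w (- 12) z0) -(invr_expz z 12) invfM.
  by rewrite mulrACA.
have [K1 [Y1 [K10 h1]]] := limi_Dl_q.
have [|Y2 h2] := qC_small (e := (2 * (K1 + 1))^-1); first by rewrite invr_gt0 mulr_gt0 // ltr_wpDl.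
exists (K * 2), (Num.max (Num.max Y Y1) Y2) => z; rewrite !gt_max => /andP[/andP[z1 z2] z3].
rewrite nmM nmV ler_pdivrMr ?nm_gt0 //.
have := h z z1; rewrite subr0 => /le_trans; apply.
rewrite -mulrA ler_wpM2l // DlE (nmM (qC z)) mulrCA -[leLHS]mulr1 ler_wpM2l ?nm_ge0 //.
have := h1 z z2; have := h2 z z3; rewrite -[X in _ < X]div1r ltr_pdivlMr ?mulr_gt0 ?ltr_wpDl //.
set E := expC _ => a b.
have := nm_le_dist 1 E; rewrite nm1 nm_distC => c.
have q0 := nm_ge0 (qC z); nra.
Qed.

Lemma limi_q_neq0 g a : limi g a -> (forall z, inH z -> g z = 0) -> a = 0.
Proof. by move=> ha e; apply: limi_unique ha _; apply: limi_eq e (limi_cst 0). Qed.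

Lemma limi_Sg_q k : limi (fun z => psum (fun n => sigmac k n.+1) (qC z)) 1.
Proof.
have := limi_psum (PSR_sub (PSR_sigmac k)); rewrite {2}/sigmac.
have -> // : (sigmaf k 1)%:R = 1 :> C.
by rewrite /sigmaf big_mkcond big_ord_recl big_ord_recl big_ord0 /= exp1n.
Qed.

Lemma Sg_q k z : inH z -> Sg k.+1 z = qC z * psum (fun n => sigmac k.+1 n.+1) (qC z).
Proof.
move=> hz; rewrite /Sg (psum_shift (PSR_sigmac _) (nm_qC_lt1 hz)).
by rewrite {1}/sigmac sigma0 add0r.
Qed.

Lemma E4_E6_neq : ~ (forall z, inH z -> E4 z ^+ 3 = E6 z ^+ 2).
Proof.
move=> e; pose u z := 240 * psum (fun n => sigmac 3 n.+1) (qC z).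
pose v z := - 504 * psum (fun n => sigmac 5 n.+1) (qC z).
have hu : limi u (240 * 1) := limiZ 240 (limi_Sg_q 3).
have hv : limi v (- 504 * 1) := limiZ (- 504) (limi_Sg_q 5).
have hq := limi_q.
(* This is [(E4^3 - E6^2) / q] with [E4 = 1 + q u] and [E6 = 1 + q v]; its limit is
   [3 * 240 + 2 * 504 = 1728]. *)
pose g z := 3 * u z + qC z * (3 * u z ^+ 2 + qC z * u z ^+ 3 - v z ^+ 2) - 2 * v z.
pose r : C := 3 * (240 * 1) + 0 * (3 * (240 * 1) ^+ 2 + 0 * (240 * 1) ^+ 3 - (- 504 * 1) ^+ 2)
  - 2 * (- 504 * 1).
have hg : limi g r.
  apply: limiB (limiD (limiZ 3 hu) (limiM hq _)) (limiZ 2 hv).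
  exact: limiB (limiD (limiZ 3 (limiX 2 hu)) (limiM hq (limiX 3 hu))) (limiX 2 hv).
have : r = 0.
  apply: limi_q_neq0 hg _ => z hz; apply: (mulfI (qC_neq0 z)); rewrite mulr0.
  have := e z hz; rewrite E4E // E6E // !Sg_q // => /eqP; rewrite -subr_eq0 => /eqP <-.
  by rewrite /g /u /v; ring.
have -> : r = 1728%:R by rewrite /r; ring.
by move/eqP; rewrite pnatr_eq0.
Qed.

(** * The structure of the ring of modular forms *)

Definition E2_equivariant : Prop := forall g z, inSL g -> inH z -> Pt g z = Defs.Pfun z.

Definition Smat : 'M[int]_2 :=
  \matrix_(i, j) (if i == i0 then (if j == i0 then 0 else -1) else (if j == i0 then 1 else 0)).

Lemma inSL_S : inSL Smat.
Proof.
by rewrite /inSL (expand_det_row _ ord0) !big_ord_recl big_ord0 /cofactor /= !det_mx11 !mxE.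
Qed.

Lemma inSL_T : inSL Tmat.
Proof.
by rewrite /inSL (expand_det_row _ ord0) !big_ord_recl big_ord0 /cofactor /= !det_mx11 !mxE.
Qed.

Lemma jz_S z : jz Smat z = z.
Proof. by rewrite /jz /gc /gd !mxE /= mul1r addr0. Qed.

Lemma gc_S : gc Smat = 1.
Proof. by rewrite /gc mxE. Qed.

Lemma mob_S z : mob Smat z = - z^-1.
Proof. by rewrite /mob -/(jz Smat z) jz_S /ga /gb !mxE /= mul0r add0r mulN1r. Qed.

Lemma jz_T z : jz Tmat z = 1.
Proof. by rewrite /jz /gc /gd !mxE /= mul0r add0r. Qed.

Lemma mob_T z : mob Tmat z = z + 1.
Proof. by rewrite /mob -/(jz Tmat z) jz_T /ga /gb !mxE /= mul1r divr1. Qed.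

Lemma mf_of_mob w f a : (forall g z, inSL g -> inH z -> f (mob g z) = jz g z ^ w * f z) ->
  holC f -> limi f a -> mf w f.
Proof.
move=> h hf ha; apply: mf_of_lim hf _ _ ha => z hz.
  by have := h _ _ inSL_T hz; rewrite mob_T jz_T exp1rz mul1r.
by have := h _ _ inSL_S hz; rewrite mob_S jz_S.
Qed.

Lemma mf_E4 : E2_equivariant -> mf 4 E4.
Proof.
by move=> hP; apply: mf_of_mob holC_E4 limi_E4 => g z hg hz; apply: E4_mob => // w; exact: hP.
Qed.

Lemma mf_E6 : E2_equivariant -> mf 6 E6.
Proof.
by move=> hP; apply: mf_of_mob holC_E6 limi_E6 => g z hg hz; apply: E6_mob => // w; exact: hP.
Qed.

(** By the law of [E2], the function [Dl (-1/z) / z^12] solves the same first-order equation as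
    [Dl], so it is [c Dl]. The fixed point [i], with [i^12 = 1], gives [c = 1]. *)
Lemma mf_Dl : E2_equivariant -> mf 12 Dl.
Proof.
move=> hP; apply: mf_of_lim holC_Dl _ _ limi_Dl => z hz; first exact: Dl_T.
have [|c hc] := @eta_pow_unique 1 (fun z => Dl (mob Smat z) / z ^+ 12).
  move=> w hw; have w0 := inH_neq0 hw.
  have d := isd_comp (isd_mob inSL_S hw) (isd_eta_pow 1 (mob_inH inSL_S hw)).
  apply: isd_eq (isd_div d (isdX 12 (isd_id w)) (expf_neq0 12 w0)) _.
  rewrite (E2_mob inSL_S hw (hP _ _ inSL_S hw)) jz_S gc_S RC1 -/Dl /=.
  by field; rewrite w0 tpi_neq0.
have hi : inH iC by rewrite /inH Imi.
have i0' := inH_neq0 hi.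
have ei : - iC^-1 = iC by apply: (mulIf i0'); rewrite mulNr mulVf // iC2.
have c1 : c = 1.
  have := hc _ hi; rewrite mob_S ei (_ : iC ^+ 12 = 1); last first.
    by rewrite -[12%N]/(2 * 6)%N exprM expr2 iC2 -signr_odd.
  by rewrite divr1 -/Dl -[LHS]mul1r => /(mulIf (eta_pow_neq0 1 iC)).
have := hc _ hz; rewrite mob_S c1 mul1r -/Dl => <-.
by rewrite mulrC divfK // expf_neq0 // inH_neq0.
Qed.

(** [f^12 Dl^(n+1)] has weight 0 and vanishes at infinity, and [Dl] has no zero. *)
Lemma mf_neg n f : E2_equivariant -> mf (- n.+1%:Z) f -> forall z, inH z -> f z = 0.
Proof.
move=> hP hf z hz; have [a ha] := mf_lim hf.
have h : mf 0 (fun z => f z ^+ 12 * Dl z ^+ n.+1).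
  have := mfM (mfX 12 hf) (mfX n.+1 (mf_Dl hP)).
  by rewrite (_ : - n.+1%:Z * 12%:Z + 12 * n.+1%:Z = 0) //; ring.
have l : limi (fun z => f z ^+ 12 * Dl z ^+ n.+1) 0.
  by have := limiM (limiX 12 ha) (limiX n.+1 limi_Dl); rewrite expr0n mulr0.
have /eqP := mf_zero h l hz; rewrite mulf_eq0 !expf_eq0 /= => /orP[/eqP //|].
by rewrite (negbTE (eta_pow_neq0 1 z)).
Qed.

Lemma mf_const f : mf 0 f -> exists a, forall z, inH z -> f z = a.
Proof.
move=> hf; have [a ha] := mf_lim hf; exists a => z hz.
have h1 : mf 0 (fun=> 1) by apply: mf_of_lim (holC_cst 1) _ _ (limi_cst 1) => // w _; rewrite mul1r.
have l : limi (fun z => f z - a * 1) 0.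
  by have := limiB ha (limiZ a (limi_cst 1)); rewrite mulr1 subrr; apply: limi_eq.
by have /eqP := mf_zero (mf_lin a hf h1) l hz; rewrite mulr1 subr_eq0 => /eqP.
Qed.

(** [E4^3 - E6^2] divided by [Dl] is a form of weight 0, hence constant, and [E4_E6_neq] makes this
    constant invertible. *)
Lemma Dl_E : E2_equivariant -> exists c, forall z, inH z -> Dl z = c * E4 z ^+ 3 + - c * E6 z ^+ 2.
Proof.
move=> hP; pose g z := E4 z ^+ 3 - 1 * E6 z ^+ 2.
have hg : mf 12 g by apply: mf_lin (mfX 3 (mf_E4 hP)) (mfX 2 (mf_E6 hP)).
have lg : limi g 0.
  have := limiB (limiX 3 limi_E4) (limiZ 1 (limiX 2 limi_E6)); rewrite !expr1n mulr1 subrr //.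
have := mf_cusp (mf_Dl hP) hg lg; rewrite subrr => /mf_const[c hc].
have gE z : inH z -> g z = c * Dl z by move=> hz; rewrite -(hc z hz) divfK // eta_pow_neq0.
have c0 : c != 0.
  apply/eqP => c0; apply: E4_E6_neq => z hz; apply/eqP; rewrite -subr_eq0.
  by have := gE z hz; rewrite c0 mul0r /g mul1r => ->.
exists c^-1 => z hz; have := gE z hz; rewrite /g mul1r => e.
by rewrite mulNr -mulrBr e mulKf.
Qed.

(* The square and the cube of a form of weight 2 are multiples of [E4] and [E6], which
   forces a relation between [E4 ^ 3] and [E6 ^ 2]. *)
Lemma mf_2 f : E2_equivariant -> mf 2 f -> forall z, inH z -> f z = 0.
Proof.
move=> hP hf; have [a ha] := mf_lim hf; have hD := mf_Dl hP.
have D0 z : Dl z != 0 by exact: eta_pow_neq0.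
have e2 z : inH z -> f z ^+ 2 = a ^+ 2 * E4 z.
  move=> hz; have h : mf 4 (fun z => f z ^+ 2 - a ^+ 2 * E4 z) by apply: mf_lin (mfX 2 hf) (mf_E4 hP).
  have l : limi (fun z => f z ^+ 2 - a ^+ 2 * E4 z) 0.
    by have := limiB (limiX 2 ha) (limiZ (a ^+ 2) limi_E4); rewrite mulr1 subrr.
  have /eqP := @mf_neg 7 _ hP (mf_cusp hD h l) z hz.
  by rewrite mulf_eq0 invr_eq0 (negbTE (D0 z)) orbF subr_eq0 => /eqP.
have e3 z : inH z -> f z ^+ 3 = a ^+ 3 * E6 z.
  move=> hz; have h : mf 6 (fun z => f z ^+ 3 - a ^+ 3 * E6 z) by apply: mf_lin (mfX 3 hf) (mf_E6 hP).
  have l : limi (fun z => f z ^+ 3 - a ^+ 3 * E6 z) 0.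
    by have := limiB (limiX 3 ha) (limiZ (a ^+ 3) limi_E6); rewrite mulr1 subrr.
  have /eqP := @mf_neg 5 _ hP (mf_cusp hD h l) z hz.
  by rewrite mulf_eq0 invr_eq0 (negbTE (D0 z)) orbF subr_eq0 => /eqP.
have a0 : a = 0.
  have [//|a0] := eqVneq a 0; case: E4_E6_neq => z hz; apply: (mulfI (expf_neq0 6 a0)).
  have -> : a ^+ 6 * E4 z ^+ 3 = (a ^+ 2 * E4 z) ^+ 3 by ring.
  have -> : a ^+ 6 * E6 z ^+ 2 = (a ^+ 3 * E6 z) ^+ 2 by ring.
  by rewrite -e2 // -e3 //; ring.
by move=> z hz; have /eqP := e2 z hz; rewrite a0 expr0n mul0r expf_eq0 => /eqP.
Qed.

(** The same functions as [Mform] in natural weights, in a form suited to induction. *)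
Inductive pol (w : nat) : (C -> C) -> Prop :=
| pol_zero f : (forall z, inH z -> f z = 0) -> pol w f
| pol_mono a b x f : (4 * a + 6 * b = w)%N ->
    (forall z, inH z -> f z = x * E4 z ^+ a * E6 z ^+ b) -> pol w f
| pol_add f g h : pol w f -> pol w g -> (forall z, inH z -> h z = f z + g z) -> pol w h.

Lemma pol_mul w a b x f : pol w f ->
  pol (4 * a + 6 * b + w) (fun z => x * E4 z ^+ a * E6 z ^+ b * f z).
Proof.
elim=> [{}f hf|a' b' x' {}f e hf|{}f g h _ IHf _ IHg e].
- by apply: pol_zero => z hz; rewrite hf // mulr0.
- apply: (@pol_mono _ (a + a') (b + b') (x * x')); first by rewrite -e; lia.
  by move=> z hz; rewrite hf // !exprD; ring.
by apply: pol_add IHf IHg _ => z hz; rewrite e //; ring.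
Qed.

Lemma pol_eq w f g : (forall z, inH z -> f z = g z) -> pol w g -> pol w f.
Proof.
move=> e hg; case: hg e => [h eh|a b x h ew eh|h1 h2 h p1 p2 eh] e.
- by apply: pol_zero => z hz; rewrite e // eh.
- by apply: (@pol_mono _ a b x) => // z hz; rewrite e // eh.
by apply: pol_add p1 p2 _ => z hz; rewrite e // eh.
Qed.

Lemma mf_mono a b : E2_equivariant -> mf (4 * a + 6 * b)%N (fun z => E4 z ^+ a * E6 z ^+ b).
Proof.
by move=> hP; have := mfM (mfX a (mf_E4 hP)) (mfX b (mf_E6 hP)); rewrite PoszD !PoszM.
Qed.

(** Take for [b] the parity of [m]. *)
Lemma weight_mono m : (1 < m)%N -> exists a b, (4 * a + 6 * b = 2 * m)%N.
Proof.
move=> m1; exists ((m - 3 * odd m)./2)%N, (odd m : nat).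
by have := odd_double_half m; case: (odd m); lia.
Qed.

(** Subtracting a multiple of a monomial of the same weight leaves a form that vanishes at infinity;
    its quotient by [Dl] has weight lower by 12. Weight 2, which has no monomial, is settled by
    [mf_2]. *)
Lemma mf_pol m f : E2_equivariant -> mf (2 * m)%N f -> pol (2 * m) f.
Proof.
move=> hP; elim/ltn_ind: m f => m IH f hf.
case: m => [|[|m]] in IH hf *.
- have [a ha] := mf_const hf; apply: (@pol_mono _ 0 0 a) => // z hz.
  by rewrite ha // !expr0 !mulr1.
- by apply: pol_zero; exact: mf_2.
have [a [b ew]] := @weight_mono m.+2 isT; have [c hc] := mf_lim hf.
pose E z := E4 z ^+ a * E6 z ^+ b.
have lE : limi E 1.
  by have := limiM (limiX a limi_E4) (limiX b limi_E6); rewrite !expr1n mulr1.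
have hE : mf (2 * m.+2)%N E by rewrite -ew; exact: mf_mono.
have lg : limi (fun z => f z - c * E z) 0 by have := limiB hc (limiZ c lE); rewrite mulr1 subrr.
have hh := mf_cusp (mf_Dl hP) (mf_lin c hf hE) lg.
have fE z : inH z -> f z = c * E4 z ^+ a * E6 z ^+ b + Dl z * ((f z - c * E z) / Dl z).
  by move=> hz; rewrite [Dl z * _]mulrC divfK ?eta_pow_neq0 // /E mulrA addrC subrK.
have pE : pol (2 * m.+2) (fun z => c * E4 z ^+ a * E6 z ^+ b) by apply: pol_mono ew _.
(* The weight is [2 (m + 2)]; it is below 12 exactly for [m < 4], and then the quotient by [Dl] has
   negative weight. *)
have [m4|m4] := ltnP m 4.
  apply: pol_eq pE => z hz; rewrite [LHS]fE // (_ : (f z - c * E z) / Dl z = 0) ?mulr0 ?addr0 //.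
  apply: (@mf_neg (7 - 2 * m) (fun z => (f z - c * E z) / Dl z)) => //.
  by rewrite (_ : - _ = (2 * m.+2)%N%:Z - 12) //; lia.
have ph : pol (2 * (m - 4)) (fun z => (f z - c * E z) / Dl z).
  apply: IH; first by lia.
  by rewrite (_ : Posz _ = (2 * m.+2)%N%:Z - 12) //; lia.
have [d hd] := Dl_E hP.
have e1 : (4 * 3 + 6 * 0 + 2 * (m - 4) = 2 * m.+2)%N by lia.
have e2 : (4 * 0 + 6 * 2 + 2 * (m - 4) = 2 * m.+2)%N by lia.
have p1 := pol_mul 3 0 d ph; have p2 := pol_mul 0 2 (- d) ph.
rewrite e1 in p1; rewrite e2 in p2.
apply: (pol_add pE (pol_add p1 p2 (fun _ _ => erefl))) => z hz.
by rewrite [LHS]fE // {1}hd // mulrDl !expr0 !mulr1.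
Qed.

Lemma Mform_zero w f : (forall z, inH z -> f z = 0) -> Mform w f.
Proof.
move=> h; exists (fun _ _ => 0) => z hz; rewrite h // big1 // => a _; rewrite big1 // => b _.
by rewrite !mul0r if_same.
Qed.

Lemma Mform_add w f g h : Mform w f -> Mform w g -> (forall z, inH z -> h z = f z + g z) -> Mform w h.
Proof.
move=> [c hc] [d hd] e; exists (fun a b => c a b + d a b) => z hz.
rewrite e // hc // hd // -big_split; apply: eq_bigr => a _; rewrite -big_split; apply: eq_bigr => b _ /=.
by case: ifP => _; rewrite ?addr0 // !mulrDl.
Qed.

Lemma Mform_mono w a b x f : (4 * a + 6 * b = w)%N ->
  (forall z, inH z -> f z = x * E4 z ^+ a * E6 z ^+ b) -> Mform w%:Z f.
Proof.
move=> ew e; exists (fun a' b' => if (a' == a) && (b' == b) then x else 0) => z hz.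
have aw : (a < w.+1)%N by lia.
have bw : (b < w.+1)%N by lia.
rewrite e // (bigD1 (Ordinal aw)) //= [X in X + _](bigD1 (Ordinal bw)) //= !eqxx ew eqxx.
rewrite [X in _ + X + _]big1 ?addr0; last first.
  by move=> i; rewrite -val_eqE /= => /negbTE ->; rewrite !mul0r if_same.
rewrite [X in _ + X]big1 ?addr0 // => i; rewrite -val_eqE /= => /negbTE ->; apply: big1 => j _.
by rewrite !mul0r if_same.
Qed.

Lemma pol_Mform w f : pol w f -> Mform w%:Z f.
Proof.
elim=> [{}f|a b x {}f|{}f g h _ pf _ pg]; [exact: Mform_zero|exact: Mform_mono|exact: Mform_add].
Qed.

Lemma mf_Mform m f : E2_equivariant -> mf (2 * m)%N f -> Mform (2 * m)%N%:Z f.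
Proof. by move=> hP /(mf_pol hP) /pol_Mform. Qed.

Lemma pol_sum w (I : Type) (s : seq I) (F : I -> C -> C) : (forall i, pol w (F i)) ->
  pol w (fun z => \sum_(i <- s) F i z).
Proof.
move=> h; elim: s => [|i s IH]; first by apply: pol_zero => z _; rewrite big_nil.
by apply: pol_add (h i) IH _ => z _; rewrite big_cons.
Qed.

Lemma Mform_pol w f : Mform w%:Z f -> pol w f.
Proof.
move=> [c hc]; apply: pol_eq hc _; apply: pol_sum => a; apply: pol_sum => b.
rewrite eqz_nat; case: eqP => [e|_]; last exact: pol_zero.
exact: pol_mono e _.
Qed.

Lemma pol_holC w f : pol w f -> holC f.
Proof.
elim=> [{}f e|a b x {}f _ e|{}f g h _ pf _ pg e]; apply: (holC_eq e).
- exact: holC_cst.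
- exact: holCM (holCZ x (holCX a holC_E4)) (holCX b holC_E6).
exact: holCD.
Qed.

Lemma pol_limi w f : pol w f -> exists a, limi f a.
Proof.
elim=> [{}f e|a b x {}f _ e|{}f g h _ [c pf] _ [d pg] e].
- by exists 0; apply: limi_eq e (limi_cst 0).
- by eexists; apply: limi_eq e (limiM (limiZ x (limiX a limi_E4)) (limiX b limi_E6)).
by exists (c + d); apply: limi_eq e (limiD pf pg).
Qed.

Lemma pol_mob w f g z : E2_equivariant -> pol w f -> inSL g -> inH z ->
  f (mob g z) = jz g z ^+ w * f z.
Proof.
move=> hP pf hg hz; have hm := mob_inH hg hz.
elim: pf => [{}f e|a b x {}f ew e|{}f h k _ pf _ ph e]; rewrite !e //.
- by rewrite mulr0.
- rewrite E4_mob ?E6_mob // => [|w' hw|w' hw]; try exact: hP.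
  rewrite -ew exprD [(_ * E4 z) ^+ a]exprMn [(_ * E6 z) ^+ b]exprMn -!exprM.
  by move: (jz g z ^+ _) (jz g z ^+ _) => u v; ring.
by rewrite pf ph mulrDr.
Qed.

(** * Vector-valued modular forms *)

Lemma cpowDz (w : C) k (n : int) : w != 0 -> cpow w (k + n%:~R) = cpow w k * w ^ n.
Proof.
move=> w0; case: n => n; first exact: cpowDn.
have := cpowDn (k + (Negz n)%:~R) n.+1 w0; rewrite NegzE -exprnN.
have -> : k + (- n.+1%:Z)%:~R + n.+1%:R = k by rewrite mulrNz addrNK.
by move=> ->; rewrite mulfK // expf_neq0.
Qed.

Lemma cpow_1 k : cpow 1 k = 1.
Proof.
have e : cpow 1 (0 + 1%:R) = cpow 1 0 * 1 ^+ 1 by apply: cpowDn; exact: oner_neq0.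
have -> : cpow 1 k = expC (RC k * LogC 1) by apply: cpowE; exact: oner_neq0.
have -> : LogC 1 = 0.
  apply: CeqP; rewrite /LogC ?ReE ?ImE ?Re0 ?Im0.
    by rewrite expr1n expr0n addr0 sqrtr1 ln1.
  by rewrite /Arg Re1 Im1 ltr01 mul0r atan0.
by rewrite mulr0 expC0.
Qed.

Lemma limi_sum (I : Type) (s : seq I) (f : I -> C -> C) (a : I -> C) : (forall i, limi (f i) (a i)) ->
  limi (fun z => \sum_(i <- s) f i z) (\sum_(i <- s) a i).
Proof.
move=> h; elim: s => [|i s IH].
  by rewrite big_nil; apply: limi_eq (limi_cst 0) => z _; rewrite big_nil.
by rewrite big_cons; apply: limi_eq (limiD (h i) IH) => z _; rewrite big_cons.
Qed.

Lemma limi_prod (I : Type) (s : seq I) (f : I -> C -> C) (a : I -> C) : (forall i, limi (f i) (a i)) ->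
  limi (fun z => \prod_(i <- s) f i z) (\prod_(i <- s) a i).
Proof.
move=> h; elim: s => [|i s IH].
  by rewrite big_nil; apply: limi_eq (limi_cst 1) => z _; rewrite big_nil.
by rewrite big_cons; apply: limi_eq (limiM (h i) IH) => z _; rewrite big_cons.
Qed.

Lemma limi_det n (A : C -> 'M[C]_n) (B : 'M[C]_n) : (forall i j, limi (fun z => A z i j) (B i j)) ->
  limi (fun z => \det (A z)) (\det B).
Proof.
move=> h; rewrite /determinant; apply: limi_sum => s; apply: limiZ; exact: limi_prod.
Qed.

Lemma limiV g b : limi g b -> b != 0 -> limi (fun z => (g z)^-1) b^-1.
Proof.
move=> [K [Y [K0 h]]] b0; have b1 : 0 < nm b by rewrite nm_gt0.
have [|Y1 h1] := qC_small (e := nm b / (2 * (K + 1))).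
  by rewrite divr_gt0 // mulr_gt0 // ltr_wpDl.
exists (K * 2 / nm b ^+ 2), (Num.max Y Y1); split; first by rewrite mulr_ge0 ?invr_ge0 ?exprn_ge0 ?nm_ge0 ?mulr_ge0.
move=> z; rewrite gt_max => /andP[z1 z2]; have e1 := h z z1.
have e2 : K * nm (qC z) <= nm b / 2.
  have := h1 z z2; rewrite ltr_pdivlMr ?mulr_gt0 ?ltr_wpDl // => e2.
  by have q0 := nm_ge0 (qC z); nra.
have gz : nm b / 2 <= nm (g z).
  by have := nm_le_dist b (g z); rewrite nm_distC; lra.
have g0 : g z != 0 by rewrite -nm_gt0; lra.
have -> : (g z)^-1 - b^-1 = - (g z - b) / (g z * b) by field; rewrite g0 b0.
rewrite nmM nmN nmV nmM ler_pdivrMr ?mulr_gt0 ?nm_gt0 //; apply: le_trans e1 _.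
have -> : K * 2 / nm b ^+ 2 * nm (qC z) * (nm (g z) * nm b) = K * nm (qC z) * (2 * nm (g z) / nm b).
  by field; rewrite gt_eqF.
rewrite -[leLHS]mulr1 ler_wpM2l ?mulr_ge0 ?nm_ge0 // ler_pdivlMr // mul1r; lra.
Qed.

(** With [t = s / (N + 1)] one has [exp (s y) = exp (t y) ^ (N + 1) >= (t y) ^ (N + 1)], which beats
    [y ^ N] by one power of [y]. *)
Lemma pow_exp_small (N : nat) (s e : R) : 0 < s -> 0 < e ->
  exists Y : R, forall y, Y < y -> y ^+ N * expR (- (s * y)) < e.
Proof.
move=> s0 e0; pose t := s / N.+1%:R; have t0 : 0 < t by rewrite divr_gt0 // ltr0n.
exists (Num.max 0 (t ^- N.+1 / e)) => y; rewrite gt_max => /andP[y0 hy].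
have ee : expR (- (s * y)) = (expR (t * y) ^+ N.+1)^-1.
  by rewrite expRN -expRM_natl mulrA [_ * t]mulrC divfK // pnatr_eq0.
have ge : (t * y) ^+ N.+1 <= expR (t * y) ^+ N.+1.
  have ge1 : t * y <= expR (t * y) by apply: le_trans (expR_ge1Dx _); rewrite lerDr.
  by apply: lerXn2r ge1; rewrite nnegrE ?expR_ge0 // ltW // mulr_gt0.
rewrite ee ltr_pdivrMr ?exprn_gt0 ?expR_gt0 //; apply: lt_le_trans (ler_wpM2l (ltW e0) ge).
move: hy; rewrite ltr_pdivrMr // => hy.
have tN : 0 < t ^+ N.+1 by rewrite exprn_gt0.
have : t ^+ N.+1 * t ^- N.+1 < t ^+ N.+1 * (y * e) by rewrite ltr_pM2l.
rewrite mulfV ?gt_eqF // => h1.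
have -> : e * (t * y) ^+ N.+1 = y ^+ N * (t ^+ N.+1 * (y * e)) by rewrite exprMn [y ^+ N.+1]exprS; ring.
by rewrite ltr_pMr ?exprn_gt0.
Qed.

(** The inversion applied twice is the identity on H, and in odd weight this reads [f = - f]. *)
Lemma mf_odd (n : int) f : mf (2 * n + 1) f -> forall z, inH z -> f z = 0.
Proof.
move=> [_ _ f3 _] z hz; have z0 := inH_neq0 hz.
have e : - (- z^-1)^-1 = z by rewrite invrN opprK invrK.
have := f3 _ (inH_S hz); rewrite e f3 //.
have -> : (- z^-1) ^ (2 * n + 1) * (z ^ (2 * n + 1) * f z) = (-1) ^ (2 * n + 1) * f z.
  rewrite mulrA -mulN1r -expfzMl; congr (_ ^ _ * _).
  by rewrite mulN1r mulNr mulVf.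
have -> : (-1) ^ (2 * n + 1) = -1 :> C.
  rewrite expfzDr ?oppr_eq0 ?oner_eq0 // expr1z -exprz_exp (_ : (-1) ^ 2 = 1) ?exp1rz ?mul1r //.
  by rewrite -exprnP sqrrN expr1n.
rewrite mulN1r => /eqP; rewrite -subr_eq0 opprK -mulr2n -mulr_natl mulf_eq0 pnatr_eq0 /=.
by move/eqP.
Qed.

(* The monomials [E4 ^ a * E6 ^ b * D^j F0] of weight [k0 + 2 * k] are those with
   [2 * a + 3 * b + j = k]; they are numbered by [t = 2 * b + (1 < j)]. *)
Definition exp_j (k t : nat) : nat := ((k - 3 * t./2) %% 2 + 2 * odd t)%N.
Definition exp_a (k t : nat) : nat := (k - 3 * t./2 - exp_j k t)./2.

Lemma exp_spec k t : (t < (2 * k) %/ 3 + 1)%N ->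
  [/\ (2 * exp_a k t + 3 * t./2 + exp_j k t = k)%N, (exp_j k t < 4)%N &
      t = (2 * t./2 + (1 < exp_j k t))%N].
Proof.
rewrite /exp_a /exp_j => ht; have := odd_double_half t.
have : (3 * t <= 2 * k)%N by lia.
by case: (odd t) => /= h1 h2; split; lia.
Qed.

Lemma exp_inv k a b j : (2 * a + 3 * b + j = k)%N -> (j < 4)%N ->
  [/\ (2 * b + (1 < j) < (2 * k) %/ 3 + 1)%N, exp_a k (2 * b + (1 < j)) = a,
      (2 * b + (1 < j))./2 = b & exp_j k (2 * b + (1 < j)) = j].
Proof.
move=> e j4; have hb : ((2 * b + (1 < j))./2 = b)%N by lia.
have ho : odd (2 * b + (1 < j)) = (1 < j)%N by rewrite oddD oddM /= oddb.
have hj : exp_j k (2 * b + (1 < j)) = j by rewrite /exp_j hb ho; lia.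
by split; rewrite // /exp_a ?hj ?hb; lia.
Qed.

(* With [v = E4 ^ 3 / E6 ^ 2] one has [E4 ^ a * E6 ^ b = (E6 / E4) ^ (2 a + 3 b) * v ^ (a + b)],
   so a relation in a fixed weight is a polynomial equation for [v]; but [v] tends to 1
   at infinity without taking the value 1. *)
Lemma monomials_free (I : finType) (S : {pred I}) (c : I -> C) (a b : I -> nat) (w : nat) :
  E2_equivariant -> (forall i, i \in S -> 2 * a i + 3 * b i = w)%N ->
  {in S &, injective (fun i => (a i + b i)%N)} ->
  (forall z, inH z -> \sum_(i in S) c i * (E4 z ^+ a i * E6 z ^+ b i) = 0) ->
  forall i, i \in S -> c i = 0.
Proof.
move=> hP hw inj h.
have [l4 l6] := (limi_E4, limi_E6).
pose v z := E4 z ^+ 3 * (E6 z ^+ 2)^-1.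
have lv : limi v 1.
  have := limiM (limiX 3 l4) (limiV (limiX 2 l6) (expf_neq0 2 (oner_neq0 _))).
  by rewrite !expr1n invr1 mulr1.
pose p : {poly C} := \sum_(i in S) c i *: 'X^(a i + b i).
have [p0|p0] := eqVneq p 0.
  move=> i iS; have := congr1 (fun q : {poly C} => q`_(a i + b i)) p0.
  rewrite coef0 coef_sum (bigD1 i) //= coefZ coefXn eqxx mulr1 big1 ?addr0 // => t /andP[tS ti].
  rewrite coefZ coefXn (_ : _ == _ = false) ?mulr0 //.
  by apply: contraNF ti => /eqP /(inj _ _ iS tS) ->.
(* Write [p] as [q] times a power of [X - 1], with [q(1)] nonzero. Far up [q(v)] is nonzero by
   continuity, and [v - 1] is nonzero because [Dl] has no zero. *)
exfalso; have [m [q hq ep]] := multiplicity_XsubC p 1.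
have q1 : q.[1] != 0 by move: hq; rewrite p0.
have lq : limi (fun z => q.[v z]) q.[1].
  have := limi_sum (index_enum 'I_(size q)) (fun i => limiZ q`_i (limiX i lv)).
  by rewrite -horner_coef; apply: limi_eq => z _; rewrite horner_coef.
have near_neq0 g d : limi g d -> d != 0 -> exists Y : R, forall z, Y < ImC z -> g z != 0.
  move=> [K [Y [K0 hY]]] d0; have d1 : 0 < nm d by rewrite nm_gt0.
  have [|Y1 h1] := qC_small (e := nm d / (K + 1)); first by rewrite divr_gt0 // ltr_wpDl.
  exists (Num.max Y Y1) => z; rewrite gt_max => /andP[z1 z2].
  apply: contraTneq (hY z z1) => ->; rewrite sub0r nmN -ltNge.
  have := h1 z z2; rewrite ltr_pdivlMr ?ltr_wpDl // => /(le_lt_trans _); apply.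
  by rewrite mulrC ler_wpM2l ?nm_ge0 // lerDl ler01.
have [Y1 h1] := near_neq0 _ _ l4 (oner_neq0 _).
have [Y2 h2] := near_neq0 _ _ l6 (oner_neq0 _).
have [Y3 h3] := near_neq0 _ _ lq q1.
pose z : C := 0 +i* (Num.max (Num.max Y1 Y2) (Num.max Y3 0) + 1).
have zi x : x <= Num.max (Num.max Y1 Y2) (Num.max Y3 0) -> x < ImC z.
  by move=> hx; rewrite ImE ltr_pwDr.
have e4 : E4 z != 0 by apply/h1/zi; rewrite !le_max lexx.
have e6 : E6 z != 0 by apply/h2/zi; rewrite !le_max lexx orbT.
have hz : inH z by apply: zi; rewrite !le_max lexx !orbT.
have qz : q.[v z] != 0 by apply/h3/zi; rewrite !le_max lexx !orbT.
have v1 : v z != 1.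
  apply/eqP => /(canRL (mulfVK (expf_neq0 2 e6))); rewrite mul1r => e.
  have [d hd] := Dl_E hP; have /eqP := hd z hz.
  by rewrite e mulNr subrr (negbTE (eta_pow_neq0 1 z)).
have : p.[v z] = 0.
  have u0 : (E6 z / E4 z) ^+ w != 0 by rewrite expf_neq0 // mulf_neq0 ?invr_neq0.
  apply: (mulfI u0); rewrite mulr0 -(h z hz) horner_sum big_distrr; apply: eq_bigr => i iS.
  rewrite /= hornerZ hornerXn mulrCA; congr (_ * _); rewrite -(hw i iS) /v.
  set u := E6 z / E4 z; set x := E4 z ^+ 3 / E6 z ^+ 2.
  transitivity ((u ^+ 2 * x) ^+ a i * (u ^+ 3 * x) ^+ b i).
    by rewrite [(u ^+ 2 * x) ^+ _]exprMn [(u ^+ 3 * x) ^+ _]exprMn -!exprM mulrACA -!exprD.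
  by congr (_ ^+ _ * _ ^+ _); rewrite /u /x; field; rewrite e4 e6.
move/eqP; rewrite ep hornerM horner_exp hornerXsubC mulf_eq0 (negbTE qz) /= expf_eq0.
by rewrite subr_eq0 (negbTE v1) andbF.
Qed.

(** * The module of forms attached to the solution vector *)

Section Solutions.
Variables (ups : 'M[int]_2 -> C) (rho0 : 'M[int]_2 -> 'M[C]_4) (F0 : C -> 'cV[C]_4).
Variables (M4 M6 M8 : C -> C) (lam : 'I_4 -> R) (k0 : R) (ac : 'I_4 -> nat -> C).
Hypothesis k0E : k0 = 3 * (\sum_i lam i) - 3.
Hypothesis lam_inj : injective lam.
Hypothesis lam_bounds : forall i, 0 <= lam i < 1.
Hypothesis ups_neq0 : forall g, inSL g -> ups g != 0.
Hypothesis F0_hol : forall i, holH (vcomp F0 i).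
Hypothesis F0_mlde : forall i z, inH z -> mlde4_op k0 M4 M6 M8 (vcomp F0 i) z = 0.
Hypothesis F0_q : forall i, qseries (lam i) 1 (vcomp F0 i) (ac i).
Hypothesis F0_slash : forall g z, inSL g -> inH z -> slash k0 ups g F0 z = rho0 g *m F0 z.

Local Notation f := (vcomp F0).

Lemma f_holC i : holC (f i).
Proof. exact: qseries_holC (F0_q i). Qed.

Lemma f_solves i : solves k0 M4 M6 M8 (f i).
Proof.
by move=> z hz; rewrite -(F0_mlde i hz) /mlde4_op -!(DnE _ _ (@f_holC i) hz).
Qed.

Lemma weight_sum : (4 * k0 + 12) / 12 = \sum_i lam i.
Proof. by rewrite k0E; field. Qed.

(** Distinct nonnegative numbers cannot all vanish; this is what allows division by [4 k0 + 12] in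
    [P_equivariant]. *)
Lemma sum_lam_gt0 : 0 < \sum_i lam i.
Proof.
have l0 i : 0 <= lam i by case/andP: (lam_bounds i).
rewrite lt_def sumr_ge0 // andbT psumr_eq0 //; apply/negP => /allP h.
have e i : lam i = 0 by apply/eqP/h; rewrite mem_index_enum.
by have := lam_inj (etrans (e ord0) (esym (e ord_max))).
Qed.

Lemma RClam_inj : injective (fun i => RC (lam i)).
Proof. by move=> i j /RC_inj /lam_inj. Qed.

Lemma series_det w : nm w < 1 -> \det (series_mx (fun l i => Dncoef (lam i) k0 l (ac i)) w) != 0.
Proof. by have [h _] := wronskian_unit RClam_inj weight_sum F0_q f_solves; exact: h. Qed.

Lemma wr_unit z : inH z -> wronskian k0 f z \in unitmx.
Proof. by have [_ h] := wronskian_unit RClam_inj weight_sum F0_q f_solves; exact: h. Qed.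

Definition j0 (g : 'M[int]_2) (z : C) : C := ups g * cpow (jz g z) k0.

Lemma j0_neq0 g z : inSL g -> inH z -> j0 g z != 0.
Proof. by move=> hg hz; rewrite mulf_neq0 ?ups_neq0 ?cpow_neq0 ?jz_neq0. Qed.

Lemma Hspace_mob (n : int) F g z : Hspace (k0 + n%:~R) rho0 ups F -> inSL g -> inH z ->
  F (mob g z) = (jz g z ^ n * j0 g z) *: (rho0 g *m F z).
Proof.
move=> [_ h] hg hz; rewrite -h // /slash -/(jz g z) scalerA cpowN ?jz_neq0 // cpowDz ?jz_neq0 //.
rewrite /j0 (_ : _ * _ = 1) ?scale1r //; field.
by rewrite ups_neq0 // cpow_neq0 ?expfz_neq0 ?jz_neq0.
Qed.

Lemma F0_mob g z i : inSL g -> inH z -> f i (mob g z) = j0 g z * \sum_m rho0 g i m * f m z.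
Proof.
move=> hg hz; have := F0_slash hg hz; rewrite /slash -/(jz g z) cpowN ?jz_neq0 // => e.
have {}e : F0 (mob g z) = j0 g z *: (rho0 g *m F0 z).
  rewrite -e scalerA (_ : _ * _ = 1) ?scale1r // /j0; field.
  by rewrite ups_neq0 // cpow_neq0 // jz_neq0.
by rewrite /vcomp e !mxE.
Qed.

Lemma isd_j0 g z : inSL g -> inH z -> isd (j0 g) z (RC k0 * gc g / jz g z * j0 g z).
Proof. by move=> hg hz; apply: isd_eq (isdZ (ups g) (isd_cpow_jz k0 hg hz)) _; rewrite /j0; ring. Qed.

Lemma P_equivariant : E2_equivariant.
Proof.
move=> g z hg; apply: (P_mob (k := k0) (M4 := M4) (M6 := M6) (M8 := M8) (f := f) (A := rho0 g) (j := j0 g)) => //.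
- have := weight_sum; have := sum_lam_gt0; move: (\sum_i _) => s s0 e; apply/eqP => e0.
  by move: e; rewrite e0 mul0r => e; rewrite -e ltxx in s0.
- exact: f_holC.
- exact: f_solves.
- exact: wr_unit.
- by move=> w; exact: j0_neq0.
- by move=> w; exact: isd_j0.
by move=> w i; exact: F0_mob.
Qed.

(** Equality on H suffices because [theta] is local; needed since [Pt g] and [P] are compared on H
    only. *)
Lemma Dg_Q_eq Q Q' n k h z : (forall w, inH w -> Q w = Q' w) -> holC Q' -> holC h -> inH z ->
  Dg Q n k h z = Dg Q' n k h z.
Proof.
move=> e hQ hh; elim: n z => [//|n IH] z hz.
by rewrite /Dg -/Dg IH // e // (theta_eq (holC_Dg n k hQ hh) hz IH).
Qed.

Lemma Dg_mob_F0 n i g z : inSL g -> inH z ->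
  Dg Defs.Pfun n k0 (f i) (mob g z) =
  jz g z ^+ (2 * n) * j0 g z * \sum_m rho0 g i m * Dg Defs.Pfun n k0 (f m) z.
Proof.
move=> hg hz; rewrite -(Dg_sum n k0 _ _ holC_P f_holC hz).
have hG : holC (fun z => \sum_m rho0 g i m * f m z) by apply: holC_sum => m; exact: holCZ (@f_holC m).
rewrite -(@Dg_Q_eq (Pt g) Defs.Pfun n k0 _ z (fun w => P_equivariant hg) holC_P hG hz).
apply: (Dg_mob n hg (@f_holC i)) => //.
  by move=> w hw; exact: F0_mob.
by move=> w hw; exact: isd_j0.
Qed.

Lemma DnV_off n z : ~~ inH z -> DnV n k0 F0 z = 0.
Proof.
move=> hz; apply/matrixP => i o; rewrite !mxE Dn_off // => w hw.
by case: (F0_hol i) => _ ->.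
Qed.

Lemma DnVE n z i : inH z -> DnV n k0 F0 z i ord0 = Dg Defs.Pfun n k0 (f i) z.
Proof. by move=> hz; rewrite mxE DnE //; exact: f_holC. Qed.

Lemma DnV_mob n g z : inSL g -> inH z ->
  DnV n k0 F0 (mob g z) = (jz g z ^+ (2 * n) * j0 g z) *: (rho0 g *m DnV n k0 F0 z).
Proof.
move=> hg hz; apply/matrixP => i o; rewrite (ord1 o) DnVE ?mob_inH // Dg_mob_F0 // !mxE.
by congr (_ * _); apply: eq_bigr => m _; rewrite DnVE.
Qed.

(** [rho0] is known through its action on [F0]; since the Wronskian matrix at the image of [i] is
    invertible, so is its factor [rho0 g]. *)
Lemma rho0_unit g : inSL g -> rho0 g \in unitmx.
Proof.
move=> hg; have hi : inH iC by rewrite /inH Imi.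
have : wronskian k0 f (mob g iC) =
    (\matrix_(l, m) (jz g iC ^+ (2 * l) * j0 g iC * Dg Defs.Pfun l k0 (f m) iC)) *m (rho0 g)^T.
  apply/matrixP => l i; rewrite !mxE Dg_mob_F0 // big_distrr; apply: eq_bigr => m _.
  by rewrite !mxE /=; ring.
move/(congr1 (fun M => M \in unitmx)); rewrite wr_unit ?mob_inH //= => /esym.
by rewrite unitmxE det_mulmx unitrM => /andP[_]; rewrite det_tr unitmxE.
Qed.

Lemma DnV_free (c c' : 'I_4 -> C) z : inH z ->
  \sum_(j < 4) c j *: DnV j k0 F0 z = \sum_(j < 4) c' j *: DnV j k0 F0 z -> forall j, c j = c' j.
Proof.
move=> hz e j; have : \row_l c l *m wronskian k0 f z = \row_l c' l *m wronskian k0 f z.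
  apply/matrixP => o i; move/matrixP/(_ i ord0): e; rewrite !summxE !mxE.
  have h (d : 'I_4 -> C) : \sum_(l < 4) (d l *: DnV l k0 F0 z) i ord0 = \sum_l (\row_l d l) o l * wronskian k0 f z l i.
    by apply: eq_bigr => l _; rewrite !mxE -DnVE // mxE.
  by rewrite !h.
move/(congr1 (mulmxr (invmx (wronskian k0 f z)))); rewrite /= !mulmxK ?wr_unit //.
by move/matrixP/(_ ord0 j); rewrite !mxE.
Qed.

Lemma RC_le (x y : R) : (RC x <= RC y) = (x <= y).
Proof. by rewrite !RCE lecR. Qed.

Lemma moderate_growthP (h : C -> C) : (exists K Y : R, forall z, Y < ImC z -> nm (h z) <= K) ->
  moderate_growth h.
Proof.
move=> [K [Y hK]]; exists 1%N, (Num.max K Y) => x y; rewrite gt_max => /andP[y1 y2].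
by rewrite norm_nm RC_le expr1 (le_trans (hK _ _)) ?ImE // ltW.
Qed.

(** By [lam i >= 0] the factor [e(lam_i z)] is bounded on H. *)
Lemma Dg_bounded n i : exists K Y : R, forall z, Y < ImC z -> nm (Dg Defs.Pfun n k0 (f i) z) <= K.
Proof.
have [ha _ e] := qseries_Dg k0 n (F0_q i).
have [K [Y [K0 h]]] := limi_bound (limi_psum ha).
exists K, (Num.max Y 0) => z; rewrite gt_max => /andP[z1 z2].
rewrite e // nmM -[K]mul1r; apply: ler_pM; rewrite ?nm_ge0 ?h // nm_eC -[leRHS]exp.expR0 ler_expR.
rewrite oppr_le0 mulr_ge0 ?mulr_ge0 ?trigo.pi_ge0 // ImM ReRC ImRC mul0r addr0 mulr_ge0 ?(ltW z2) //.
by case/andP: (lam_bounds i).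
Qed.

Lemma Hspace_mul (j w : nat) M : Mform w%:Z M ->
  Hspace (k0 + w%:R + 2 * j%:R) rho0 ups (fun z => M z *: DnV j k0 F0 z).
Proof.
move=> hM; have pM := Mform_pol hM; have [c lM] := pol_limi pM; split; last first.
  move=> g z hg hz; rewrite /slash -/(jz g z) (pol_mob P_equivariant pM hg hz) DnV_mob //.
  rewrite !scalerA -scalemxAr; congr (_ *: _).
  rewrite cpowN ?jz_neq0 // -natrM !cpowDn ?jz_neq0 // /j0; field.
  by rewrite ups_neq0 // cpow_neq0 ?expf_neq0 ?jz_neq0.
move=> i; have e z : inH z -> vcomp (fun z => M z *: DnV j k0 F0 z) i z = M z * Dg Defs.Pfun j k0 (f i) z.
  by move=> hz; rewrite /vcomp !mxE -DnVE // mxE.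
split; first split.
- move=> z hz; have [l hl] := holC_eq e (holCM (pol_holC pM) (holC_Dg j k0 holC_P (@f_holC i))) hz.
  exact: isd_derivable hl.
- by move=> z hz; rewrite /vcomp DnV_off // scaler0 mxE.
apply: moderate_growthP; have [K1 [Y1 [K10 h1]]] := limi_bound lM; have [K2 [Y2 h2]] := Dg_bounded j i.
exists (K1 * K2), (Num.max (Num.max Y1 Y2) 0) => z; rewrite !gt_max => /andP[/andP[z1 z2] z3].
by rewrite e // nmM ler_pM ?nm_ge0 ?h1 ?h2.
Qed.

(** Under [z -> z + 1] each [D^l f_p] is multiplied by [e(lam_p)]; the invertible Wronskian at [i]
    turns this into an equation of matrices. *)
Lemma rho0_T i m : ups Tmat * rho0 Tmat i m = if m == i then eC (RC (lam i)) else 0.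
Proof.
have hi : inH iC by rewrite /inH Imi.
pose A := ups Tmat *: rho0 Tmat; pose B := \matrix_(i, m) if m == i then eC (RC (lam i)) else 0.
suff : A = B by move/matrixP/(_ i m); rewrite !mxE.
have : wronskian k0 f iC *m A^T = wronskian k0 f iC *m B^T.
  apply/matrixP => l p; have := Dg_mob_F0 l p inSL_T hi.
  rewrite mob_T jz_T expr1n mul1r /j0 jz_T cpow_1 mulr1.
  have [_ _ e] := qseries_Dg k0 l (F0_q p).
  have -> : Dg Defs.Pfun l k0 (f p) (iC + 1) = eC (RC (lam p)) * Dg Defs.Pfun l k0 (f p) iC.
    by rewrite !e ?inH_T // qC_shift mulrDr mulr1 eCD; ring.
  move=> e2; rewrite !mxE; transitivity (eC (RC (lam p)) * Dg Defs.Pfun l k0 (f p) iC).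
    by rewrite e2 big_distrr; apply: eq_bigr => q _; rewrite !mxE /=; ring.
  rewrite (bigD1 p) //= !mxE eqxx mulrC big1 ?addr0 // => q qp.
  by rewrite !mxE (negbTE qp) mulr0.
move/(congr1 (mulmx (invmx (wronskian k0 f iC)))); rewrite !mulKmx ?wr_unit //.
by move/(congr1 trmx); rewrite !trmxK.
Qed.

Section Coefficients.
Variables (n : int) (F : C -> 'cV[C]_4).
Hypothesis hF : Hspace (k0 + n%:~R) rho0 ups F.

(** The components of [F] with [q ^ lam_i] removed. The matrix [Y] is the Wronskian treated
    likewise, and [Yj] has [G] in row [j], as in Cramer's rule. In these normalised terms every
    entry has a limit at infinity. *)
Let G i z : C := F z i ord0 * eC (- (RC (lam i) * z)).
Let Y z : 'M[C]_4 := series_mx (fun l i => Dncoef (lam i) k0 l (ac i)) (qC z).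
Let Yj (j : 'I_4) z : 'M[C]_4 := \matrix_(l, i) if l == j then G i z else Y z l i.

Definition coefs (j : 'I_4) (z : C) : C := \det (Yj j z) / \det (Y z).

Lemma F_holC i : holC (fun z => F z i ord0).
Proof. by move=> z hz; eexists; apply: derivable_isd; have [/(_ i)[[h _] _] _] := hF; exact: h. Qed.

Lemma G_holC i : holC (G i).
Proof.
apply: holCM (F_holC i) _ => z hz; eexists; apply: isd_loc (isd_eC z (- RC (lam i))).
by apply: nb_true => w; rewrite mulNr.
Qed.

(** By [rho0_T] the function [G i] has period 1. Moderate growth bounds [q G i] by
    [y ^ N exp (- 2 pi (1 - lam i) y)], which tends to 0 because [lam i < 1]; so the singularity at
    [q = 0] is removable. *)
Lemma G_limi i : exists c, limi (G i) c.
Proof.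
pose G' z := if inH z then G i z else 0.
have FT z : inH z -> F (z + 1) i ord0 = eC (RC (lam i)) * F z i ord0.
  move=> hz; rewrite -mob_T (Hspace_mob hF inSL_T hz) jz_T exp1rz mul1r /j0 jz_T cpow_1 mulr1 !mxE.
  rewrite big_distrr (bigD1 i) //= mulrA rho0_T eqxx big1 ?addr0 // => m mi.
  by rewrite mulrA rho0_T (negbTE mi) mul0r.
have [||e e0|c [K [Z [K0 h]]]] := @periodic_limit G' 0.
- move=> z hz; have [l hl] := G_holC i hz; exists l; apply: isd_loc hl.
  by apply: nb_H => // w hw; rewrite /G' hw.
- move=> z; rewrite /G' inH_T; case: ifP => // hz.
  by rewrite /G FT // mulrDr mulr1 opprD eCD !eCN; field; rewrite !eC_neq0.
- have [/(_ i)[_ [N [c hN]]] _] := hF.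
  have [l0 l1] := andP (lam_bounds i).
  have p0 : 0 < 2 * pi * (1 - lam i) by rewrite mulr_gt0 ?subr_gt0 // mulr_gt0 ?pi_gt0.
  have [Z hZ] := pow_exp_small N p0 e0.
  exists (Num.max (Num.max Z c) 0) => z; rewrite !gt_max => /andP[/andP[z1 z2] z3].
  apply: le_lt_trans (hZ _ z1); rewrite /G' /inH z3 /G.
  have -> : qC z * (F z i ord0 * eC (- (RC (lam i) * z))) = F z i ord0 * (qC z * eC (- (RC (lam i) * z))) by ring.
  rewrite nmM -eCD nm_eC; apply: ler_pM; rewrite ?nm_ge0 ?expR_ge0 //.
    have := hN (ReC z) (ImC z) z2; rewrite norm_nm RC_le /vcomp; congr (nm (F _ _ _) <= _).
    by case: (z).
  rewrite ler_expR ImD ImN ImM ReRC ImRC mul0r addr0.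
  by move: pi => p; lra.
exists c, K, (Num.max Z 0); split=> // z; rewrite gt_max => /andP[z1 z2].
by have := h z z1; rewrite /G' /inH z2.
Qed.

Lemma Y_entry l i : holC (fun z => Y z l i) /\ exists c, limi (fun z => Y z l i) c.
Proof.
have [ha _ _] := qseries_Dg k0 l (F0_q i).
have e : (fun z => Y z l i) = (fun z => psum (Dncoef (lam i) k0 l (ac i)) (qC z)).
  by apply: funext => z; rewrite mxE.
rewrite e; split; last by eexists; exact: limi_psum.
by move=> z hz; eexists; exact: isd_psum_qC.
Qed.

Lemma holC_det m (A : C -> 'M[C]_m) : (forall i j, holC (fun z => A z i j)) -> holC (fun z => \det (A z)).
Proof.
move=> h z hz; eexists; apply: (isd_det (A' := \matrix_(i, j) 'D_1 (fun z => A z i j) z)) => i j.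
by rewrite mxE; apply: holC_isd (h i j) hz.
Qed.

Lemma detY_neq0 z : inH z -> \det (Y z) != 0.
Proof. by move=> hz; apply: series_det; exact: nm_qC_lt1. Qed.

Lemma coefs_holC j : holC (coefs j).
Proof.
apply: holC_div => [||z hz]; last exact: detY_neq0.
  apply: holC_det => l i; have [lj|lj] := eqVneq l j.
    by apply: holC_eq (G_holC i) => z _; rewrite mxE lj eqxx.
  by apply: holC_eq (Y_entry l i).1 => z _; rewrite mxE (negbTE lj).
by apply: holC_det => l i; exact: (Y_entry l i).1.
Qed.

(** The denominator tends to the value of the normalised determinant at [q = 0], which is not 0. *)
Lemma coefs_limi j : exists c, limi (coefs j) c.
Proof.
have lY : limi (fun z => \det (Y z)) (\det (series_mx (fun l i => Dncoef (lam i) k0 l (ac i)) 0)).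
  have n0 : nm 0 < 1 by rewrite nm0 ltr01.
  have ha l i : PSR (Dncoef (lam i) k0 l (ac i)) by have [] := qseries_Dg k0 l (F0_q i).
  by have [l hl] := series_mx_det ha n0; exact: limi_isd hl.
have n0 : nm 0 < 1 by rewrite nm0 ltr01.
have hG : exists B : 'M[C]_4, forall l i, limi (fun z => Yj j z l i) (B l i).
  have h l i : exists c, limi (fun z => Yj j z l i) c.
    have [lj|lj] := eqVneq l j.
      by have [c hc] := G_limi i; exists c; apply: limi_eq hc => z _; rewrite mxE lj eqxx.
    by have [c hc] := (Y_entry l i).2; exists c; apply: limi_eq hc => z _; rewrite mxE (negbTE lj).
  have [B hB] := choice (fun p : 'I_4 * 'I_4 => h p.1 p.2).
  by exists (\matrix_(l, i) B (l, i)) => l i; rewrite mxE; exact: (hB (l, i)).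
have [B hB] := hG; eexists.
exact: limiM (limi_det hB) (limiV lY (series_det n0)).
Qed.

Lemma coefs_sum z : inH z -> F z = \sum_(j < 4) coefs j z *: DnV j k0 F0 z.
Proof.
move=> hz; apply/matrixP => i o; rewrite (ord1 o) summxE.
have d0 := detY_neq0 hz.
have cr j : coefs j z = ((\row_i G i z) *m invmx (Y z)) ord0 j.
  rewrite /invmx unitmxE unitfE d0 -scalemxAr !mxE /coefs mulrC; congr (_ * _).
  rewrite (expand_det_row _ j); apply: eq_bigr => p _; rewrite !mxE eqxx; congr (_ * _).
  rewrite /cofactor; congr (_ * \det _); apply/matrixP => b c; rewrite !mxE.
  by rewrite eq_sym (negbTE (neq_lift _ _)).
have : ((\row_i G i z) *m invmx (Y z) *m Y z) ord0 i = G i z by rewrite mulmxKV ?mxE // unitmxE unitfE.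
rewrite mxE /G => e.
have {}e : F z i ord0 = (\sum_j coefs j z * Y z j i) * eC (RC (lam i) * z).
  by rewrite -(eq_bigr _ (fun j _ => congr1 (fun c => c * Y z j i) (esym (cr j)))) e eCN divfK // eC_neq0.
rewrite e big_distrl; apply: eq_bigr => j _; rewrite [RHS]mxE DnVE //.
by have [_ _ ->] := qseries_Dg k0 j (F0_q i) => //; rewrite mxE /=; ring.
Qed.

(** Expand [F (mob g z)] in two ways, cancel [rho0 g] and the automorphy factor of weight [k0], and
    use the independence of the [D^j F0] at the point [z]. *)
Lemma coefs_mob j g z : inSL g -> inH z ->
  coefs j (mob g z) = jz g z ^ (n - (2 * j)%N%:Z) * coefs j z.
Proof.
move=> hg hz; have J0 := jz_neq0 hg hz; have z0 := j0_neq0 hg hz.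
have := coefs_sum (mob_inH hg hz); rewrite (Hspace_mob hF hg hz) {1}(coefs_sum hz).
rewrite mulmx_sumr scaler_sumr => e.
have {}e : \sum_(j < 4) (jz g z ^ n * coefs j z) *: DnV j k0 F0 z =
   \sum_(j < 4) (jz g z ^+ (2 * j) * coefs j (mob g z)) *: DnV j k0 F0 z.
  apply: (can_inj (mulKmx (rho0_unit hg))); apply: (scalerI z0).
  rewrite !mulmx_sumr !scaler_sumr; transitivity (\sum_(i < 4) (jz g z ^ n * j0 g z) *: (rho0 g *m (coefs i z *: DnV i k0 F0 z))).
    by apply: eq_bigr => i _; rewrite -!scalemxAr !scalerA mulrCA mulrA.
  rewrite e; apply: eq_bigr => i _; rewrite DnV_mob // -!scalemxAr !scalerA; congr (_ *: _); ring.
have := DnV_free hz e j; rewrite expfzDr // -mulrAC => ->.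
by rewrite -exprnN mulrAC mulfV ?mul1r // expf_neq0.
Qed.

Lemma coefs_mf (j : 'I_4) : mf (n - (2 * j)%N%:Z) (coefs j).
Proof.
have [c hc] := coefs_limi j; apply: mf_of_mob (coefs_holC j) hc => g z hg hz; exact: coefs_mob.
Qed.

End Coefficients.


(** The coefficients have weights [n - 2 j], which are all negative in the first case and all odd in
    the second. *)
Lemma Hspace_vanish (n : int) F : (n < 0 \/ odd (absz n)) -> Hspace (k0 + n%:~R) rho0 ups F ->
  forall z, F z = 0.
Proof.
move=> hn hF z; have [hz|hz] := boolP (inH z); last first.
  apply/matrixP => i o; rewrite (ord1 o) mxE; have [/(_ i)[[_ h] _] _] := hF; exact: h.
rewrite (coefs_sum F hz) big1 // => j _; have hm := coefs_mf hF j.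
rewrite (_ : coefs _ j z = 0) ?scale0r //; case: hn => hn.
  have [m em] : exists m : nat, n - (2 * j)%N%:Z = - m.+1%:Z.
    by exists (`|n| + 2 * j).-1%N; lia.
  by rewrite em in hm; exact: mf_neg P_equivariant hm z hz.
have [m em] : exists m : int, n - (2 * j)%N%:Z = 2 * m + 1.
  exists (divz (n - 1) 2 - j%:Z); have := odd_double_half `|n|; rewrite hn; lia.
by rewrite em in hm; exact: mf_odd hm z hz.
Qed.

Lemma F0_Hspace : Hspace k0 rho0 ups F0.
Proof.
split; last by move=> g z hg hz; exact: F0_slash.
by move=> i; split; [exact: F0_hol|apply: moderate_growthP; exact: (Dg_bounded 0)].
Qed.

Lemma coefs_Mform (k : nat) F (hF : Hspace (k0 + 2 * k%:R) rho0 ups F) :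
  exists Ms : 'I_4 -> C -> C, (forall j : 'I_4, Mform ((2 * k)%N%:Z - (2 * j)%N%:Z) (Ms j)) /\
    forall z, inH z -> F z = \sum_(j < 4) Ms j z *: DnV j k0 F0 z.
Proof.
have hF' : Hspace (k0 + (2 * k)%N%:Z%:~R) rho0 ups F by rewrite -pmulrn natrM.
exists (coefs F); split; last exact: coefs_sum.
(* For [j > k] the weight is negative, so the coefficient vanishes. *)
move=> j; have hm := coefs_mf hF' j; have [jk|kj] := leqP j k.
  have e : (2 * k)%N%:Z - (2 * j)%N%:Z = (2 * (k - j))%N%:Z by lia.
  by rewrite e in hm *; exact: mf_Mform P_equivariant hm.
have e : (2 * k)%N%:Z - (2 * j)%N%:Z = - (2 * (j - k)).-1.+1%:Z by lia.
by apply: Mform_zero => z hz; rewrite e in hm; exact: mf_neg P_equivariant hm z hz.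
Qed.

Lemma coefs_unique (Ms : 'I_4 -> C -> C) z : inH z ->
  \sum_(j < 4) Ms j z *: DnV j k0 F0 z = 0 -> forall j, Ms j z = 0.
Proof.
move=> hz e; apply: (DnV_free (c' := fun=> 0) hz); rewrite e big1 // => j _.
by rewrite scale0r.
Qed.

Definition monomial (k t : nat) (z : C) : 'cV[C]_4 :=
  (E4 z ^+ exp_a k t * E6 z ^+ t./2) *: DnV (exp_j k t) k0 F0 z.

Lemma monomial_Hspace k t : (t < (2 * k) %/ 3 + 1)%N -> Hspace (k0 + 2 * k%:R) rho0 ups (monomial k t).
Proof.
move=> ht; have [e _ _] := exp_spec ht.
have hM : Mform (4 * exp_a k t + 6 * t./2)%N%:Z (fun z => E4 z ^+ exp_a k t * E6 z ^+ t./2).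
  by apply: (Mform_mono (x := 1) erefl) => z _; rewrite mul1r.
have := Hspace_mul (exp_j k t) hM; congr Hspace.
have -> : k = (2 * exp_a k t + 3 * t./2 + exp_j k t)%N by rewrite e.
by rewrite -!natrM -addrA -natrD; congr (_ + _%:R); rewrite e; lia.
Qed.

Definition spanned (k : nat) (F : C -> 'cV[C]_4) : Prop :=
  exists c : 'I_((2 * k) %/ 3 + 1) -> C, forall z, inH z -> F z = \sum_t c t *: monomial k t z.

Lemma spanned_zero k F : (forall z, inH z -> F z = 0) -> spanned k F.
Proof. by move=> h; exists (fun=> 0) => z hz; rewrite h // big1 // => t _; rewrite scale0r. Qed.

Lemma spanned_add k F G H : spanned k F -> spanned k G -> (forall z, inH z -> H z = F z + G z) ->
  spanned k H.
Proof.
move=> [c hc] [d hd] e; exists (fun t => c t + d t) => z hz; rewrite e // hc // hd // -big_split.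
by apply: eq_bigr => t _ /=; rewrite scalerDl.
Qed.

Lemma spanned_monomial k a b j x F : (2 * a + 3 * b + j = k)%N -> (j < 4)%N ->
  (forall z, inH z -> F z = (x * E4 z ^+ a * E6 z ^+ b) *: DnV j k0 F0 z) -> spanned k F.
Proof.
move=> e j4 h; have [ht ea eb ej] := exp_inv e j4.
exists (fun t => if t == Ordinal ht then x else 0) => z hz.
rewrite h // (bigD1 (Ordinal ht)) //= eqxx big1 ?addr0 => [|t /negbTE ->]; last by rewrite scale0r.
by rewrite /monomial /= ea eb ej scalerA mulrA.
Qed.

Lemma spanned_pol k w (j : 'I_4) M : pol w M -> (w + 2 * j = 2 * k)%N ->
  spanned k (fun z => M z *: DnV j k0 F0 z).
Proof.
elim=> [{}M e|a b x {}M ew e|g h {}M _ pg _ ph e] wk.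
- by apply: spanned_zero => z hz; rewrite e // scale0r.
- by apply: (@spanned_monomial k a b j x) => // [|z hz]; [lia|rewrite e].
by apply: spanned_add (pg wk) (ph wk) _ => z hz; rewrite e // scalerDl.
Qed.

Lemma monomial_span k F : Hspace (k0 + 2 * k%:R) rho0 ups F -> spanned k F.
Proof.
move=> hF; have [Ms [hM e]] := coefs_Mform hF.
have s : spanned k (fun z => \sum_(j < 4) Ms j z *: DnV j k0 F0 z).
  elim: (index_enum _) => [|j s IH].
    by apply: spanned_zero => z _; rewrite big_nil.
  apply: (spanned_add (F := fun z => Ms j z *: DnV j k0 F0 z) _ IH) => [|z _]; last by rewrite big_cons.
  have [jk|kj] := leqP j k.
    have ew : (2 * k)%N%:Z - (2 * j)%N%:Z = (2 * (k - j))%N%:Z by lia.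
    by have := hM j; rewrite ew => /Mform_pol /spanned_pol; apply; lia.
  have [c hc] := hM j; apply: spanned_zero => z hz.
  rewrite hc // big1 ?scale0r // => p _; rewrite big1 // => q _.
  by case: eqP => //; lia.
by have [c hc] := s; exists c => z hz; rewrite e // hc.
Qed.

(** For independence, a relation splits according to [j], because [F0, .., D^3 F0] are independent
    at every point. For fixed [j] the sum [2 a + 3 b = k - j] is fixed, so [a + b] distinguishes the
    monomials and [monomials_free] applies. *)
Lemma Hspace_dim k : has_dim (Hspace (k0 + 2 * k%:R) rho0 ups) ((2 * k) %/ 3 + 1)%N.
Proof.
exists (fun t => monomial k t); split; [by move=> t; exact: monomial_Hspace|move=> c hc|exact: monomial_span].
move=> t; have [_ ej _] := exp_spec (ltn_ord t); pose j := Ordinal ej.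
apply: (@monomials_free _ [pred s | exp_j k (nat_of_ord s) == j] c (fun s => exp_a k s) (fun s => s./2)
   (k - j)%N P_equivariant) => [s /eqP hs|s s' /eqP hs /eqP hs' es|z hz|].
- by have [es _ _] := exp_spec (ltn_ord s); lia.
- apply/val_inj; have [e1 _ f1] := exp_spec (ltn_ord s); have [e2 _ f2] := exp_spec (ltn_ord s').
  by rewrite hs in e1 f1; rewrite hs' in e2 f2; rewrite /= f1 f2; lia.
- have := coefs_unique (Ms := fun i z =>
     \sum_(s < (2 * k) %/ 3 + 1 | exp_j k s == i) c s * (E4 z ^+ exp_a k s * E6 z ^+ s./2)) hz.
  move=> /(_ _ j); apply; rewrite -[RHS](hc z hz).
  under [LHS]eq_bigr => i _ do rewrite scaler_suml.
  rewrite (exchange_big_dep xpredT) //=; apply: eq_bigr => s _.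
  have [_ sj _] := exp_spec (ltn_ord s).
  rewrite (big_pred1 (Ordinal sj)) => [|i]; last by apply/eqP/eqP => [e|-> //]; exact/val_inj.
  by rewrite /monomial scalerA.
exact: eqxx.
Qed.

End Solutions.

Theorem theorem4p11
  (rho : 'M[int]_2 -> 'M[C]_4) (ups : 'M[int]_2 -> C) (m : R) (r : 'I_4 -> R)
  (M4 M6 M8 : C -> C) (F0 : C -> 'cV[C]_4) (rho0 : 'M[int]_2 -> 'M[C]_4) :
  is_rep rho -> T_determined rho -> T_unitarizable rho ->
  (* the (distinct) eigenvalues e(r_1),...,e(r_4) of rho(T), 0 <= r_1 < ... < r_4 < 1 *)
  0 <= r ord0 -> (forall i j : 'I_4, (i < j)%N -> r i < r j) -> (forall i, r i < 1) ->
  char_poly (rho Tmat) = \prod_(j < 4) ('X - (eC (RC (r j)))%:P) ->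
  cusp_parameter ups m ->
  let lam := fun j : 'I_4 => fracR (r j + m / 12) in
  let k0 := 3 * (\sum_(j < 4) lam j) - 3 in
  multiplier_system k0 ups ->
  (* L = D^4 + M4 D^2 + M6 D + M8 : the 4th order MLDE in weight k0 with
     indicial roots lam_1..lam_4, and F0 = (f_1,..,f_4)^t its fundamental system *)
  is_mlde4 M4 M6 M8 ->
  (forall j, indicial_root k0 M4 M6 M8 (lam j)) ->
  fundamental_system k0 M4 M6 M8 (vcomp F0) ->
  (forall j, qexp_form (lam j) (vcomp F0 j)) ->
  (* rho0 : F0 |_{k0}^ups g = rho0(g) F0 *)
  (forall g z, inSL g -> inH z -> slash k0 ups g F0 z = rho0 g *m F0 z) ->
  (* (i) *)
  [/\ ((forall n : int, (n < 0 \/ odd (absz n)) ->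
          forall F, Hspace (k0 + n%:~R) rho0 ups F -> forall z, F z = 0) /\
       Hspace k0 rho0 ups F0 /\
       exists N4 N6 N8, is_mlde4 N4 N6 N8 /\ fundamental_system k0 N4 N6 N8 (vcomp F0)),
      (* (ii) free M-module with basis F0, DF0, D^2F0, D^3F0 *)
      [/\ (forall (j : 'I_4) (w : nat) (M : C -> C), Mform w%:Z M ->
             Hspace (k0 + w%:R + 2 * j%:R) rho0 ups (fun z => M z *: DnV j k0 F0 z)),
          (forall (k : nat) F, Hspace (k0 + 2 * k%:R) rho0 ups F ->
             exists Ms : 'I_4 -> C -> C,
               (forall j : 'I_4, Mform ((2 * k)%N%:Z - (2 * j)%N%:Z) (Ms j)) /\
               forall z, inH z -> F z = \sum_(j < 4) Ms j z *: DnV j k0 F0 z) &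
          (forall (k : nat) (Ms : 'I_4 -> C -> C),
             (forall j : 'I_4, Mform ((2 * k)%N%:Z - (2 * j)%N%:Z) (Ms j)) ->
             (forall z, inH z -> \sum_(j < 4) Ms j z *: DnV j k0 F0 z = 0) ->
             forall j z, inH z -> Ms j z = 0)],
      (* (iii) H(rho0, ups) = R F0 *)
      (forall (j w : nat) (M : C -> C), Mform w%:Z M ->
          Hspace (k0 + w%:R + 2 * j%:R) rho0 ups (fun z => M z *: DnV j k0 F0 z)) /\
      (forall (k : nat) F, Hspace (k0 + 2 * k%:R) rho0 ups F ->
          exists (J : nat) (Ms : nat -> C -> C),
            (forall j : nat, Mform ((2 * k)%N%:Z - (2 * j)%N%:Z) (Ms j)) /\
            forall z, inH z -> F z = \sum_(j < J) Ms j z *: DnV j k0 F0 z) &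
      (* (iv) *)
      forall k : nat, has_dim (Hspace (k0 + 2 * k%:R) rho0 ups) ((2 * k) %/ 3 + 1)%N].
Proof.
move=> _ _ _ r0 r_lt r1 _ _ lam k0 [ups1 _] hM _ hF hq hslash; have [hsol _ _] := hF.
have r_bounds i : 0 <= r i < 1.
  rewrite r1 andbT; have [->//|i0] := eqVneq i ord0.
  by apply: (le_trans r0); apply/ltW/r_lt; rewrite /= lt0n.
(* [r j - r i] lies strictly between 0 and 1, so it is not a difference of two integral parts. *)
have lam_inj : injective lam.
  have lt (i j : 'I_4) : (i < j)%N -> lam i = lam j -> False.
    rewrite /lam /fracR => ij; have lt_r := r_lt _ _ ij.
    have /andP[b1 _] := r_bounds i; have /andP[_ b2] := r_bounds j.
    set x := Num.floor _; set y := Num.floor _ => e.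
    have ed : (y - x)%:~R = r j - r i by rewrite rmorphB /=; lra.
    have p0 : 0 < y - x by rewrite -(ltr0z R) ed subr_gt0.
    have p1 : y - x < 1 by rewrite -(ltr_int R) ed; lra.
    by lia.
  by move=> i j e; apply/val_inj; case: (ltngtP i j) => // ij; [case: (lt i j)|case: (lt j i)].
have lam_bounds i : 0 <= lam i < 1.
  have := floor_itv (r i + m / 12); rewrite intrD1 /lam /fracR => /andP[l1 l2].
  by rewrite subr_ge0 l1 /= ltrBlDl.
have ups_neq0 g : inSL g -> ups g != 0.
  by move=> /ups1; apply: contra_eq_neq => ->; rewrite normr0 eq_sym oner_eq0.
have [ac hac] := choice (fun i => qexp_qseries (hq i)).
have F0_hol i := (hsol i).1.
have F0_mlde i := (hsol i).2.
have mulH := Hspace_mul (erefl k0) lam_inj lam_bounds ups_neq0 F0_hol F0_mlde hac hslash.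
have expand := coefs_Mform (erefl k0) lam_inj lam_bounds ups_neq0 F0_mlde hac hslash.
split; last exact: (Hspace_dim (erefl k0) lam_inj lam_bounds ups_neq0 F0_hol F0_mlde hac hslash).
- split.
    by move=> n hn G; exact: (Hspace_vanish (erefl k0) lam_inj lam_bounds ups_neq0 F0_mlde hac hslash).
  split; first exact: (F0_Hspace lam_bounds F0_hol hac hslash).
  by exists M4, M6, M8.
- split; [by move=> j w M; exact: mulH|by move=> k G; exact: expand|].
  by move=> k Ms _ e j z hz; exact: (coefs_unique (erefl k0) lam_inj F0_mlde hac hz (e z hz)).
split; first by move=> j w M; exact: mulH.
move=> k G /expand[Ms [hMs e]].
(* The four coefficients are continued by 0, so that the family is indexed by all natural
   numbers. *)
exists 4%N, (fun j => if (j < 4)%N then Ms (inord j) else fun=> 0); split => [j|z hz].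
  case: ifP => [j4|_]; last exact: Mform_zero.
  by have := hMs (inord j); rewrite inordK.
by rewrite e //; apply: eq_bigr => j _; rewrite ltn_ord inord_val.
Qed.
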